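(* Let $X$ be a Banach space with $n(X)>0$ such that $\mathcal{K}_v(X)$ is an M-ideal in $\mathcal{L}_v(X)$. (1) For $T\in\mathcal{L}_v(X)$, if $T^*$ does not attain its numerical radius, then $v(T)=v_e(T)$. (2) The set of operators in $\mathcal{L}_v(X)$ whose adjoint operators do not attain their numerical radius is nowhere dense in $\mathcal{L}_v(X)$.
   Context: Banach spaces are over $\mathbb{K}=\mathbb{R}$ or $\mathbb{C}$; $S_X$ denotes the unit sphere of $X$. $\mathcal{L}(X)$ is the space of bounded linear operators on $X$ and $\mathcal{K}(X)$ its subspace of compact operators. Put $\Pi(X)=\{(x^*,x)\in S_{X^*}\times S_X: x^*(x)=1\}$. The numerical radius of $T\in\mathcal{L}(X)$ is $v(T)=\sup\{|x^*(Tx)|:(x^*,x)\in\Pi(X)\}$, and $T$ attains its numerical radius if $|x^*(Tx)|=v(T)$ for some $(x^*,x)\in\Pi(X)$; these notions are applied likewise to $T^*\in\mathcal{L}(X^* )$, with $\Pi(X^* )\subseteq S_{X^{**}}\times S_{X^*}$. The numerical index of $X$ is $n(X)=\inf\{v(T):T\in\mathcal{L}(X),\ \|T\|=1\}$. If $n(X)>0$, then $v$ is a norm on $\mathcal{L}(X)$ equivalent to the operator norm; $\mathcal{L}_v(X)$ and $\mathcal{K}_v(X)$ denote $\mathcal{L}(X)$ and $\mathcal{K}(X)$ equipped with the norm $v$. The essential numerical radius is $v_e(T)=\inf_{K\in\mathcal{K}(X)}v(T-K)$. A closed subspace $J$ of a Banach space $Z$ is an M-ideal in $Z$ if $Z^*=J^*\oplus_1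 J^\perp$, i.e. the annihilator $J^\perp$ is the kernel of a linear projection $P$ on $Z^*$ with $\|z^*\|=\|Pz^*\|+\|z^*-Pz^*\|$ for all $z^*\in Z^*$ (the range of $P$ then being identified isometrically with $J^*$). *)

(* Defs.v *)
From HB Require Import structures.
From mathcomp Require Import all_boot all_order all_algebra.
From mathcomp Require Import complex.
From mathcomp Require Import all_classical all_reals.
From mathcomp Require Import topology normedtype.
Import Order.TTheory GRing.Theory Num.Theory.
Import numFieldNormedType.Exports.

Set Implicit Arguments.
Unset Strict Implicit.
Unset Printing Implicit Defensive.

Local Open Scope classical_set_scope.
Local Open Scope complex_scope.
Local Open Scope ring_scope.

Variant scalar_kind := RealScalars | ComplexScalars.

Definition scalars (R : realType) (k : scalar_kind) : numFieldType :=
  match k with RealScalars => R | ComplexScalars => R[i] end.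

(* Norms take their values in the scalar field, so for complex scalars the
   order below is the partial order of [R[i]], in which comparable numbers have
   the same imaginary part; on sets of nonnegative elements, suprema and infima
   for that order are those of the real numbers. *)
Lemma supremums_scalars (R : realType) (k : scalar_kind)
    (A : set (scalars R k)) :
  A !=set0 -> (forall x, A x -> 0 <= x) -> has_ubound A ->
  supremums A !=set0.
Proof.
case: k A => /= A A0 Age0 Aub.
  exists (sup A); split; first by apply: ub_le_sup.
  by move=> y yA; apply: ge_sup.
case: Aub => M MA.
pose B := [set complex.Re x | x in A].
have AE x : A x -> x = (complex.Re x)%:C.
  by move=> /Age0; rewrite lecE /= => /andP[/eqP + _]; case: x => a b /= ->.
have Bub : has_ubound B.
  exists (complex.Re M) => _ [x Ax <-].
  by have := MA _ Ax; rewrite lecE => /andP[].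
have B0 : B !=set0 by case: A0 => x Ax; exists (complex.Re x), x.
exists (sup B)%:C; split.
  move=> x Ax; rewrite [x]AE// lecR; apply: ub_le_sup => //.
  by exists x.
move=> y yA.
have yE : y = (complex.Re y)%:C.
  case: A0 => x Ax; have := yA _ Ax; rewrite [x]AE// lecE /=.
  by move=> /andP[/eqP + _]; case: y {yA} => a b /= ->.
rewrite yE lecR; apply: ge_sup => // _ [x Ax <-].
by have := yA _ Ax; rewrite lecE => /andP[].
Qed.

Section SupSeminorm.
Variables (R : realType) (k : scalar_kind).
Local Notation K := (scalars R k).
Variables (E : lmodType K) (I : Type) (D : set I) (q : I -> E -> K).
Hypothesis q_ge0 : forall i x, 0 <= q i x.
Hypothesis qD : forall i x y, q i (x + y) <= q i x + q i y.
Hypothesis qZ : forall i l x, q i (l *: x) = `|l| * q i x.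
Hypothesis q_bd : forall x, exists M, forall i, D i -> q i x <= M.

Local Notation p x := (supremum 0 [set q i x | i in D]).

Lemma sup_seminormP x : ([set q i x | i in D] = set0 /\ p x = 0) \/
  supremums [set q i x | i in D] (p x).
Proof.
have [->|/set0P A0] := eqVneq [set q i x | i in D] set0.
  by left; rewrite supremum0.
right; rewrite /supremum ifF; last exact/negbTE/set0P.
case: xgetP => [//|noSup]; exfalso.
have [|||y] := @supremums_scalars R k [set q i x | i in D] => //.
- by move=> _ [i _ <-].
- by have [M Mq] := q_bd x; exists M => _ [i Di <-]; exact: Mq.
- exact: noSup.
Qed.

Lemma sup_seminorm_ub x i : D i -> q i x <= p x.
Proof.
move=> Di; case: (sup_seminormP x) => [[A0 _]|[+ _]]; last first.
  by apply; exists i.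
by exfalso; have : set0 (q i x); [rewrite -A0; exists i|].
Qed.

Lemma sup_seminorm_le x M :
  0 <= M -> (forall i, D i -> q i x <= M) -> p x <= M.
Proof.
move=> M0 Mq; case: (sup_seminormP x) => [[_ ->//]|[_]]; apply.
by move=> _ [i Di <-]; exact: Mq.
Qed.

Lemma sup_seminorm_ge0 x : 0 <= p x.
Proof.
have [A0|/set0P[_ [i Di _]]] := eqVneq [set q i x | i in D] set0.
  by rewrite A0 supremum0.
exact: le_trans (q_ge0 i x) (sup_seminorm_ub x Di).
Qed.

Lemma sup_seminormD x y : p (x + y) <= p x + p y.
Proof.
apply: sup_seminorm_le => [|i Di]; first by rewrite addr_ge0 ?sup_seminorm_ge0.
by apply: (le_trans (qD i x y)); apply: lerD; exact: sup_seminorm_ub.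
Qed.

Lemma sup_seminormZ l x : p (l *: x) = `|l| * p x.
Proof.
have leZ l' x' : p (l' *: x') <= `|l'| * p x'.
  apply: sup_seminorm_le => [|i Di]; first by rewrite mulr_ge0 ?sup_seminorm_ge0.
  by rewrite qZ ler_wpM2l// sup_seminorm_ub.
apply/eqP; rewrite eq_le leZ /=.
have [->|l0] := eqVneq l 0; first by rewrite normr0 mul0r sup_seminorm_ge0.
rewrite -ler_pdivlMl ?normr_gt0//.
by have := leZ l^-1 (l *: x); rewrite scalerA mulVf// scale1r normfV.
Qed.

End SupSeminorm.

Section BoundedLinear.
Variables (R : realType) (k : scalar_kind).
Local Notation K := (scalars R k).
Variables V W : normedModType K.

Definition bounded_linear (f : V -> W) : Prop :=
  linear f /\ exists M : K, forall x, `|f x| <= M * `|x|.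

Definition blin_pred : {pred V -> W} := mem [set f | bounded_linear f].

Record blin := BLin { blin_fun :> V -> W; _ : blin_fun \in blin_pred }.

HB.instance Definition _ := [isSub for blin_fun].
HB.instance Definition _ := [Choice of blin by <:].

Lemma blinP (f : blin) : bounded_linear f.
Proof. by case: f => f /= /set_mem. Qed.

Lemma blin_submod_closed : submod_closed blin_pred.
Proof.
split.
  apply/mem_set; split; last by exists 0 => x; rewrite mul0r normr0.
  by move=> a x y; rewrite scaler0 addr0.
move=> l f g /set_mem[linf [Mf fb]] /set_mem[ling [Mg gb]]; apply/mem_set; split.
  move=> a x y; rewrite /= !fctE linf ling !scalerDr !scalerA mulrC.
  by rewrite addrACA.
exists (`|l| * Mf + Mg) => x; rewrite !fctE.
apply: (le_trans (ler_normD _ _)); rewrite mulrDl lerD// normrZ -mulrA.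
by rewrite ler_wpM2l.
Qed.

HB.instance Definition _ :=
  GRing.isSubmodClosed.Build K (V -> W) blin_pred blin_submod_closed.
HB.instance Definition _ := [SubChoice_isSubLmodule of blin by <:].

HB.instance Definition _ (f : blin) :=
  GRing.isLinear.Build K V W _ (blin_fun f) (proj1 (blinP f)).

Lemma blinDE (f g : blin) x : (f + g) x = f x + g x.
Proof. by []. Qed.

Lemma blinZE (l : K) (f : blin) x : (l *: f) x = l *: f x.
Proof. by []. Qed.

Definition op_norm (T : blin) : K :=
  supremum 0 [set `|T x| | x in [set x : V | `|x| <= 1]].

Let opD (x : V) (S T : blin) : `|(S + T) x| <= `|S x| + `|T x|.
Proof. by rewrite blinDE ler_normD. Qed.

Let opZ (x : V) (l : K) (T : blin) : `|(l *: T) x| = `|l| * `|T x|.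
Proof. by rewrite blinZE normrZ. Qed.

Let op_bd (T : blin) :
  exists M : K, forall x : V, `|x| <= 1 -> `|T x| <= M.
Proof.
have [_ [M TM]] := blinP T; exists `|M| => x x1.
have M0 : 0 <= M * `|x| by exact: le_trans (TM x).
apply: (le_trans (TM x)); rewrite -[leLHS]ger0_norm// normrM normr_id.
by rewrite ler_piMr.
Qed.

Let op_ge0 (x : V) (T : blin) : 0 <= `|T x|.
Proof. exact: normr_ge0. Qed.

Lemma op_norm_ge0 T : 0 <= op_norm T.
Proof. exact: (sup_seminorm_ge0 op_ge0 op_bd). Qed.

Lemma le_op_norm (T : blin) x : `|T x| <= op_norm T * `|x|.
Proof.
have [->|x0] := eqVneq x 0; first by rewrite linear0 !normr0 mulr0.
have nx0 : `|x| != 0 by rewrite normr_eq0.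
rewrite -ler_pdivrMr ?normr_gt0// mulrC.
have -> : `|x|^-1 * `|T x| = `|T (`|x|^-1 *: x)|.
  by rewrite linearZ normrZ normfV normr_id.
apply: (sup_seminorm_ub op_ge0 op_bd) => /=.
by rewrite normrZ normfV normr_id mulVf.
Qed.

Let op_normD S T : op_norm (S + T) <= op_norm S + op_norm T.
Proof. exact: (sup_seminormD op_ge0 opD op_bd). Qed.

Let op_normZ l T : op_norm (l *: T) = `|l| * op_norm T.
Proof. exact: (sup_seminormZ op_ge0 opZ op_bd). Qed.

Let op_norm_eq0 T : op_norm T = 0 -> T = 0.
Proof.
move=> T0; apply/val_inj/funext => x /=.
by have := le_op_norm T x; rewrite T0 mul0r normr_le0 => /eqP.
Qed.

HB.instance Definition _ :=
  Lmodule_isNormed.Build K blin op_normD op_normZ op_norm_eq0.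

End BoundedLinear.

Definition dual (R : realType) (k : scalar_kind)
    (V : normedModType (scalars R k)) :=
  blin V (scalars R k)^o.

Section Adjoint.
Variables (R : realType) (k : scalar_kind).
Local Notation K := (scalars R k).
Variables (V W : normedModType K) (T : blin V W).

Lemma adjoint_fun_subproof (f : dual W) : f \o T \in @blin_pred R k V K^o.
Proof.
apply/mem_set; split; first by move=> a x y; rewrite /= !linearP.
exists (op_norm f * op_norm T) => x /=.
apply: (le_trans (le_op_norm _ _)).
by rewrite -mulrA ler_wpM2l ?op_norm_ge0 ?le_op_norm.
Qed.

Definition adjoint_fun (f : dual W) : dual V := BLin (adjoint_fun_subproof f).

Lemma adjoint_subproof : adjoint_fun \in @blin_pred R k (dual W) (dual V).
Proof.
apply/mem_set; split; first by move=> a f g; apply/val_inj.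
exists (op_norm T) => f.
have T0 := op_norm_ge0 T; have f0 := op_norm_ge0 f.
rewrite /Num.norm /= -/(op_norm f).
have bd x : `|x| <= 1 -> `|adjoint_fun f x| <= op_norm T * op_norm f.
  move=> x1; apply: (le_trans (le_op_norm f (T x))).
  rewrite [leRHS]mulrC ler_wpM2l//; apply: (le_trans (le_op_norm _ _)).
  by rewrite ler_piMr.
rewrite /op_norm /supremum; case: ifPn => _; first exact: mulr_ge0.
case: xgetP => [y _ [_]|_]; last exact: mulr_ge0.
by apply => _ [x x1 <-]; exact: bd.
Qed.

Definition adjoint : blin (dual W) (dual V) := BLin adjoint_subproof.

(* [precompact A] means that the closure of [A] is compact. *)
Definition compact_operator : Prop :=
  precompact (T @` [set x : V | `|x| <= 1]).

End Adjoint.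

Section NumericalRadius.
Variables (R : realType) (k : scalar_kind).
Local Notation K := (scalars R k).
Variable V : normedModType K.
Implicit Types S T : blin V V.

Definition numerical_pairs : set (dual V * V) :=
  [set fx : dual V * V | [/\ `|fx.1| = 1, `|fx.2| = 1 & fx.1 fx.2 = 1]].

Definition numerical_radius T : K :=
  supremum 0 [set `|fx.1 (T fx.2)| | fx in numerical_pairs].

Definition attains_numerical_radius T : Prop :=
  exists2 fx, numerical_pairs fx & `|fx.1 (T fx.2)| = numerical_radius T.

(* For the zero space the set below is empty and the value is 0. *)
Definition numerical_index : K :=
  infimum 0 [set numerical_radius T | T in [set T : blin V V | `|T| = 1]].

Definition essential_numerical_radius T : K :=
  infimum 0 [set numerical_radius (T - S) | S in @compact_operator R k V V].

Let nq (fx : dual V * V) T : K := `|fx.1 (T fx.2)|.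

Let nD fx S T : nq fx (S + T) <= nq fx S + nq fx T.
Proof. by rewrite /nq blinDE linearD ler_normD. Qed.

Let nZ fx l T : nq fx (l *: T) = `|l| * nq fx T.
Proof. by rewrite /nq blinZE linearZ normrZ. Qed.

Let n_bd T : exists M : K, forall fx, numerical_pairs fx -> nq fx T <= M.
Proof.
exists (op_norm T) => -[f x] [/= f1 x1 _].
apply: (le_trans (le_op_norm _ _)).
have -> : op_norm f = 1 by [].
by rewrite mul1r; have := le_op_norm T x; rewrite x1 mulr1.
Qed.

Let n_ge0 fx T : 0 <= nq fx T.
Proof. exact: normr_ge0. Qed.

Lemma numerical_radius_ge0 T : 0 <= numerical_radius T.
Proof. exact: (sup_seminorm_ge0 n_ge0 n_bd). Qed.

Lemma numerical_radiusD S T :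
  numerical_radius (S + T) <= numerical_radius S + numerical_radius T.
Proof. exact: (sup_seminormD n_ge0 nD n_bd). Qed.

Lemma numerical_radiusZ l T :
  numerical_radius (l *: T) = `|l| * numerical_radius T.
Proof. exact: (sup_seminormZ n_ge0 nZ n_bd). Qed.

Lemma numerical_radius_eq0 T :
  0 < numerical_index -> numerical_radius T = 0 -> T = 0.
Proof.
move=> n0 vT0; apply/eqP; apply/negPn/negP => T0.
have nT0 : `|T| != 0 by rewrite normr_eq0.
suff : numerical_index <= 0 by move=> /(lt_le_trans n0); rewrite ltxx.
have A0 : [set numerical_radius S | S in [set S : blin V V | `|S| = 1]] 0.
  exists (`|T|^-1 *: T); last by rewrite numerical_radiusZ vT0 mulr0.
  by rewrite /= normrZ normfV normr_id mulVf.
rewrite /numerical_index /infimum; case: ifPn => // _.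
by case: xgetP => // y _ [+ _]; apply.
Qed.

End NumericalRadius.

Section NumericalRadiusSpace.
Variables (R : realType) (k : scalar_kind).
Local Notation K := (scalars R k).
Variables (V : normedModType K) (n_gt0 : 0 < numerical_index V).

Definition Lv & 0 < numerical_index V : Type := blin V V.

HB.instance Definition _ := GRing.Lmodule.copy (Lv n_gt0) (blin V V).
HB.instance Definition _ :=
  Lmodule_isNormed.Build K (Lv n_gt0) (@numerical_radiusD R k V)
    (@numerical_radiusZ R k V)
    (fun T => @numerical_radius_eq0 R k V T n_gt0).

Definition Kv : set (Lv n_gt0) := [set T | compact_operator T].

End NumericalRadiusSpace.

Arguments Kv {R k V} n_gt0 _.

Section MIdeal.
Variables (R : realType) (k : scalar_kind).
Local Notation K := (scalars R k).
Variable Z : normedModType K.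

Definition annihilator (J : set Z) : set (dual Z) :=
  [set f | forall z, J z -> f z = 0].

Definition closed_subspace (J : set Z) : Prop :=
  [/\ J 0, forall (a : K) x y, J x -> J y -> J (a *: x + y) & closed J].

Definition M_ideal (J : set Z) : Prop :=
  closed_subspace J /\
  exists P : {linear dual Z -> dual Z},
    [/\ forall f, P (P f) = P f,
        [set f | P f = 0] = annihilator J
      & forall f, `|f| = `|P f| + `|f - P f| ].

End MIdeal.

Definition nowhere_dense (T : topologicalType) (A : set T) : Prop :=
  interior (closure A) = set0.

(* Main.v *)
Require Import Defs.
From HB Require Import structures.
From mathcomp Require Import all_boot all_order all_algebra.
From mathcomp Require Import complex.
From mathcomp Require Import all_classical all_reals.
From mathcomp Require Import topology normedtype.
From mathcomp Require Import ring lra zify.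
Import Order.TTheory GRing.Theory Num.Theory.
Import numFieldNormedType.Exports.

(** Let v be the numerical radius, Z the space of operators normed by v, J its
    subspace of compact operators, and P the projection of the dual of Z whose
    kernel is the annihilator of J.  For y in X** and g in X*, [mcoef] is the
    functional T |-> y (T^* g) on Z.

    Everything rests on [adjoint_attains]: if v (T - S) < v T for some compact
    S, then T^* attains its numerical radius.  An operator whose adjoint does
    not attain therefore has v T <= v (T - S) for all compact S, which is the
    first claim.  This condition is closed, and it fails somewhere in every
    ball, because adding a small multiple of a suitable rank one operator
    x^* (.) x increases v; this is the second claim.

    To prove [adjoint_attains], take limits along an ultrafilter on the pairs
    (x^*, x) with |x^* (T x)| close to v T ([attaining_limit]): a functional f
    on Z with norm 1, f I = 1 and |f T| = v T, a limit y of the x in X**, and a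
    limit g of the x^* in X*.  Since |f (T - S)| <= v (T - S) < v T, the
    L-decomposition leaves only P f = f ([state_in_range]).  On a compact
    operator the limits may be taken one after the other, so f and mcoef y g
    agree on J, that is, P (mcoef y g) = f.  If y g = 1, then (y, g) is a pair
    for X*, mcoef y g has norm at most 1 ([adjoint_pair_le]), and the equality
    |mcoef y g| = |f| + |mcoef y g - f| gives mcoef y g = f; thus
    |y (T^* g)| = v T.

    The hard point is y g = 1 ([compact_state_pairing]).  It is measured by the
    operator B on X** defined by (B y) g = y g - P (mcoef y g) I, since here
    (B y) g = y g - 1.  Separation in Z x K turns the L-projection into
    operators ([compact_near_identity]): for a compact K0 with v K0 <= 1 and
    lam = 1 or -1 there is a compact L with v (K0 + lam (I - L)) <= 1 + eps
    and mcoef y g L close to P (mcoef y g) I.  An operator A with numerical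
    range in a half plane Re <= mu satisfies
    |I + h A| <= (1 + h^2 |A|^2) / (1 - h mu), hence
    I + h (K0 + lam (I - L) - I) has norm at most 1 + O(h^2).  Choosing K0 of
    rank one gives two facts.  First, |y + s B y| <= (1 + O(s^2)) |y|, so B
    generates an almost isometric flow.  Second, if Re (y ((I + H)^* g)) <= gam
    for all compact H with |I + H| <= 1 + eta + O(h^2), then the same holds
    with 1 + eta for y + h (k - y + B y), for every k with |k| <= |y|.

    These moves reach all radial directions ([radial_bound]).  For q close to
    a = y / |y|, let b be the image of q under the backward flow for a long
    time, follow the chord from a to b while dividing its points by a sliding
    average of their norms, and compose with the forward flow: each step is,
    up to second order, one of the above moves, and the walk ends at a multiple
    of q.  So Re (q g) <= (Re (a g)) |q| when the bound at a is Re (a g).  For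
    q = a - t B a, where |q| = 1 + O(t^2) but Re (q g) has slope
    1 - Re (a g) in t (after a normalization that makes a g = y g), letting
    t tend to 0 gives Re (y g) >= 1, and |y g| <= |y| |g| <= 1. *)

Set Implicit Arguments.
Unset Strict Implicit.
Unset Printing Implicit Defensive.
Local Open Scope classical_set_scope.
Local Open Scope ring_scope.

(** * Averages of a norm along a chord *)

Lemma lincomb2_diff (R : pzRingType) (E : lmodType R) (al be p q l m : R)
    (u d : E) :
  al *: (u + l *: d) - (p *: (q *: u) + be *: (u + m *: d)) =
  (al - p * q - be) *: u + (al * l - be * m) *: d.
Proof.
rewrite !scalerDr !scalerA !scalerBl !opprD -!addrA; congr (_ + _).
by rewrite [LHS]addrCA; congr (_ + _); rewrite addrCA.
Qed.

Lemma exprn_1D_le (R : realFieldType) (y : R) n :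
  0 <= y -> 2 * (n%:R * y) <= 1 -> (1 + y) ^+ n <= 1 + 2 * (n%:R * y).
Proof.
move=> y0; elim: n => [|n IH] ny; first by rewrite mul0r mulr0 addr0.
have ny' : 2 * (n%:R * y) <= 1.
  apply: le_trans ny; rewrite ler_pM2l// ler_wpM2r// ler_nat.
  exact: leqnSn.
rewrite exprSr -natr1.
have y1 : 0 <= 1 + y by lra.
apply: (le_trans (ler_wpM2r y1 (IH ny'))).
have := ler_wpM2r y0 ny'; lra.
Qed.

Section Seminorm.
Variables (R : realFieldType) (E : lmodType R) (nu : E -> R).
Hypothesis nuD : forall x y, nu (x + y) <= nu x + nu y.
Hypothesis nuZ : forall l x, nu (l *: x) = `|l| * nu x.

Lemma seminorm0 : nu 0 = 0.
Proof. by rewrite -(scale0r 0) nuZ normr0 mul0r. Qed.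

Lemma seminormN x : nu (- x) = nu x.
Proof. by rewrite -scaleN1r nuZ normrN1 mul1r. Qed.

Lemma seminorm_ge0 x : 0 <= nu x.
Proof. by have := nuD x (- x); rewrite subrr seminorm0 seminormN; lra. Qed.

Lemma seminormBC x y : nu (x - y) = nu (y - x).
Proof. by rewrite -seminormN opprB. Qed.

Lemma seminorm_le_dist x y : nu x <= nu y + nu (x - y).
Proof. by have := nuD y (x - y); rewrite addrC subrK. Qed.

Lemma seminorm_dist x y : `|nu x - nu y| <= nu (x - y).
Proof.
have := seminorm_le_dist x y; have := seminorm_le_dist y x.
by rewrite (seminormBC y) ler_norml; lra.
Qed.

Section Chord.
Variables (a d : E) (M : nat) (sigma h rho R0 : R).
Let c i := a + (i%:R * sigma) *: d.
Let g i := nu (c i).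
Let A j := h * \sum_(i < M) g (j + i)%N.
Hypotheses (sigma_ge0 : 0 <= sigma) (h_gt0 : 0 < h) (hM : h * M%:R = 1).
Let D := M%:R * sigma * nu d.

Lemma chord_lip i j : (i <= j <= i + M)%N -> `|g i - g j| <= D.
Proof.
move=> /andP[ij jiM]; apply: (le_trans (seminorm_dist _ _)).
have -> : c i - c j = ((i%:R - j%:R) * sigma) *: d.
  by rewrite /c opprD addrACA subrr add0r -scalerBl mulrBl.
rewrite nuZ normrM (ger0_norm sigma_ge0) /D.
apply: ler_wpM2r; first exact: seminorm_ge0.
apply: ler_wpM2r => //; rewrite distrC -natrB// normr_nat ler_nat.
by rewrite leq_subLR addnC addnC.
Qed.

Lemma chord_mean_close j l : (j <= l <= j + M)%N -> `|A j - g l| <= D.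
Proof.
move=> /andP[jl ljM].
have -> : A j - g l = h * \sum_(i < M) (g (j + i)%N - g l).
  rewrite sumrB mulrBr sumr_const card_ord -[g l *+ M]mulr_natr.
  by rewrite [_ * (g l * _)]mulrCA hM mulr1.
rewrite normrM gtr0_norm//.
have -> : D = h * (M%:R * D) by rewrite mulrA hM mul1r.
rewrite ler_pM2l//; apply: (le_trans (ler_norm_sum _ _ _)).
apply: (@le_trans _ _ (\sum_(i < M) D)); last first.
  by rewrite sumr_const card_ord mulr_natl.
apply: ler_sum => i _; have iM := ltn_ord i.
have [le|le] := leqP l (j + i); last first.
  by apply: chord_lip; lia.
by rewrite distrC; apply: chord_lip; lia.
Qed.

Lemma chord_meanS j : A j.+1 = A j + h * (g (j + M)%N - g j).
Proof.
rewrite /A -mulrDr; congr (_ * _).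
case: M hM => [|m] _; first by rewrite !big_ord0 addn0 subrr addr0.
rewrite big_ord_recr big_ord_recl /= addn0 addrC addnS addSn.
rewrite (eq_bigr (fun i : 'I_m => g (j + bump 0 i)%N)) => [|i _].
  by ring.
by rewrite /bump /= add1n addnS addSn.
Qed.

(** Dividing c i by the average A i makes the motion along the chord look like
    y |-> (1 - h) y + h k with k of the norm of y: when i increases by one, A i
    changes by h times the difference of the norms at the two ends of the
    averaging window, and this cancels the terms of first order for the
    multiple k of the far end c (j + M). *)
Lemma chord_step j K :
  0 < rho -> h <= 1 ->
  (forall i, (i <= j + M)%N -> rho <= g i <= R0) ->
  rho <= A j <= R0 -> rho <= A j.+1 <= R0 ->
  K = 3 * R0 * nu d ^+ 2 / rho ^+ 3 ->
  let y i := (A i)^-1 *: c i in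
  exists k, nu k = nu (y j) /\
    nu (y j.+1 - ((1 - h) *: y j + h *: k)) <= h * (M%:R * sigma) ^+ 2 * K.
Proof.
move=> rho0 h1 gb /andP[Aj AjR] /andP[Aj1 Aj1R] KE y.
set s := M%:R * sigma.
have s0 : 0 <= s by rewrite mulr_ge0.
have M0 : (0 < M)%N by case: (M) hM => // H; exfalso; move: H; rewrite mulr0; lra.
have /andP[gj gjR] := gb j (leq_addr _ _).
have /andP[gM gMR] := gb (j + M)%N (leqnn _).
have nd0 : 0 <= nu d by exact: seminorm_ge0.
exists ((g j / (A j * g (j + M)%N)) *: c (j + M)%N); split.
  rewrite !nuZ -/(g j) -/(g (j + M)%N) normfV normrM normfV normrM.
  rewrite !gtr0_norm; [|lra..].
  by field; apply/andP; split; apply: lt0r_neq0; lra.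
set gm := g (j + M)%N in gM gMR *; set G := g j in gj gjR *.
set A0 := A j in Aj AjR *; set A1 := A j.+1 in Aj1 Aj1R *.
have cM : c (j + M)%N = c j + s *: d.
  by rewrite /c natrD mulrDl scalerDl addrA.
have c1 : c j.+1 = c j + sigma *: d.
  by rewrite /c -addn1 natrD mulrDl mul1r scalerDl addrA.
have A1E : A1 = A0 + h * (gm - G) by exact: chord_meanS.
have e1 : `|gm - G| <= s * nu d by rewrite distrC; apply: chord_lip; rewrite ?leq_addr ?leqnn.
have e2 : `|A0 - G| <= s * nu d by apply: chord_mean_close; rewrite ?leq_addr ?leqnn.
have e3 : `|A1 - gm| <= s * nu d.
  by apply: chord_mean_close => //; rewrite leq_add2r leqnSn -[j.+1]addn1 leq_add2l M0.
have sE : sigma = h * s by rewrite mulrA hM mul1r.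
pose p := h * (gm - G) * (A1 - gm) / (A0 * gm * A1).
pose q := sigma * (A0 * (gm - A1) + A1 * (A0 - G)) / (A0 * gm * A1).
have -> : y j.+1 - ((1 - h) *: y j + h *: ((G / (A0 * gm)) *: c (j + M)%N)) =
    p *: c j + q *: d.
  rewrite /y -/A0 -/A1 cM c1 [h *: (_ *: _)]scalerA.
  rewrite lincomb2_diff.
  congr (_ *: _ + _ *: _); rewrite /p /q.
    by rewrite A1E; field; rewrite -A1E !lt0r_neq0//; lra.
  by rewrite sE; field; rewrite !lt0r_neq0//; lra.
apply: (le_trans (nuD _ _)); rewrite !nuZ -/(g j) -/G.
clearbody s A0 A1 gm G.
have sd0 : 0 <= s * nu d by rewrite mulr_ge0.
have R00 : 0 <= R0 by lra.
have den : rho ^+ 3 <= A0 * gm * A1.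
  rewrite !exprS expr0 mulr1 mulrA; apply: ler_pM; rewrite ?mulr_ge0 ?ler_pM//; lra.
have r3 : 0 < rho ^+ 3 by rewrite exprn_gt0.
have iden : (A0 * gm * A1)^-1 <= (rho ^+ 3)^-1 by rewrite lef_pV2// posrE; lra.
have nden : `|(A0 * gm * A1)^-1| = (A0 * gm * A1)^-1.
  by rewrite ger0_norm// invr_ge0; lra.
have n0 : 0 <= (A0 * gm * A1)^-1 by rewrite invr_ge0; lra.
have pb : `|p| * G <= h * (s * nu d) ^+ 2 * (rho ^+ 3)^-1 * R0.
  apply: ler_pM => //; first by lra.
  rewrite /p !normrM nden (gtr0_norm h_gt0); apply: ler_pM => //.
    by rewrite !mulr_ge0// ltW.
  by rewrite -mulrA; apply: ler_wpM2l; [exact: ltW|rewrite expr2 ler_pM].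
have qb : `|q| <= h * s * (2 * R0 * (s * nu d)) * (rho ^+ 3)^-1.
  rewrite /q sE !normrM nden (gtr0_norm h_gt0) (ger0_norm s0).
  apply: ler_pM => //; first by rewrite !mulr_ge0// ltW.
  apply: ler_wpM2l; first by rewrite mulr_ge0// ltW.
  apply: (le_trans (ler_normD _ _)); rewrite !normrM distrC.
  rewrite (gtr0_norm (lt_le_trans rho0 Aj)) (gtr0_norm (lt_le_trans rho0 Aj1)).
  have := ler_wpM2l (ltW (lt_le_trans rho0 Aj)) e3.
  have := ler_wpM2l (ltW (lt_le_trans rho0 Aj1)) e2.
  have := ler_wpM2r (mulr_ge0 s0 nd0) AjR.
  have := ler_wpM2r (mulr_ge0 s0 nd0) Aj1R.
  lra.
have : `|q| * nu d <= h * s * (2 * R0 * (s * nu d)) * (rho ^+ 3)^-1 * nu d.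
  by rewrite ler_wpM2r.
have -> : h * s ^+ 2 * K = h * (s * nu d) ^+ 2 * (rho ^+ 3)^-1 * R0 +
    h * s * (2 * R0 * (s * nu d)) * (rho ^+ 3)^-1 * nu d by rewrite KE; ring.
by move=> qd; apply: lerD.
Qed.

Lemma chord_mean_between j n :
  (j <= n)%N -> (forall i, (i <= n + M)%N -> rho <= g i <= R0) ->
  rho <= A j <= R0.
Proof.
move=> jn gb.
have mean_const (x : R) : x = h * \sum_(i < M) x.
  by rewrite sumr_const card_ord -mulr_natl mulrA hM mul1r.
rewrite [rho]mean_const [R0]mean_const !ler_pM2l//.
by apply/andP; split; apply: ler_sum => i _; have iM := ltn_ord i;
  have [] := andP (gb (j + i)%N (leq_add jn (ltnW iM))).
Qed.

End Chord.

(** * Walking along an Euler flow *)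
Section Flow.
Variables (B : {linear E -> E}) (C : R).
Hypothesis C_ge1 : 1 <= C.
Hypothesis nuB : forall y, nu (B y) <= C * nu y.
Hypothesis nu_flow : forall (s : R) y, `|s| <= 1 ->
  nu (y + s *: B y) <= (1 + C ^+ 2 * s ^+ 2) * nu y.

Definition euler (s : R) (y : E) : E := y + s *: B y.

Lemma euler_linear s : linear (euler s).
Proof.
move=> l x y; rewrite /euler linearP !scalerDr !scalerA addrACA.
by congr (_ + _ + _); rewrite mulrC.
Qed.

Lemma iter_euler_linear s n : linear (iter n (euler s)).
Proof. by elim: n => [|n IH] l x y //=; rewrite IH euler_linear. Qed.

Lemma iter_eulerB s n x y :
  iter n (euler s) (x - y) = iter n (euler s) x - iter n (euler s) y.
Proof.
by rewrite addrC -scaleN1r iter_euler_linear scaleN1r addrC.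
Qed.

Lemma iter_eulerZ s n l x :
  iter n (euler s) (l *: x) = l *: iter n (euler s) x.
Proof.
have i0 : iter n (euler s) 0 = 0.
  by have := iter_eulerB s n 0 0; rewrite !subrr.
by rewrite -[l *: x]addr0 iter_euler_linear i0 addr0.
Qed.

Lemma euler_back s y : euler (- s) (euler s y) = y - s ^+ 2 *: B (B y).
Proof.
by rewrite /euler linearD linearZ /= scaleNr scalerDr scalerA -expr2 opprD addrA addrK.
Qed.

Lemma nu_iter_euler s n y : `|s| <= 1 ->
  nu (iter n (euler s) y) <= (1 + C ^+ 2 * s ^+ 2) ^+ n * nu y.
Proof.
move=> s1; elim: n => [|n IH] /=; first by rewrite mul1r.
apply: (le_trans (nu_flow _ s1)); rewrite (exprS _ n) -mulrA ler_wpM2l//.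
by rewrite addr_ge0// mulr_ge0// sqr_ge0.
Qed.

Section Bounded.
Variables (n : nat) (s X : R).
Hypothesis s1 : `|s| <= 1.
Hypothesis X_ub : (1 + C ^+ 2 * s ^+ 2) ^+ n <= X.

Lemma flow_bound_ge1 : 1 <= 1 + C ^+ 2 * s ^+ 2.
Proof. by rewrite lerDl mulr_ge0// sqr_ge0. Qed.

Lemma nu_iter_le m y : (m <= n)%N ->
  nu (iter m (euler s) y) <= X * nu y /\ nu (iter m (euler (- s)) y) <= X * nu y.
Proof.
move=> mn.
have pX : (1 + C ^+ 2 * s ^+ 2) ^+ m <= X.
  by apply: le_trans X_ub; rewrite ler_weXn2l// flow_bound_ge1.
split.
  apply: (le_trans (nu_iter_euler m y s1)).
  by rewrite ler_wpM2r ?seminorm_ge0.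
have sN1 : `|- s| <= 1 by rewrite normrN.
apply: (le_trans (nu_iter_euler m y sN1)); rewrite sqrrN.
by rewrite ler_wpM2r ?seminorm_ge0.
Qed.

Lemma total_bound_ge1 : 1 <= X.
Proof. by apply: le_trans X_ub; rewrite exprn_ege1// flow_bound_ge1. Qed.

(** A step forth and a step back compose to I - s^2 B^2, so that going n steps
    forth and back costs only n s^2. *)
Lemma nu_iter_back m y : (m <= n)%N ->
  nu (iter m (euler (- s)) (iter m (euler s) y) - y) <=
  m%:R * (C * s) ^+ 2 * X ^+ 2 * nu y.
Proof.
elim: m => [|m IH] mn; first by rewrite subrr seminorm0 !mul0r.
rewrite iterSr [iter m.+1 (euler s) y]iterS euler_back iter_eulerB iter_eulerZ.
set z := iter m (euler s) y; rewrite addrAC.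
apply: (le_trans (nuD _ _)); rewrite seminormN nuZ.
rewrite -[m.+1]addn1 natrD !mulrDl; apply: lerD; first exact: IH (ltnW mn).
rewrite mul1r ger0_norm ?sqr_ge0//.
have [_] := nu_iter_le (B (B z)) (ltnW mn).
have [zX _] := nu_iter_le y (ltnW mn); rewrite -/z in zX.
have := nuB (B z); have := nuB z.
have X1 := total_bound_ge1; have y0 := seminorm_ge0 y; have s2 := sqr_ge0 s.
move: (nu (iter m _ _)) (nu (B (B z))) (nu (B z)) (nu z) zX => p q r t tX rt qr pq.
have C0 := le_trans ler01 C_ge1; have X0 := le_trans ler01 X1.
have r1 := le_trans rt (ler_wpM2l C0 tX).
have q1 := le_trans qr (ler_wpM2l C0 r1).
have p1 := le_trans pq (ler_wpM2l X0 q1).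
apply: (le_trans (ler_wpM2l s2 p1)).
by rewrite le_eqVlt; apply/orP; left; apply/eqP; ring.
Qed.

Lemma nu_iter_lower m y : (m <= n)%N ->
  (1 - m%:R * (C * s) ^+ 2 * X ^+ 2) * nu y <= X * nu (iter m (euler s) y).
Proof.
move=> mn; rewrite mulrBl mul1r lerBlDr addrC.
have [_ H] := nu_iter_le (iter m (euler s) y) mn.
apply: (le_trans (seminorm_le_dist y (iter m (euler (- s)) (iter m (euler s) y)))).
by rewrite addrC; apply: lerD => //; rewrite seminormBC; exact: nu_iter_back.
Qed.

End Bounded.

Section Walk.
Variables (bnd : R -> E -> R -> Prop) (kappa : R).
Hypothesis kappa_ge0 : 0 <= kappa.
Hypothesis bnd_lip : forall eta y z gam, 0 <= eta -> eta <= 1 ->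
  bnd eta y gam -> bnd eta z (gam + kappa * nu (z - y)).
Hypothesis bnd_mono : forall eta y gam gam', gam <= gam' ->
  bnd eta y gam -> bnd eta y gam'.
Hypothesis bnd_scale : forall eta l y gam, 0 <= l ->
  bnd eta y gam -> bnd eta (l *: y) (l * gam).
Hypothesis bnd_step : forall h eta k y gam, 0 < h -> h <= 1 -> 0 <= eta ->
  eta + 2 * C ^+ 2 * h ^+ 2 <= 1 -> nu k <= nu y ->
  bnd (eta + 2 * C ^+ 2 * h ^+ 2) y gam -> bnd eta (y + h *: (k - y + B y)) gam.

(** The flow commutes with B.  Hence, transported by the flow, the motion
    y |-> (1 - h) y + h k becomes Y |-> Y + h (k' - Y + B Y) up to errors of
    second order in h.  The factor 1 - eps gives k' a norm below that of Y in
    spite of the flow being isometric only up to a small factor. *)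
Lemma walk_step_error (h eps err R1 X : R) m n (y y' k : E) :
  0 < h -> h <= 1 -> 0 <= eps -> (1 + C ^+ 2 * h ^+ 2) ^+ n <= X -> (m <= n)%N ->
  nu k = nu y -> nu y <= R1 ->
  nu (y' - ((1 - h) *: y + h *: k)) <= err ->
  nu (iter m.+1 (euler h) y' - (iter m (euler h) y +
      h *: ((1 - eps) *: iter m (euler h) k - iter m (euler h) y +
            B (iter m (euler h) y)))) <=
  X * (err * (1 + h * C) + 2 * h ^+ 2 * C * R1 + h * eps * R1).
Proof.
move=> h0 h1 e0 XX mn ky yR1 errb; set Y := iter m (euler h) y.
have C0 := le_trans ler01 C_ge1.
have hn : `|h| <= 1 by rewrite gtr0_norm.
have X0 := le_trans ler01 (total_bound_ge1 XX).
pose inner := (y' - ((1 - h) *: y + h *: k)) + h *: B (y' - y) + (h * eps) *: k.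
have -> : iter m.+1 (euler h) y' -
      (Y + h *: ((1 - eps) *: iter m (euler h) k - Y + B Y)) =
      iter m (euler h) inner.
  rewrite iterSr -iter_eulerZ /Y.
  have -> : iter m (euler h) y + h *: (iter m (euler h) ((1 - eps) *: k) -
      iter m (euler h) y + B (iter m (euler h) y)) =
      iter m.+1 (euler h) y + h *: iter m (euler h) ((1 - eps) *: k - y).
    by rewrite iterS /euler -/(euler h) iter_eulerB scalerDr addrA addrAC.
  rewrite iterSr -iter_eulerZ opprD addrA -!iter_eulerB; congr iter.
  rewrite /euler /inner (raddfB B) /= !scalerBr !scalerBl !scale1r scalerBr scalerA.
  move: (h *: B y') (h *: B y) (h *: y) (h *: k) ((h * eps) *: k) => P Q S T U.
  by rewrite !opprD !opprK !addrA [LHS](ACl (1*3*7*5*2*4*6)).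
have [H _] := nu_iter_le hn XX inner mn.
apply: (le_trans H); rewrite ler_wpM2l//.
have R10 : 0 <= R1 by apply: le_trans yR1; exact: seminorm_ge0.
have dy : nu (y' - y) <= err + 2 * h * R1.
  apply: (le_trans (seminorm_le_dist _ (h *: (k - y)))).
  have -> : y' - y - h *: (k - y) = y' - ((1 - h) *: y + h *: k).
    rewrite scalerBr scalerBl scale1r !opprD !opprK.
    by rewrite -!addrA; congr (_ + (_ + _)); rewrite addrC.
  rewrite nuZ gtr0_norm// addrC; apply: lerD => //.
  rewrite [2 * h]mulrC -mulrA ler_wpM2l//; first exact: ltW.
  by apply: (le_trans (nuD _ _)); rewrite seminormN ky; lra.
apply: (le_trans (nuD _ _)); rewrite nuZ ky; apply: lerD; last first.
  by rewrite normrM gtr0_norm// ger0_norm// ler_wpM2l// mulr_ge0// ltW.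
apply: (le_trans (nuD _ _)); rewrite nuZ gtr0_norm//.
rewrite mulrDr mulr1 -addrA; apply: lerD => //.
apply: (@le_trans _ _ (h * (C * (err + 2 * h * R1)))).
  rewrite ler_wpM2l//; first exact: ltW.
  by apply: (le_trans (nuB _)); rewrite ler_wpM2l.
by rewrite le_eqVlt; apply/orP; left; apply/eqP; ring.
Qed.

(** Each step along the chord spends 2 C^2 h^2 of the tolerance eta and adds
    kappa times the error of [walk_step_error] to the bound. *)
Lemma walk (a d : E) (M n : nat) (sigma h rho R0 K X eps Gam : R) :
  0 <= sigma -> 0 < h -> h <= 1 -> h * M%:R = 1 -> 0 < rho ->
  (forall i, (i <= n + M)%N ->
     rho <= nu (a + (i%:R * sigma) *: d) <= R0) ->
  K = 3 * R0 * nu d ^+ 2 / rho ^+ 3 ->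
  (1 + C ^+ 2 * h ^+ 2) ^+ n <= X -> 0 <= eps -> eps <= 1 ->
  (1 - eps) * X ^+ 2 <= 1 - n%:R * (C * h) ^+ 2 * X ^+ 2 ->
  n%:R * (2 * C ^+ 2 * h ^+ 2) <= 1 ->
  let c i := a + (i%:R * sigma) *: d in
  let A j := h * \sum_(i < M) nu (c (j + i)%N) in
  bnd (n%:R * (2 * C ^+ 2 * h ^+ 2)) ((A 0%N)^-1 *: c 0%N) Gam ->
  bnd 0 ((A n)^-1 *: iter n (euler h) (c n))
    (Gam + n%:R * (kappa * (X * (h * (M%:R * sigma) ^+ 2 * K * (1 + h * C) +
       2 * h ^+ 2 * C * (R0 / rho) + h * eps * (R0 / rho))))).
Proof.
move=> s0 h0 h1 hM rho0 gb KE XX e0 e1 eX nd c A start.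
set del := 2 * C ^+ 2 * h ^+ 2 in nd start.
set e := kappa * _.
have hn : `|h| <= 1 by rewrite gtr0_norm.
have X1 := total_bound_ge1 XX; have X0 := lt_le_trans ltr01 X1.
have del0 : 0 <= del by rewrite /del -mulrA mulr_ge0// mulr_ge0// sqr_ge0.
have Ab j : (j <= n)%N -> rho <= A j <= R0.
  by move=> jn; exact: (chord_mean_between h0 hM jn gb).
suff H j : (j <= n)%N -> bnd ((n - j)%:R * del)
    (iter j (euler h) ((A j)^-1 *: c j)) (Gam + j%:R * e).
  by have := H n (leqnn n); rewrite subnn mul0r iter_eulerZ.
elim: j => [|j IH] jn; first by rewrite subn0 mul0r addr0.
have := IH (ltnW jn).
have -> : (n - j)%:R * del = (n - j.+1)%:R * del + del.
  by rewrite -[in LHS](subnSK jn) -addn1 natrD mulrDl mul1r.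
move=> step.
have jnM : (j + M <= n + M)%N by rewrite leq_add2r ltnW.
have gbj i : (i <= j + M)%N -> rho <= nu (c i) <= R0.
  by move=> ij; apply: gb; exact: leq_trans jnM.
have [k [ky err]] :=
  chord_step s0 h0 hM rho0 h1 gbj (Ab j (ltnW jn)) (Ab j.+1 jn) KE.
set y := (A j)^-1 *: c j in ky step.
have /andP[Aj _] := Ab j (ltnW jn).
have A0 : 0 < A j by exact: lt_le_trans Aj.
have yR : nu y <= R0 / rho.
  have /andP[_ gR] := gbj j (leq_addr _ _).
  have Ai : (A j)^-1 <= rho^-1 by rewrite lef_pV2// posrE.
  have Ai0 : 0 <= (A j)^-1 by rewrite invr_ge0 ltW.
  by rewrite /y nuZ normfV gtr0_norm// mulrC ler_pM// seminorm_ge0.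
have sm : nu ((1 - eps) *: iter j (euler h) k) <= nu (iter j (euler h) y).
  rewrite nuZ ger0_norm ?subr_ge0//.
  have [Hk _] := nu_iter_le hn XX k (ltnW jn).
  have Hy := nu_iter_lower hn XX y (ltnW jn).
  rewrite -(ler_pM2l X0); apply: (le_trans _ Hy).
  apply: (@le_trans _ _ (X * ((1 - eps) * (X * nu k)))).
    by rewrite ler_pM2l// ler_wpM2l// subr_ge0.
  rewrite ky [leLHS](_ : _ = (1 - eps) * X ^+ 2 * nu y); last by ring.
  rewrite ler_wpM2r ?seminorm_ge0//; apply: (le_trans eX).
  rewrite lerD2l lerN2; apply: ler_wpM2r; first exact: sqr_ge0.
  by apply: ler_wpM2r; [exact: sqr_ge0 | rewrite ler_nat ltnW].
have eta0 : 0 <= (n - j.+1)%:R * del by rewrite mulr_ge0.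
have eta1 : (n - j.+1)%:R * del + del <= 1.
  apply: le_trans nd; rewrite -[X in _ + X]mul1r -mulrDl ler_wpM2r//.
  by rewrite natr1 ler_nat subnSK// leq_subr.
have := bnd_step h0 h1 eta0 eta1 sm step.
have eta1' : (n - j.+1)%:R * del <= 1 by rewrite (le_trans _ eta1)// lerDl.
move/(bnd_lip (iter j.+1 (euler h) ((A j.+1)^-1 *: c j.+1)) eta0 eta1').
have W := walk_step_error h0 h1 e0 XX (ltnW jn) ky yR err.
have -> : Gam + j.+1%:R * e = Gam + j%:R * e + e.
  by rewrite -addn1 natrD mulrDl mul1r addrA.
by apply: bnd_mono; rewrite lerD2l; exact: ler_wpM2l.
Qed.

End Walk.
End Flow.

(** The chord can approach the origin only when b is close to - a, and both
    alternatives exclude that.  It is followed a little beyond b, because the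
    averages look ahead. *)
Lemma chord_bounds (a b : E) (u : R) :
  nu a = 1 -> 7/8 <= nu b <= 9/8 ->
  1/4 <= nu (a + b) \/ nu (b - a) <= 5/8 -> 0 <= u -> u <= 65/64 ->
  1/64 <= nu (a + u *: (b - a)) <= 4.
Proof.
move=> na /andP[b1 b2] ab u0 u1; apply/andP; split; last first.
  apply: (le_trans (nuD _ _)); rewrite nuZ ger0_norm//.
  have := nuD b (- a); rewrite seminormN na => bma.
  have := ler_wpM2l u0 bma; have := ler_wpM2l u0 b2; lra.
have [ab4|ba] := ab; last first.
  have := seminorm_le_dist a (a + u *: (b - a)).
  rewrite opprD addrA subrr add0r seminormN nuZ ger0_norm//.
  by have := ler_wpM2l u0 ba; lra.
have ub1 := ler_wpM2l u0 b1; have ub2 := ler_wpM2l u0 b2.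
set z := a + u *: (b - a).
have zE : z = (1 - u) *: a + u *: b.
  by rewrite /z scalerBr scalerBl scale1r addrA addrAC.
have i1 : u * nu b <= nu z + `|1 - u|.
  have := seminorm_le_dist (u *: b) z.
  rewrite zE [_ + u *: b]addrC opprD addrA subrr add0r seminormN !nuZ na mulr1.
  by rewrite (ger0_norm u0) [u *: b + _]addrC -zE.
have i2 : `|1 - u| <= nu z + u * nu b.
  have := seminorm_le_dist ((1 - u) *: a) z.
  rewrite zE opprD addrA subrr add0r seminormN !nuZ na mulr1.
  by rewrite (ger0_norm u0) -zE.
have i3 : 1/8 <= nu z + `|1/2 - u| * (17/8).
  have wE : z = (1/2) *: (a + b) + (1/2 - u) *: (a - b).
    rewrite zE scalerDr scalerBr addrACA -scalerDl -scalerBl.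
    by congr (_ *: _ + _ *: _); lra.
  have := seminorm_le_dist ((1/2) *: (a + b)) z.
  rewrite wE opprD addrA subrr add0r seminormN !nuZ -wE.
  have := nuD a (- b); rewrite seminormN => amb.
  have : `|1/2 - u| * nu (a - b) <= `|1/2 - u| * (17/8).
    by apply: ler_wpM2l => //; lra.
  rewrite (@ger0_norm _ (1/2)); lra.
have [uh|uh] := lerP u (1/2).
  by move: i2 i3; rewrite !ger0_norm; lra.
have [ul|ul] := lerP u 1.
  by move: i1 i3; rewrite (@ger0_norm _ (1 - u)) ?(@ltr0_norm _ (1/2 - u)); lra.
by move: i1; rewrite (@ltr0_norm _ (1 - u)); lra.
Qed.

End Seminorm.

(** * The radial inequality *)

(** What the walk uses of the bidual.  Read bnd eta y gam as an upper bound gam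
    for y on a set of test vectors that depends on a tolerance eta.  The
    substantial field is [walk_move], which consumes tolerance. *)
Record walkable (R : realFieldType) (E : lmodType R) (nu : E -> R)
    (B : {linear E -> E}) (C kappa : R) (bnd : R -> E -> R -> Prop) : Prop := Walkable {
  walk_C : 1 <= C;
  walk_kappa : 0 <= kappa;
  walk_nuD : forall x y, nu (x + y) <= nu x + nu y;
  walk_nuZ : forall l x, nu (l *: x) = `|l| * nu x;
  walk_nuB : forall y, nu (B y) <= C * nu y;
  walk_flow : forall s y, `|s| <= 1 ->
    nu (y + s *: B y) <= (1 + C ^+ 2 * s ^+ 2) * nu y;
  walk_lip : forall eta y z gam, 0 <= eta -> eta <= 1 ->
    bnd eta y gam -> bnd eta z (gam + kappa * nu (z - y));
  walk_mono : forall eta y gam gam', gam <= gam' -> bnd eta y gam -> bnd eta y gam';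
  walk_scale : forall eta l y gam, 0 <= l -> bnd eta y gam -> bnd eta (l *: y) (l * gam);
  walk_move : forall h eta k y gam, 0 < h -> h <= 1 -> 0 <= eta ->
    eta + 2 * C ^+ 2 * h ^+ 2 <= 1 -> nu k <= nu y ->
    bnd (eta + 2 * C ^+ 2 * h ^+ 2) y gam -> bnd eta (y + h *: (k - y + B y)) gam
}.

(** The scales are tied to one integer N: steps of length h = N^-3, and n of
    the order of N^4 of them, so that the total time T = n h is of order N.  An
    averaging window of 1/h steps covers a part s = 1/T of the chord, and the
    norm drifts by O(n h^2); both, hence all errors, are of order 1/N.
    The chord ends at b, the image of q under n backward steps, so that n
    forward steps bring its end back to q. *)
Lemma radial_param (R : realFieldType) (E : lmodType R) (nu : E -> R)
    (B : {linear E -> E}) (C kappa : R) (bnd : R -> E -> R -> Prop)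
    (ell : E -> R) (a q : E) (gam : R) (N n : nat) :
  walkable nu B C kappa bnd ->
  (forall y g, bnd 0 y g -> ell y <= g) ->
  (forall eta, 0 < eta -> eta <= 1 -> bnd eta a (gam + eta)) ->
  nu a = 1 -> nu (q - a) <= 1/16 ->
  64 * C ^+ 2 <= N%:R -> (N ^ 4 <= n <= 2 * N ^ 4)%N ->
  let h : R := (N%:R ^+ 3)^-1 in
  let b := iter n (euler B (- h)) q in
  1/4 <= nu (a + b) \/ nu (b - a) <= 5/8 ->
  ell q <= gam * nu q + N%:R^-1 *
    (kappa * (2 * (3 * 4 * 5 * 64 ^+ 3 * 2 + 16 + 24 * C ^+ 2 * 256)) * 4 +
     kappa + `|gam| * 20 + 1).
Proof.
move=> [C_ge1 kap0 nuD nuZ nuB nu_flow bnd_lip bnd_mono bnd_scale bnd_step].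
move=> bnd_end bnd_start na qa.
move=> NC /andP[n1 n2] h b ab.
have C0 := le_trans ler01 C_ge1.
have C21 : 1 <= C ^+ 2 by rewrite exprn_ege1.
have N64 : 64 <= N%:R :> R by move: NC C21; clear; lra.
have N0 : 0 < N%:R :> R by move: N64; clear; lra.
have [t tD] : {t : R | t = N%:R^-1} by eexists.
have t0 : 0 < t by rewrite tD invr_gt0.
have tN : t * N%:R = 1 by rewrite tD mulVf// lt0r_neq0.
have t64 : t <= 1/64 by rewrite -(ler_pM2r N0) tN; move: N64; clear; lra.
have Ct : C ^+ 2 * t <= 1/64.
  by rewrite -(ler_pM2r N0) -mulrA tN; move: NC; clear; lra.
have hE : h = t ^+ 3 by rewrite /h tD exprVn.
have h0 : 0 < h by rewrite hE exprn_gt0.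
have h1 : h <= 1/64.
  have tt := ler_wpM2l (ltW t0) t64.
  have ttt := ler_wpM2l (ltW t0) tt.
  by rewrite hE !exprS expr0 mulr1; move: tt ttt t64; clear; lra.
have hM : h * (N ^ 3)%:R = 1.
  by rewrite natrX mulVf// expf_neq0// lt0r_neq0.
have nN1 : N%:R ^+ 4 <= n%:R :> R by rewrite -natrX ler_nat.
have nN2 : n%:R <= 2 * N%:R ^+ 4 :> R by rewrite -natrX -natrM ler_nat.
have N40 : 0 < N%:R ^+ 4 :> R by rewrite exprn_gt0.
have nr0 : 0 < n%:R :> R by apply: lt_le_trans nN1.
have [T TD] : {T : R | T = n%:R * h} by eexists.
have hN4 : h * N%:R ^+ 4 = N%:R.
  by rewrite exprSr mulrA -natrX hM mul1r.
have T1 : N%:R <= T by rewrite -hN4 TD mulrC ler_pM2r.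
have T2 : T <= 2 * N%:R by rewrite -hN4 mulrCA TD mulrC ler_pM2l.
have T0 : 0 < T by exact: lt_le_trans T1.
have [s sD] : {s : R | s = (N ^ 3)%:R * n%:R^-1} by eexists.
have sT : s * T = 1.
  by rewrite sD TD mulrA mulfVK ?lt0r_neq0// mulrC.
have s0 : 0 < s by rewrite sD mulr_gt0 ?invr_gt0// natrX exprn_gt0.
have st : s <= t.
  rewrite -(ler_pM2r T0) sT -tN; apply: ler_pM => //; exact: ltW.
have [x xD] : {x : R | x = n%:R * (C * h) ^+ 2} by eexists.
have xE : x = T * (C ^+ 2 * h) by rewrite xD TD; ring.
have x0 : 0 <= x by rewrite xD mulr_ge0// sqr_ge0.
have Tt2 : T * t <= 2.
  by rewrite -(ler_pM2r N0) -mulrA tN; move: T2; clear; lra.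
have Tt0 : 0 <= T * t := mulr_ge0 (ltW T0) (ltW t0).
have Ct0 : 0 <= C ^+ 2 * t := mulr_ge0 (sqr_ge0 C) (ltW t0).
have xt : x <= t / 32.
  have -> : x = T * t * (C ^+ 2 * t) * t by rewrite xE hE; ring.
  have -> : t / 32 = 2 * (1/64) * t by clear; lra.
  by apply: ler_wpM2r; [exact: ltW | exact: ler_pM].
have x1 : x <= 1/2048 by move: xt t64; clear; lra.
have [X XE] : {X : R | X = 1 + 2 * x} by eexists.
have hn : `|h| <= 1 by rewrite gtr0_norm//; move: h1; clear; lra.
have hNn : `|- h| <= 1 by rewrite normrN.
have XX : (1 + C ^+ 2 * h ^+ 2) ^+ n <= X.
  have xE' : x = n%:R * (C ^+ 2 * h ^+ 2) by rewrite xD exprMn.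
  rewrite XE xE'; apply: exprn_1D_le; first by rewrite mulr_ge0// sqr_ge0.
  by rewrite -xE'; move: x1; clear; lra.
have XXN : (1 + C ^+ 2 * (- h) ^+ 2) ^+ n <= X by rewrite sqrrN.
have X1 : 1 <= X by rewrite XE lerDl mulr_ge0.
have X2 : X <= 1025/1024 by rewrite XE; move: x1; clear; lra.
have X4 : X ^+ 2 <= 2.
  have := ler_wpM2l (le_trans ler01 X1) X2; rewrite -expr2.
  by move: X2; clear; lra.
have nq1 : nu q <= 17/16.
  by have := seminorm_le_dist nuD q a; rewrite na; move: qa; clear; lra.
have nq2 : 15/16 <= nu q.
  have := seminorm_le_dist nuD a q; rewrite na (seminormBC nuZ).
  by move: qa; clear; lra.
have xX : x * X ^+ 2 <= t / 16.
  by have := ler_wpM2l x0 X4; move: xt; clear; lra.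
have xX0 : 0 <= x * X ^+ 2 by rewrite mulr_ge0// sqr_ge0.
have xXq : x * X ^+ 2 * nu q <= t / 15.
  by have := ler_wpM2l xX0 nq1; move: xX t0; clear; lra.
have bq1 : nu b <= nu q + t / 15.
  have [_ H] := nu_iter_le nuD nuZ nu_flow hn XX q (leqnn n).
  apply: (le_trans H); rewrite XE mulrDl mul1r lerD2l.
  have x20 : 0 <= 2 * x by rewrite mulr_ge0.
  by have := ler_wpM2l x20 nq1; move: xt t0; clear; lra.
have b_ub : nu b <= 9/8 by move: bq1 nq1 t64; clear; lra.
have bq2 : nu q <= nu b + t / 7.
  have H := nu_iter_lower nuD nuZ C_ge1 nuB nu_flow hNn XXN q (leqnn n).
  rewrite mulrN sqrrN -xD mulrBl mul1r -/b in H.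
  have : X * nu b <= nu b + 2 * x * (9/8).
    by rewrite XE mulrDl mul1r lerD2l; apply: ler_wpM2l => //; rewrite mulr_ge0.
  by move: H xXq xt t0; clear; lra.
have b_lb : 7/8 <= nu b by move: bq2 nq2 t64; clear; lra.
have back : nu (iter n (euler B h) b - q) <= t / 15.
  have := nu_iter_back nuD nuZ C_ge1 nuB nu_flow hNn XXN q (leqnn n).
  by rewrite opprK mulrN sqrrN -xD -/b => /le_trans; exact.
pose d := b - a; pose sigma := n%:R^-1 : R.
have sig0 : 0 <= sigma by rewrite invr_ge0 ltW.
have nd : nu d <= 17/8.
  by have := nuD b (- a); rewrite (seminormN nuZ) na -/d; move: b_ub; clear; lra.
have nd0 := seminorm_ge0 nuD nuZ d.
have gb i : (i <= n + N ^ 3)%N -> 1/64 <= nu (a + (i%:R * sigma) *: d) <= 4.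
  move=> iM; apply: (chord_bounds nuD nuZ); rewrite ?b_lb//; first by rewrite mulr_ge0.
  apply: (@le_trans _ _ ((n + N ^ 3)%:R * sigma)).
    by rewrite ler_wpM2r// ler_nat.
  rewrite natrD mulrDl mulfV ?lt0r_neq0// -sD.
  by move: st t64; clear; lra.
have [K KE] : {K : R | K = 3 * 4 * nu d ^+ 2 / (1/64 : R) ^+ 3} by eexists.
have rho0 : 0 < 1/64 :> R by clear; lra.
have h1' : h <= 1 by move: h1; clear; lra.
have e0 : 0 <= 6 * x by rewrite mulr_ge0.
have e1 : 6 * x <= 1 by move: x1; clear; lra.
have eX : (1 - 6 * x) * X ^+ 2 <= 1 - n%:R * (C * h) ^+ 2 * X ^+ 2.
  rewrite -xD lerBrDr -mulrDl.
  have -> : (1 - 6 * x + x) * X ^+ 2 = 1 - (x + 16 * (x * x) + 20 * (x * (x * x))).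
    by rewrite XE; ring.
  have xx := mulr_ge0 x0 x0; have xxx := mulr_ge0 x0 xx.
  by move: x0 xx xxx; clear; lra.
have budget : n%:R * (2 * C ^+ 2 * h ^+ 2) = 2 * x by rewrite xD; ring.
have n21 : n%:R * (2 * C ^+ 2 * h ^+ 2) <= 1 by rewrite budget; move: x1; clear; lra.
have /= W := walk nuD nuZ C_ge1 nuB nu_flow kap0 bnd_lip bnd_mono bnd_step sig0 h0 h1' hM
  rho0 gb KE XX e0 e1 eX n21.
pose c i := a + (i%:R * sigma) *: d.
pose A j := h * \sum_(i < N ^ 3) nu (c (j + i)%N).
have c0 : c 0%N = a by rewrite /c mul0r scale0r addr0.
have cn : c n = b by rewrite /c mulfV ?lt0r_neq0// scale1r addrC subrK.
have [A0 A0D] : {A0 : R | A0 = A 0%N} by eexists.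
have [An AnD] : {An : R | An = A n} by eexists.
have A0b : 1/64 <= A0 <= 4.
  by rewrite A0D; exact: (chord_mean_between h0 hM (leq0n n) gb).
have Anb : 1/64 <= An <= 4.
  by rewrite AnD; exact: (chord_mean_between h0 hM (leqnn n) gb).
have A01 : `|A0 - 1| <= s * nu d.
  rewrite A0D -na -c0 sD.
  by apply: (chord_mean_close nuD nuZ a d sig0 h0 hM); rewrite leqnn leq_addr.
have Anb' : `|An - nu b| <= s * nu d.
  rewrite AnD -cn sD.
  by apply: (chord_mean_close nuD nuZ a d sig0 h0 hM); rewrite leqnn leq_addr.
move: W; rewrite budget -/(c 0%N) -/(c n) -/(A 0%N) -/(A n) c0 cn -A0D -AnD -sD.
move: A0b Anb => /andP[A0l A0u] /andP[Anl Anu].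
have sd : s * nu d <= t * (17/8) by apply: ler_pM => //; exact: ltW.
have A0p : 0 < A0 by exact: lt_le_trans A0l.
have Anp : 0 < An by exact: lt_le_trans Anl.
set e := n%:R * _.
have eb : e <= t * (kappa * (2 * (3 * 4 * 5 * 64 ^+ 3 * 2 + 16 + 24 * C ^+ 2 * 256))).
  have -> : e = kappa * (X * ((s * T) * s * (K * (1 + h * C)) +
      2 * (T * (h * C)) * 256 + 6 * (T * x) * 256)).
    rewrite /e; have -> : 4 / (1/64) = 256 :> R by clear; lra.
    by rewrite TD; ring.
  rewrite sT mul1r [leRHS]mulrCA; apply: ler_wpM2l => //; rewrite [leRHS]mulrCA.
  have CC : C <= C ^+ 2 by rewrite expr2 ler_peMl.
  have hCx := ler_wpM2l (ltW h0) CC.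
  have ThC : T * (h * C) <= t / 32.
    apply: le_trans xt; rewrite xE [C ^+ 2 * h]mulrC.
    by apply: ler_wpM2l => //; exact: ltW.
  have hC1 : h * C <= 1.
    apply: (le_trans hCx).
    have -> : h * C ^+ 2 = (t * t) * (C ^+ 2 * t) by rewrite hE; ring.
    have t1 : t <= 1 by move: t64; clear; lra.
    have tt1 : t * t <= 1 by rewrite mulr_ile1// ltW.
    by rewrite mulr_ile1 ?mulr_ge0 ?(ltW t0)//; move: Ct; clear; lra.
  have Tx : T * x <= 4 * (C ^+ 2 * t).
    have -> : T * x = (T * t) * (T * t) * (C ^+ 2 * t) by rewrite xE hE; ring.
    apply: ler_wpM2r => //; have -> : 4 = 2 * 2 :> R by clear; lra.
    exact: ler_pM.
  have K0 : 0 <= K.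
    by rewrite KE !mulr_ge0// ?sqr_ge0// invr_ge0 exprn_ge0// ltW.
  have nd5 : nu d ^+ 2 <= 5.
    have := ler_pM nd0 nd0 nd nd; rewrite -expr2; clear; lra.
  have KK : K <= 3 * 4 * 5 * 64 ^+ 3.
    have -> : K = nu d ^+ 2 * (12 * 64 ^+ 3) by rewrite KE; field.
    have p0 : 0 <= 12 * 64 ^+ 3 :> R by rewrite mulr_ge0// exprn_ge0.
    by have := ler_wpM2r p0 nd5; clear; lra.
  have Kh : K * (1 + h * C) <= 3 * 4 * 5 * 64 ^+ 3 * 2.
    apply: ler_pM => //; last by move: hC1; clear; lra.
    by rewrite addr_ge0// mulr_ge0// ltW.
  have Kh0 : 0 <= K * (1 + h * C) by rewrite mulr_ge0// addr_ge0// mulr_ge0// ltW.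
  have sKh : s * (K * (1 + h * C)) <= t * (3 * 4 * 5 * 64 ^+ 3 * 2).
    exact: (ler_pM (ltW s0) Kh0 st Kh).
  have ThC0 : 0 <= T * (h * C) by rewrite !mulr_ge0// ltW.
  have Tx0 : 0 <= T * x by rewrite mulr_ge0// ltW.
  apply: ler_pM; first by apply: le_trans X1.
  - have := mulr_ge0 (ltW s0) Kh0; move: ThC0 Tx0; clear; lra.
  - by move: X2; clear; lra.
  - by move: sKh ThC Tx; clear; lra.
have x20 : 0 < 2 * x.
  by rewrite mulr_gt0// xD mulr_gt0// exprn_gt0// mulr_gt0// (lt_le_trans ltr01).
have x21 : 2 * x <= 1 by move: x1; clear; lra.
have A0i : 0 <= A0^-1 by rewrite invr_ge0 ltW.
move=> W.
have := W ((gam + 2 * x) / A0).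
rewrite [_ / A0]mulrC => /(_ (bnd_scale _ _ _ _ A0i (bnd_start _ x20 x21))).
(* The walk starts at a / A0 and ends next to q / An, and both averages are
   known up to O(1/N): A0 is close to 1, An to nu q. *)
have Ani : 0 <= An^-1 by rewrite invr_ge0 ltW.
move/(bnd_lip _ _ (An^-1 *: q) _ (lexx 0) ler01)/(bnd_scale _ _ _ _ (ltW Anp))/bnd_end.
rewrite -scalerBr nuZ (ger0_norm Ani) scalerA mulfV ?lt0r_neq0// scale1r.
move/le_trans; apply; rewrite -tD.
have nb : nu (q - iter n (euler B h) b) <= t.
  by rewrite (seminormBC nuZ); move: back t0; clear; lra.
have kb := ler_wpM2l kap0 nb.
set Q := kappa * (2 * _) in eb *.
have Q0 : 0 <= Q by rewrite mulr_ge0// mulr_ge0// !addr_ge0// !mulr_ge0// ?exprn_ge0// sqr_ge0.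
have Ae : An * e <= t * (Q * 4).
  apply: (le_trans (ler_wpM2l (ltW Anp) eb)).
  rewrite mulrC -mulrA; apply: ler_wpM2l; first exact: ltW.
  by apply: ler_wpM2l.
have [r rD] : {r : R | r = An / A0} by eexists.
have rA : r * A0 = An by rewrite rD mulfVK// lt0r_neq0.
have A0h : 15/16 <= A0.
  by move: A01; rewrite ler_norml => /andP[]; move: sd t64; clear; lra.
have rq : `|r - nu q| <= 10 * t.
  rewrite -(ler_pM2r A0p) -{1}(gtr0_norm A0p) -normrM mulrBl rA.
  have -> : An - nu q * A0 = (An - nu b) + (nu b - nu q) + nu q * (1 - A0) by ring.
  apply: (@le_trans _ _ (5 * t)); last first.
    by have := ler_wpM2l (ltW t0) A0h; move: t0; clear; lra.
  apply: (le_trans (ler_normD _ _)).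
  have b3 : `|nu b - nu q| <= t / 7.
    by rewrite ler_norml; apply/andP; move: bq1 bq2 t0; clear; split; lra.
  have q3 : `|nu q * (1 - A0)| <= 17/16 * (t * (17/8)).
    rewrite normrM (ger0_norm (le_trans _ nq2)); last by clear; lra.
    apply: ler_pM => //; first by apply: le_trans nq2; clear; lra.
    by rewrite distrC; exact: le_trans sd.
  have := ler_normD (An - nu b) (nu b - nu q).
  by move: Anb' sd b3 q3 t0; clear; lra.
have gr : gam * r <= gam * nu q + `|gam| * (10 * t).
  rewrite -lerBlDl -mulrBr; apply: (le_trans (ler_norm _)); rewrite normrM.
  exact: ler_wpM2l.
have r2 : r <= 2.
  by move: rq; rewrite ler_norml => /andP[_]; move: nq1 t64; clear; lra.
have rx : r * (2 * x) <= t / 8.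
  have := ler_wpM2r (ltW x20) r2; move: xt; clear; lra.
have -> : An * (A0^-1 * (gam + 2 * x) + e + kappa * (An^-1 * nu (q - iter n (euler B h) b))) =
   gam * r + r * (2 * x) + An * e + kappa * nu (q - iter n (euler B h) b).
  by rewrite rD; field; rewrite !lt0r_neq0.
have gt := mulr_ge0 (normr_ge0 gam) (ltW t0).
by move: Ae kb gr rx t0 gt; clear; lra.
Qed.

(** [radial_param] with N large, where one of n = N^4 and n = 2 N^4 keeps the
    chord off the origin: the backward flow is linear and almost isometric, so
    if it takes q, hence a, close to - a in N^4 steps, then it takes q close to
    a in twice as many. *)
Lemma radial_bound (R : realType) (E : lmodType R) (nu : E -> R)
    (B : {linear E -> E}) (C kappa : R) (bnd : R -> E -> R -> Prop)
    (ell : E -> R) (a q : E) (gam : R) :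
  walkable nu B C kappa bnd ->
  (forall y g, bnd 0 y g -> ell y <= g) ->
  (forall eta, 0 < eta -> eta <= 1 -> bnd eta a (gam + eta)) ->
  nu a = 1 -> nu (q - a) <= 1/16 -> ell q <= gam * nu q.
Proof.
move=> MM bnd_end bnd_start na qa.
rewrite leNgt; apply/negP => lt.
set K := kappa * (2 * (3 * 4 * 5 * 64 ^+ 3 * 2 + 16 + 24 * C ^+ 2 * 256)) * 4 +
     kappa + `|gam| * 20 + 1.
pose gap := ell q - gam * nu q.
have gap0 : 0 < gap by rewrite subr_gt0.
have [N NN] : exists N : nat, Num.max (64 * C ^+ 2) (K / gap) < N%:R.
  by exists (Num.bound (Num.max (64 * C ^+ 2) (K / gap))); rewrite archi_boundP//
    le_max mulr_ge0// sqr_ge0.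
move: NN; rewrite gt_max => /andP[NC NK].
have N0 : 0 < N%:R :> R.
  by apply: le_lt_trans NC; rewrite mulr_ge0// sqr_ge0.
have {NK} NK : N%:R^-1 * K < gap.
  by rewrite mulrC ltr_pdivrMr// -ltr_pdivrMl// mulrC.
suff : ell q <= gam * nu q + N%:R^-1 * K.
  by rewrite -lerBlDl leNgt NK.
case: (MM) => C1 k0 nuD nuZ nuB nuF Ml Mm Ms Mst.
have [h hD] : {h : R | h = (N%:R ^+ 3)^-1} by eexists.
pose b m := iter m (euler B (- h)) q.
have [ab|ab] := lerP (1/4) (nu (a + b (N ^ 4)%N)).
  apply: (radial_param MM bnd_end bnd_start na qa (ltW NC) (n := (N ^ 4)%N)).
    by rewrite leqnn leq_pmull.
  by left; rewrite -hD.
apply: (radial_param MM bnd_end bnd_start na qa (ltW NC) (n := (2 * N ^ 4)%N)).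
  by rewrite leqnn leq_pmull.
right; rewrite -hD -/(b _).
have N64 : 64 <= N%:R :> R.
  have C2 : 1 <= C ^+ 2 by rewrite exprn_ege1.
  by apply: le_trans (ltW NC); lra.
set m := (N ^ 4)%N in ab *.
have [x xD] : {x : R | x = C ^+ 2 * h ^+ 2} by eexists.
have x0 : 0 <= x by rewrite xD mulr_ge0// sqr_ge0.
have mx : m%:R * x <= 1/64.
  have -> : m%:R * x = C ^+ 2 / N%:R ^+ 2.
    by rewrite xD hD /m natrX; field; rewrite lt0r_neq0.
  rewrite ler_pdivrMr ?exprn_gt0//.
  have := ler_pM _ _ (ltW NC) N64; rewrite -expr2 => H.
  have := H (mulr_ge0 (ler0n _ _) (sqr_ge0 C)) (ler0n _ _).
  move: (sqr_ge0 C); clear; lra.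
have X : (1 + x) ^+ m <= 1 + 1/32.
  have := @exprn_1D_le _ x m x0; lra.
have hn : `|- h| <= 1.
  have N3 : 0 < N%:R ^+ 3 :> R by rewrite exprn_gt0.
  rewrite normrN hD gtr0_norm ?invr_gt0// invf_le1// exprn_ege1//.
  by move: N64; clear; lra.
have itb y : nu (iter m (euler B (- h)) y) <= (1 + 1/32) * nu y.
  apply: (le_trans (nu_iter_euler nuF m y hn)); rewrite sqrrN -xD.
  by rewrite ler_wpM2r// (seminorm_ge0 nuD nuZ).
have bE : b (2 * m)%N = iter m (euler B (- h)) (b m).
  by rewrite /b mul2n -addnn iterD.
have bmE : iter m (euler B (- h)) q = b m by [].
clearbody b.
have -> : b (2 * m)%N - a = iter m (euler B (- h)) (a + b m) +
    iter m (euler B (- h)) (q - a) - (a + b m).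
  rewrite bE iter_eulerB bmE.
  have -> : a + b m = b m - (- a) by rewrite opprK addrC.
  rewrite iter_eulerB.
  have -> : iter m (euler B (- h)) (- a) = - iter m (euler B (- h)) a.
    by rewrite -scaleN1r iter_eulerZ scaleN1r.
  move: (iter m _ a) (iter m _ _) => A P.
  transitivity (P - a + (A - A) + (b m - b m)); first by rewrite !subrr !addr0.
  by rewrite !opprK opprD !addrA [RHS](ACl (1*6*2*4*3*5)).
apply: (le_trans (nuD _ _)); rewrite (seminormN nuZ).
have := nuD (iter m (euler B (- h)) (a + b m)) (iter m (euler B (- h)) (q - a)).
have := itb (a + b m); have := itb (q - a); move: qa ab; clear; lra.
Qed.

(** * Sublinear functionals *)

Section Sublinear.
Variables (R : realType) (E : lmodType R).

Definition sublinear (p : E -> R) : Prop :=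
  (forall x y, p (x + y) <= p x + p y) /\
  (forall l x, 0 <= l -> p (l *: x) = l * p x).

Lemma sublinear0 p : sublinear p -> p 0 = 0.
Proof. by case=> _ pZ; rewrite -(scale0r 0) pZ// mul0r. Qed.

Lemma sublinearN p x : sublinear p -> - p (- x) <= p x.
Proof.
move=> pS; have := pS.1 x (- x); rewrite subrr (sublinear0 pS); lra.
Qed.

Lemma sublinear_leN p q x : sublinear p -> (forall y, p y <= q y) ->
  - q (- x) <= p x.
Proof. by move=> pS pq; apply: le_trans (sublinearN x pS); rewrite lerN2. Qed.

(** Lowers p so that its value at - y becomes at most - p y.  A sublinear p
    that cannot be lowered is therefore additive. *)
Definition tilt (p : E -> R) (y x : E) : R :=
  inf [set p (x + t *: y) - t * p y | t in [set t | 0 <= t]].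

Section Tilt.
Variables (p : E -> R) (y : E).
Hypothesis pS : sublinear p.
Let S x := [set p (x + t *: y) - t * p y | t in [set t : R | 0 <= t]].

Lemma tilt_lb x t : 0 <= t -> - p (- x) <= p (x + t *: y) - t * p y.
Proof.
move=> t0; rewrite -(pS.2 _ _ t0) lerBrDr addrC lerBlDr.
apply: le_trans (pS.1 _ _) => /=.
by rewrite addrAC subrr add0r.
Qed.

Lemma tilt_has_inf x : has_inf (S x).
Proof.
split; first by exists (p (x + 0 *: y) - 0 * p y), 0 => /=.
by exists (- p (- x)) => _ [t /= t0 <-]; exact: tilt_lb.
Qed.

Lemma tilt_le x t : 0 <= t -> tilt p y x <= p (x + t *: y) - t * p y.
Proof. by move=> t0; apply: ge_inf; [exact: (tilt_has_inf x).2 | exists t]. Qed.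

Lemma tilt_ge x m :
  (forall t, 0 <= t -> m <= p (x + t *: y) - t * p y) -> m <= tilt p y x.
Proof.
move=> H; apply: lb_le_inf; first exact: (tilt_has_inf x).1.
by move=> _ [t /= t0 <-]; exact: H.
Qed.

Lemma tilt_sublinear : sublinear (tilt p y).
Proof.
split=> [x z|l x l0].
  rewrite -lerBlDr; apply: tilt_ge => t t0; rewrite lerBlDr -lerBlDl.
  apply: tilt_ge => s s0; rewrite lerBlDl.
  apply: (le_trans (tilt_le (x + z) (addr_ge0 t0 s0))).
  have := pS.1 (x + t *: y) (z + s *: y).
  have -> : x + t *: y + (z + s *: y) = x + z + (t + s) *: y.
    by rewrite addrACA scalerDl.
  lra.
have [->|lp] := eqVneq l 0.
  rewrite scale0r mul0r; apply/le_anti/andP; split.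
    by apply: (le_trans (tilt_le 0 (lexx 0))); rewrite scale0r addr0 (sublinear0 pS) mul0r subr0.
  by apply: tilt_ge => t t0; rewrite add0r pS.2// subrr.
have l1 : 0 < l by rewrite lt_neqAle eq_sym lp.
apply/le_anti/andP; split.
  rewrite -ler_pdivrMl//; apply: tilt_ge => t t0; rewrite ler_pdivrMl//.
  apply: (le_trans (tilt_le (l *: x) (mulr_ge0 l0 t0))).
  by rewrite -scalerA -scalerDr pS.2// mulrBr mulrA.
apply: tilt_ge => t t0.
have li0 : 0 <= l^-1 by rewrite invr_ge0.
rewrite -ler_pdivlMl//; apply: (le_trans (tilt_le x (mulr_ge0 li0 t0))).
by rewrite ler_pdivlMl// mulrBr -(pS.2 l)// scalerDr scalerA !mulrA mulfV// !mul1r.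
Qed.

Lemma tilt_le_self x : tilt p y x <= p x.
Proof. by have := tilt_le x (lexx 0); rewrite scale0r addr0 mul0r subr0. Qed.

Lemma tiltN : tilt p y (- y) <= - p y.
Proof.
by have := tilt_le (- y) ler01; rewrite scale1r addNr (sublinear0 pS) mul1r sub0r.
Qed.

End Tilt.

Definition minorant (p : E -> R) : Type :=
  {q : E -> R | sublinear q /\ forall x, q x <= p x}.

(** Zorn's lemma: a pointwise infimum of a chain of sublinear functionals is
    sublinear, and it is finite because of the bound - p (- x). *)
Lemma minimal_sublinear p : sublinear p ->
  exists2 q : E -> R, sublinear q /\ (forall x, q x <= p x) &
    forall r, sublinear r -> (forall x, r x <= q x) -> forall x, r x = q x.
Proof.
move=> pS.
pose T := minorant p; pose t0 : T := exist _ p (conj pS (fun x => lexx (p x))).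
pose rel (s t : T) := `[< forall x, sval t x <= sval s x >].
have [|||[q [qS qp]] qmax] := @ZL_preorder T t0 rel.
- by move=> t; apply/asboolP.
- move=> r s t /asboolP rs /asboolP st; apply/asboolP => x.
  exact: le_trans (st x) (rs x).
- move=> A totA; have [A0|/set0P[u Au]] := eqVneq A set0.
    by exists t0 => s; rewrite A0.
  pose S x := [set sval t x | t in A].
  have Si x : has_inf (S x).
    split; first by exists (sval u x), u.
    exists (- p (- x)) => _ [[t [tS tp]] At <-] /=; exact: sublinear_leN.
  pose m x := inf (S x).
  have mle t x : A t -> m x <= sval t x.
    by move=> At; apply: ge_inf; [exact: (Si x).2|exists t].
  have mge x c : (forall t, A t -> c <= sval t x) -> c <= m x.
    move=> H; apply: lb_le_inf; first exact: (Si x).1.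
    by move=> _ [t At <-]; exact: H.
  have mS : sublinear m.
    split=> [x y|l x l0].
      rewrite -lerBlDr; apply: (mge) => t At; rewrite lerBlDr -lerBlDl.
      apply: (mge) => s As; rewrite lerBlDl.
      have [/asboolP ts|/asboolP st] := totA _ _ At As.
        apply: (le_trans (mle s (x + y) As)).
        by apply: (le_trans ((svalP s).1.1 x y)); rewrite lerD2r.
      apply: (le_trans (mle t (x + y) At)).
      by apply: (le_trans ((svalP t).1.1 x y)); rewrite lerD2l.
    have [->|lp] := eqVneq l 0.
      rewrite scale0r mul0r; apply/le_anti/andP; split.
        by apply: (le_trans (mle u 0 Au)); rewrite (sublinear0 (svalP u).1).
      by apply: (mge) => t At; rewrite (sublinear0 (svalP t).1).
    have l1 : 0 < l by rewrite lt_neqAle eq_sym lp.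
    apply/le_anti/andP; split.
      rewrite -ler_pdivrMl//; apply: (mge) => t At; rewrite ler_pdivrMl//.
      by rewrite -(svalP t).1.2//; exact: (mle).
    by apply: (mge) => t At; rewrite (svalP t).1.2// ler_pM2l//; exact: (mle).
  have mp x : m x <= p x by apply: (le_trans (mle u x Au)); exact: (svalP u).2.
  exists (exist _ m (conj mS mp)) => s As; apply/asboolP => x /=; exact: (mle).
exists q => // r rS rq.
have rp x : r x <= p x := le_trans (rq x) (qp x).
have /asboolP H := qmax (exist _ r (conj rS rp)) (introT (asboolP _) rq).
by move=> x; apply/le_anti/andP; split; [exact: rq|exact: H].
Qed.

(** A minimal functional below [tilt p x0] is linear; its value at - x0 is at
    most - p x0, so that at x0 it reaches p x0. *)
Lemma real_hahn_banach p x0 : sublinear p ->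
  exists f : E -> R, [/\ linear_for *%R f, forall x, f x <= p x & f x0 = p x0].
Proof.
move=> pS.
have [f [fS fp] fmin] := minimal_sublinear (tilt_sublinear x0 pS).
have fp' x : f x <= p x := le_trans (fp x) (tilt_le_self x0 pS x).
have fD x y : f (x + y) = f x + f y.
  apply/le_anti/andP; split; first exact: fS.1.
  have := fmin _ (tilt_sublinear y fS) (tilt_le_self y fS) x.
  by have := tilt_le y fS x ler01; rewrite scale1r mul1r => /[swap] ->; rewrite lerBrDr.
have fN x : f (- x) = - f x.
  by apply/eqP; rewrite -addr_eq0 -fD addNr (sublinear0 fS).
exists f; split=> //.
  move=> l x y; rewrite fD; congr (_ + _).
  have [l0|l0] := lerP 0 l; first exact: fS.2.
  rewrite -[l]opprK scaleNr fN mulNr fS.2//; lra.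
apply/le_anti/andP; split=> //.
by rewrite -lerN2 -fN; apply: (le_trans (fp _)); exact: tiltN.
Qed.

End Sublinear.

(** * Real parts and real-valued norms *)

Section Scalars.
Variables (R : realType) (k : scalar_kind).
Local Notation K := (scalars R k).

Definition sre : K -> R :=
  match k return scalars R k -> R with
  | RealScalars => fun x => x
  | ComplexScalars => fun z => complex.Re z
  end.

Definition sinj : R -> K :=
  match k return R -> scalars R k with
  | RealScalars => fun x => x
  | ComplexScalars => fun x => (x%:C)%C
  end.

(** With the value 0 over the reals, the splitting of a scalar into real and
    imaginary parts has one formula for both fields. *)
Definition simag : K :=
  match k return scalars R k with
  | RealScalars => 0
  | ComplexScalars => 'i%C
  end.

Lemma sinjK x : sre (sinj x) = x.
Proof. by rewrite /sre /sinj; case: k. Qed.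

Lemma sinjD (x y : R) : sinj (x + y) = sinj x + sinj y.
Proof. by rewrite /sinj; case: k => //=; rewrite rmorphD. Qed.

Lemma sinjM x y : sinj (x * y) = sinj x * sinj y.
Proof. by rewrite /sinj; case: k => //=; rewrite rmorphM. Qed.

Lemma sinj1 : sinj 1 = 1.
Proof. by rewrite /sinj; case: k. Qed.

Lemma sinj0 : sinj 0 = 0.
Proof. by rewrite /sinj; case: k. Qed.

Lemma sinjN x : sinj (- x) = - sinj x.
Proof. by rewrite /sinj; case: k => //=; rewrite rmorphN. Qed.

Lemma sinjB x y : sinj (x - y) = sinj x - sinj y.
Proof. by rewrite sinjD sinjN. Qed.

Lemma le_sinj x y : (sinj x <= sinj y) = (x <= y).
Proof. by rewrite /sinj; case: k => //=; rewrite lecR. Qed.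

Lemma lt_sinj x y : (sinj x < sinj y) = (x < y).
Proof.
rewrite !lt_neqAle le_sinj; congr (~~ _ && _).
by apply/eqP/eqP => [/(congr1 sre)|->//]; rewrite !sinjK.
Qed.

Lemma sreD x y : sre (x + y) = sre x + sre y.
Proof. by rewrite /sre; case: k x y => //= -[a b] [c d]. Qed.

Lemma sreN x : sre (- x) = - sre x.
Proof. by rewrite /sre; case: k x => //= -[a b]. Qed.

Lemma sreB x y : sre (x - y) = sre x - sre y.
Proof. by rewrite sreD sreN. Qed.

Lemma sreZ l x : sre (sinj l * x) = l * sre x.
Proof.
by rewrite /sre /sinj; case: k x => //= -[a b] /=; rewrite mul0r subr0.
Qed.

Lemma sre1 : sre 1 = 1.
Proof. by rewrite -sinj1 sinjK. Qed.

Lemma sre0 : sre 0 = 0.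
Proof. by rewrite -sinj0 sinjK. Qed.

Lemma ge0_sinj x : 0 <= x -> x = sinj (sre x).
Proof.
rewrite /sre /sinj; case: k x => //= x.
by rewrite lecE /=; case: x => a b /= /andP[/eqP ->].
Qed.

Lemma sre_le x y : x <= y -> sre x <= sre y.
Proof.
move=> xy; rewrite -subr_ge0 -sreB.
have := xy; rewrite -subr_ge0 => /[dup] /ge0_sinj ->.
by rewrite -[0]sinj0 le_sinj sinjK.
Qed.

Lemma sre_lt x y : x < y -> sre x < sre y.
Proof.
move=> xy; rewrite -subr_gt0 -sreB.
have := xy; rewrite -subr_gt0 => /[dup] /ltW/ge0_sinj ->.
by rewrite -[0]sinj0 lt_sinj sinjK.
Qed.

Lemma sinj_ge0 x : (0 <= sinj x) = (0 <= x).
Proof. by rewrite -sinj0 le_sinj. Qed.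

Lemma norm_sinj x : `|sinj x| = sinj `|x|.
Proof.
have [x0|x0] := lerP 0 x.
  by rewrite (ger0_norm x0) ger0_norm// sinj_ge0.
by rewrite (ltr0_norm x0) ltr0_norm ?sinjN// -sinj0 lt_sinj.
Qed.

Lemma sinjV x : sinj x^-1 = (sinj x)^-1.
Proof.
have [->|x0] := eqVneq x 0; first by rewrite invr0 sinj0 invr0.
have s0 : sinj x != 0.
  by apply: contra x0 => /eqP/(congr1 sre); rewrite sinjK sre0 => ->.
by apply: (mulIf s0); rewrite -sinjM !mulVf// sinj1.
Qed.

Section Norm.
Variable V : normedZmodType K.

(** The norm as a real number: estimates need a total order, which the complex
    scalars lack. *)
Definition rnorm (x : V) : R := sre `|x|.

Lemma rnormE x : `|x| = sinj (rnorm x).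
Proof. exact: ge0_sinj. Qed.

Lemma rnorm_ge0 x : 0 <= rnorm x.
Proof. by rewrite /rnorm -sre0; apply: sre_le. Qed.

Lemma rnormD x y : rnorm (x + y) <= rnorm x + rnorm y.
Proof. by rewrite /rnorm -sreD; apply: sre_le; exact: ler_normD. Qed.

Lemma rnormN x : rnorm (- x) = rnorm x.
Proof. by rewrite /rnorm normrN. Qed.

Lemma rnorm0 : rnorm 0 = 0.
Proof. by rewrite /rnorm normr0 sre0. Qed.

Lemma rnorm_eq0 x : rnorm x = 0 -> x = 0.
Proof. by move=> x0; apply/eqP; rewrite -normr_eq0 rnormE x0 sinj0. Qed.

End Norm.

Lemma rnormZ (V : normedModType K) l (x : V) : rnorm (l *: x) = rnorm l * rnorm x.
Proof. by rewrite /rnorm normrZ (ge0_sinj (normr_ge0 l)) sreZ sinjK. Qed.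

Lemma rnormM (l x : K) : rnorm (l * x) = rnorm l * rnorm x.
Proof. by rewrite /rnorm normrM (ge0_sinj (normr_ge0 l)) sreZ sinjK. Qed.

Lemma rnorm_sinj x : rnorm (sinj x) = `|x|.
Proof. by rewrite /rnorm norm_sinj sinjK. Qed.

Lemma rnorm1 : rnorm (1 : K) = 1.
Proof. by rewrite -sinj1 rnorm_sinj normr1. Qed.

Lemma sre_le_rnorm (z : K) : sre z <= rnorm z.
Proof.
rewrite /rnorm /sre; case: k z => [x|z] /=; first exact: ler_norm.
have := normc_ge_Re z; rewrite lecE => /andP[_]; apply: le_trans.
exact: ler_norm.
Qed.

Lemma norm_sre_le (z : K) : `|sre z| <= rnorm z.
Proof.
by rewrite ler_norml sre_le_rnorm andbT lerNl -sreN -rnormN sre_le_rnorm.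
Qed.

Lemma phase (z : K) : exists2 u : K, rnorm u = 1 & u * z = sinj (rnorm z).
Proof.
have [->|z0] := eqVneq z 0.
  by exists 1; rewrite ?rnorm1// mulr0 rnorm0 sinj0.
exists (`|z| / z); last by rewrite mulfVK// rnormE.
by rewrite /rnorm normrM normfV normr_id mulfV ?normr_eq0// sre1.
Qed.

Lemma simag_sq_split (z : K) :
  z = sinj (sre z) - simag * sinj (sre (simag * z)).
Proof.
rewrite /sre /sinj /simag; case: k z => [x|[a b]] /=.
  by rewrite !mul0r subr0.
by simpc; rewrite ?mul0r ?mul1r ?sub0r ?add0r ?opprK ?subr0 ?addr0 ?mul0r ?oppr0.
Qed.

End Scalars.

(** * Hahn-Banach over both scalar fields *)

Section Realified.
Variables (R : realType) (k : scalar_kind).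
Local Notation K := (scalars R k).
Variable V : lmodType K.

Definition realified : Type := V.
HB.instance Definition _ := GRing.Zmodule.copy realified V.

Let rscale (r : R) (x : realified) : realified := sinj k r *: (x : V).

Let rscaleA a b x : rscale a (rscale b x) = rscale (a * b) x.
Proof. by rewrite /rscale scalerA sinjM. Qed.
Let rscale1 x : rscale 1 x = x.
Proof. by rewrite /rscale sinj1 scale1r. Qed.
Let rscaleDr a x y : rscale a (x + y) = rscale a x + rscale a y.
Proof. by rewrite /rscale scalerDr. Qed.
Let rscaleDl x a b : rscale (a + b) x = rscale a x + rscale b x.
Proof. by rewrite /rscale sinjD scalerDl. Qed.

HB.instance Definition _ := GRing.Zmodule_isLmodule.Build R realified
  rscaleA rscale1 rscaleDr rscaleDl.

Lemma realifiedZ (r : R) (x : realified) : r *: x = sinj k r *: (x : V).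
Proof. by []. Qed.

End Realified.

Section HahnBanach.
Variables (R : realType) (k : scalar_kind).
Local Notation K := (scalars R k).

Lemma sre_simag (y : R) : sre (simag R k * sinj k y) = 0.
Proof.
by rewrite /sre /simag /sinj; case: k => /=; rewrite ?mul0r//; simpc.
Qed.

Lemma simag_sq : simag R k = 0 \/ simag R k * simag R k = -1.
Proof.
rewrite /simag; case: k => /=; [by left | right].
by rewrite -expr2 sqr_i.
Qed.

Lemma rnorm_le_sre (z : K) : rnorm z <= sre z -> z = sinj k (sre z).
Proof.
rewrite /rnorm /sre /sinj; case: k z => //= -[a b] /=.
move=> le_a.
have a0 : 0 <= a by apply: le_trans le_a; exact: sqrtr_ge0.
have s0 : 0 <= a ^+ 2 + b ^+ 2 by rewrite addr_ge0// sqr_ge0.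
have : a ^+ 2 + b ^+ 2 <= a ^+ 2.
  by rewrite -[leLHS]sqr_sqrtr// ler_pXn2r// nnegrE// sqrtr_ge0.
rewrite gerDl => b0; have /eqP : b ^+ 2 == 0 by rewrite eq_le b0 sqr_ge0.
by move/eqP; rewrite sqrf_eq0 => /eqP ->.
Qed.

(** The real extension f gives the functional f x - i f (i x); rotating a value
    to the positive half line reduces its modulus to its real part. *)
Lemma hahn_banach (V : lmodType K) (q : V -> R) (x0 : V) :
  (forall x y, q (x + y) <= q x + q y) ->
  (forall l x, q (l *: x) = rnorm l * q x) ->
  exists f : V -> K^o, [/\ linear f, forall x, rnorm (f x : K) <= q x &
    f x0 = sinj k (q x0)].
Proof.
move=> qD qZ.
have qS : @sublinear R (realified V) q.
  split=> // l x l0; rewrite realifiedZ qZ rnorm_sinj ger0_norm//.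
have [f [flin fq fx0]] := @real_hahn_banach R (realified V) q x0 qS.
have fD x y : f (x + y) = f x + f y.
  by have := flin 1 x y; rewrite scale1r mul1r.
have f0 : f 0 = 0 by have := fD 0 0; rewrite addr0; lra.
have fZ (l : R) (x : V) : f (sinj k l *: x) = l * f x.
  by have := flin l x 0; rewrite addr0 f0 addr0.
pose F (x : V) : K^o := sinj k (f x) - simag R k * sinj k (f (simag R k *: x)).
have FD x y : F (x + y) = F x + F y.
  by rewrite /F scalerDr !fD !sinjD mulrDr opprD addrACA.
have FZr (l : R) x : F (sinj k l *: x) = sinj k l * F x.
  rewrite /F fZ scalerA [simag R k * sinj k l]mulrC -scalerA fZ !sinjM mulrBr.
  by congr (_ - _); rewrite mulrCA.
have FI x : F (simag R k *: x) = simag R k * F x.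
  have [i0|ii] := simag_sq.
    by rewrite /F i0 scale0r !mul0r f0 sinj0 subr0.
  rewrite /F scalerA ii scaleN1r mulrBr mulrA ii mulN1r opprK.
  have -> : f (- x) = - f x by have := fD x (- x); rewrite subrr f0; lra.
  by rewrite sinjN mulrN opprK addrC.
have FN x : F (- x) = - F x.
  by have := FZr (-1) x; rewrite sinjN sinj1 scaleN1r mulN1r.
have FZ l x : F (l *: x) = l * F x.
  rewrite {1}(simag_sq_split l) scalerBl FD FN FZr -scalerA FI FZr mulrA.
  by rewrite -mulrBl -simag_sq_split.
have sF x : sre (F x : K) = f x by rewrite /F sreB sinjK sre_simag subr0.
have Fq x : rnorm (F x : K) <= q x.
  have [u u1 uF] := phase (F x : K).
  have -> : rnorm (F x : K) = f (u *: x) by rewrite -sF FZ uF sinjK.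
  by apply: (le_trans (fq _)); rewrite qZ u1 mul1r.
exists F; split=> //; first by move=> l x y; rewrite FD FZ.
have := @rnorm_le_sre (F x0); rewrite sF fx0; apply; exact: Fq.
Qed.

End HahnBanach.

Section Operators.
Variables (R : realType) (k : scalar_kind).
Local Notation K := (scalars R k).
Variables V W : normedModType K.

Lemma rnorm_blin (T : blin V W) x : rnorm (T x) <= rnorm T * rnorm x.
Proof.
have := sre_le (le_op_norm T x).
have -> : op_norm T = `|T| by [].
by rewrite (rnormE T) sreZ.
Qed.

Lemma rnorm_blin_le (T : blin V W) (M : R) :
  0 <= M -> (forall x, rnorm (T x) <= M * rnorm x) -> rnorm T <= M.
Proof.
move=> M0 TM.
suff : op_norm T <= sinj k M by move/sre_le; rewrite sinjK.
rewrite /op_norm /supremum; case: ifPn => _; first by rewrite sinj_ge0.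
case: xgetP => [y _ [_]|_]; last by rewrite sinj_ge0.
apply => _ [x /= x1 <-]; rewrite rnormE le_sinj.
apply: (le_trans (TM x)); rewrite ler_piMr//.
by have := sre_le x1; rewrite sre1.
Qed.

Lemma blin_ofP (f : V -> W) (M : R) : linear f ->
  (forall x, rnorm (f x) <= M * rnorm x) -> f \in @blin_pred R k V W.
Proof.
move=> flin fM; apply/mem_set; split => //.
by exists (sinj k M) => x; rewrite !rnormE -sinjM le_sinj.
Qed.

Definition blin_of (f : V -> W) (M : R) (flin : linear f)
    (fM : forall x, rnorm (f x) <= M * rnorm x) : blin V W :=
  BLin (blin_ofP flin fM).

Lemma blin_eqP (S T : blin V W) : (forall x, S x = T x) -> S = T.
Proof. by move=> ST; apply/val_inj/funext. Qed.

End Operators.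

(** * Numerical radius *)

Section Composition.
Variables (R : realType) (k : scalar_kind).
Local Notation K := (scalars R k).

Section Comp.
Variables U V W : normedModType K.
Variables (S : blin V W) (T : blin U V).

Lemma comp_linear : linear (S \o T).
Proof. by move=> l x y /=; rewrite !linearP. Qed.

Lemma comp_bound x : rnorm ((S \o T) x) <= rnorm S * rnorm T * rnorm x.
Proof.
rewrite /= -mulrA; apply: (le_trans (rnorm_blin _ _)).
by rewrite ler_wpM2l ?rnorm_ge0// rnorm_blin.
Qed.

Definition bcomp : blin U W := blin_of comp_linear comp_bound.

Lemma bcompE x : bcomp x = S (T x).
Proof. by []. Qed.

Lemma rnorm_bcomp : rnorm bcomp <= rnorm S * rnorm T.
Proof.
apply: rnorm_blin_le; first by rewrite mulr_ge0 ?rnorm_ge0.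
exact: comp_bound.
Qed.

End Comp.

Variable V : normedModType K.

Lemma id_linear : linear (@idfun V).
Proof. by []. Qed.

Lemma id_bound (x : V) : rnorm (idfun x) <= 1 * rnorm x.
Proof. by rewrite mul1r. Qed.

Definition bid : blin V V := blin_of id_linear id_bound.

Lemma bidE x : bid x = x.
Proof. by []. Qed.

Lemma rnorm_bid : rnorm bid <= 1.
Proof. by apply: rnorm_blin_le => // x; exact: id_bound. Qed.

Lemma supporting (x : V) : exists f : dual V,
  rnorm f <= 1 /\ f x = sinj k (rnorm x).
Proof.
have [F [Flin Fq Fx]] := @hahn_banach R k V (@rnorm R k V) x (@rnormD R k V) (@rnormZ R k V).
have Fb y : rnorm (F y) <= 1 * rnorm y by rewrite mul1r; exact: Fq.
exists (blin_of Flin Fb); split=> //.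
exact: (rnorm_blin_le (T := blin_of Flin Fb) ler01 Fb).
Qed.

End Composition.

Section NumRadius.
Variables (R : realType) (k : scalar_kind).
Local Notation K := (scalars R k).
Variable V : normedModType K.
Implicit Types S T : blin V V.

Lemma numerical_pairsP (fx : dual V * V) : numerical_pairs fx <->
  [/\ rnorm fx.1 = 1, rnorm fx.2 = 1 & fx.1 fx.2 = 1].
Proof.
by split=> -[f1 x1 fx1]; split=> //;
  [rewrite /rnorm f1 sre1|rewrite /rnorm x1 sre1|rewrite rnormE f1 sinj1|
   rewrite rnormE x1 sinj1].
Qed.

Lemma supporting_pair (x : V) : x != 0 -> exists f : dual V,
  numerical_pairs (f, sinj k (rnorm x)^-1 *: x) /\ f x = sinj k (rnorm x).
Proof.
move=> x0; have [f [f1 fx]] := supporting x.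
have nx : rnorm x != 0 by apply: contra x0 => /eqP/rnorm_eq0 ->.
have nx0 : 0 < rnorm x by rewrite lt_neqAle eq_sym nx rnorm_ge0.
have fnx : f (sinj k (rnorm x)^-1 *: x) = 1.
  by rewrite linearZ /= fx [_ *: _](_ : _ = sinj k (rnorm x)^-1 * sinj k (rnorm x))// -sinjM mulVf// sinj1.
have x1 : rnorm (sinj k (rnorm x)^-1 *: x) = 1.
  by rewrite rnormZ rnorm_sinj gtr0_norm ?invr_gt0// mulVf.
exists f; split=> //; apply/numerical_pairsP; split=> //=.
apply/le_anti; rewrite f1 /=.
have := rnorm_blin f (sinj k (rnorm x)^-1 *: x).
by rewrite x1 mulr1 fnx; apply: le_trans; rewrite rnorm1.
Qed.

Definition rv T : R := sre (numerical_radius T).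

Lemma numerical_radius_sinj T : numerical_radius T = sinj k (rv T).
Proof. exact: ge0_sinj (numerical_radius_ge0 T). Qed.

Lemma rv_ge0 T : 0 <= rv T.
Proof. by rewrite /rv -(sre0 R k); exact: sre_le (numerical_radius_ge0 T). Qed.

Lemma rvD S T : rv (S + T) <= rv S + rv T.
Proof. by rewrite /rv -sreD; exact: sre_le (numerical_radiusD S T). Qed.

Lemma rvZ l T : rv (l *: T) = rnorm l * rv T.
Proof.
by rewrite /rv numerical_radiusZ (ge0_sinj (normr_ge0 l)) sreZ.
Qed.

Lemma rvN T : rv (- T) = rv T.
Proof. by rewrite -scaleN1r rvZ rnormN rnorm1 mul1r. Qed.

Lemma rv_pair T (f : dual V) x : numerical_pairs (f, x) -> rnorm (f (T x)) <= rv T.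
Proof.
move=> fx.
suff : `|f (T x)| <= numerical_radius T by exact: sre_le.
apply: (@sup_seminorm_ub R k (blin V V) _ (@numerical_pairs R k V)
  (fun fx T => `|fx.1 (T fx.2)|) _ _ T (f, x) fx) => //.
move=> {T fx f x} T.
exists (`|T|) => -[f x] [/= f1 x1 _].
apply: (le_trans (le_op_norm _ _)).
have -> : op_norm f = 1 by [].
by rewrite mul1r; have := le_op_norm T x; rewrite x1 mulr1.
Qed.

Lemma rv_le T (M : R) : 0 <= M ->
  (forall f x, numerical_pairs (f, x) -> rnorm (f (T x)) <= M) -> rv T <= M.
Proof.
move=> M0 TM.
suff : numerical_radius T <= sinj k M by move/sre_le; rewrite sinjK.
rewrite /numerical_radius /supremum; case: ifPn => _; first by rewrite sinj_ge0.
case: xgetP => [y _ [_]|_]; last by rewrite sinj_ge0.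
apply => _ [[f x] fx <-]; rewrite rnormE le_sinj; exact: TM.
Qed.

Lemma rv_le_rnorm T : rv T <= rnorm T.
Proof.
apply: rv_le; first exact: rnorm_ge0.
move=> f x /numerical_pairsP[/= f1 x1 _].
apply: (le_trans (rnorm_blin _ _)); rewrite f1 mul1r.
by apply: (le_trans (rnorm_blin _ _)); rewrite x1 mulr1.
Qed.

Lemma rv_bid : rv (bid V) <= 1.
Proof. exact: le_trans (rv_le_rnorm _) (rnorm_bid _). Qed.

Lemma rv_approx T (e : R) : 0 < rv T -> 0 < e ->
  exists f x, numerical_pairs (f, x) /\ rv T - e < rnorm (f (T x)).
Proof.
move=> v0 e0; apply: contrapT => H.
have : rv T <= Num.max 0 (rv T - e).
  apply: rv_le; first by rewrite le_max lexx.
  move=> f x fx; rewrite le_max; apply/orP; right.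
  by rewrite leNgt; apply/negP => lt; apply: H; exists f, x.
by rewrite le_max => /orP[]; lra.
Qed.

Lemma numerical_index_le T : 0 < numerical_index V ->
  sre (numerical_index V) * rnorm T <= rv T.
Proof.
move=> n0.
have [->|T0] := eqVneq T 0.
  by rewrite rnorm0 mulr0 rv_ge0.
have nT : 0 < rnorm T.
  rewrite lt_neqAle rnorm_ge0 andbT eq_sym.
  by apply: contra T0 => /eqP/rnorm_eq0 ->.
pose S := sinj k (rnorm T)^-1 *: T.
have S1 : `|S| = 1.
  by rewrite rnormE rnormZ rnorm_sinj gtr0_norm ?invr_gt0// mulVf ?lt0r_neq0// sinj1.
have : numerical_index V <= numerical_radius S.
  move: n0; rewrite /numerical_index /infimum; case: ifPn => [_|_]; first by rewrite ltxx.
  case: xgetP => [y _ [+ _] _|_]; last by rewrite ltxx.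
  by apply; exists S.
move/sre_le; rewrite -/(rv S) rvZ rnorm_sinj gtr0_norm ?invr_gt0//.
by rewrite ler_pdivlMl// mulrC.
Qed.

Lemma sre_numerical_index : 0 < numerical_index V -> 0 < sre (numerical_index V).
Proof. by move/sre_lt; rewrite sre0. Qed.

(** If f norms x, the real part of f (x - h A x) is at least (1 - h mu) |x|, so
    I - h A is bounded below by 1 - h mu.  Apply this to (I + h A) x and use
    (I - h A) (I + h A) = I - h^2 A^2. *)
Lemma rnorm_id_add (A : blin V V) (mu h : R) : 0 <= h -> h * mu < 1 ->
  (forall f x, numerical_pairs (f, x) -> sre (f (A x)) <= mu) ->
  rnorm (bid V + sinj k h *: A) <= (1 + h ^+ 2 * rnorm A ^+ 2) / (1 - h * mu).
Proof.
move=> h0 hmu Amu.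
have d0 : 0 < 1 - h * mu by lra.
have lower x : (1 - h * mu) * rnorm x <= rnorm (x - sinj k h *: A x).
  have [->|x0] := eqVneq x 0; first by rewrite rnorm0 mulr0 rnorm_ge0.
  have [f [fx fxE]] := supporting_pair x0.
  have nx0 : 0 < rnorm x.
    rewrite lt_neqAle rnorm_ge0 andbT eq_sym.
    by apply: contra x0 => /eqP/rnorm_eq0 ->.
  have fA : sre (f (A x)) <= rnorm x * mu.
    rewrite -ler_pdivrMl// -sreZ; have := Amu _ _ fx.
    have -> : f (A (sinj k (rnorm x)^-1 *: x)) = sinj k (rnorm x)^-1 * f (A x).
      by rewrite !linearZ.
    by [].
  have /numerical_pairsP[/= f1 _ _] := fx.
  have := rnorm_blin f (x - sinj k h *: A x); rewrite f1 mul1r.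
  move=> H; apply: le_trans H; apply: le_trans (sre_le_rnorm _).
  have -> : f (x - sinj k h *: A x) = sinj k (rnorm x) - sinj k h * f (A x).
    by rewrite linearB linearZ /= fxE.
  by rewrite sreB sinjK sreZ; have := ler_wpM2l h0 fA; lra.
apply: rnorm_blin_le.
  apply: divr_ge0; last exact: ltW.
  by rewrite addr_ge0// mulr_ge0// sqr_ge0.
move=> x; rewrite mulrAC ler_pdivlMr// mulrC.
apply: (le_trans (lower _)).
have -> : (bid V + sinj k h *: A) x - sinj k h *: A ((bid V + sinj k h *: A) x) =
    x - sinj k (h ^+ 2) *: A (A x).
  rewrite blinDE blinZE bidE.
  have -> : A (x + sinj k h *: A x) = A x + sinj k h *: A (A x).
    by rewrite linearD linearZ.
  by rewrite scalerDr scalerA -sinjM -expr2 opprD addrA addrK.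
apply: (le_trans (rnormD _ _)); rewrite rnormN rnormZ rnorm_sinj ger0_norm ?sqr_ge0//.
rewrite mulrDl mul1r lerD2l.
have -> : h ^+ 2 * rnorm A ^+ 2 * rnorm x = h ^+ 2 * (rnorm A * (rnorm A * rnorm x)).
  by ring.
apply: ler_wpM2l; first exact: sqr_ge0.
apply: (le_trans (rnorm_blin _ _)).
by apply: ler_wpM2l; [exact: rnorm_ge0 | exact: rnorm_blin].
Qed.

End NumRadius.

(** * Compact operators close to the identity *)

Section Distance.
Variables (R : realType) (k : scalar_kind).
Local Notation K := (scalars R k).
Variables (E : lmodType K) (p : E -> R) (S : set E).
Hypothesis pD : forall x y, p (x + y) <= p x + p y.
Hypothesis pZ : forall l x, p (l *: x) = rnorm l * p x.
Hypothesis S0 : S 0.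
Hypothesis Slin : forall (a : K) x y, S x -> S y -> S (a *: x + y).

Lemma kseminorm_ge0 x : 0 <= p x.
Proof.
have p0 : p 0 = 0 by rewrite -(scale0r 0) pZ rnorm0 mul0r.
have pN : p (- x) = p x by rewrite -scaleN1r pZ rnormN rnorm1 mul1r.
by have := pD x (- x); rewrite subrr p0 pN; lra.
Qed.

Definition dist_to (x : E) : R := inf [set p (x - s) | s in S].

Lemma dist_to_has_inf x : has_inf [set p (x - s) | s in S].
Proof.
split; first by exists (p (x - 0)), 0.
by exists 0 => _ [s _ <-]; exact: kseminorm_ge0.
Qed.

Lemma dist_to_le x s : S s -> dist_to x <= p (x - s).
Proof. by move=> Ss; apply: ge_inf; [exact: (dist_to_has_inf x).2|exists s]. Qed.

Lemma dist_to_ge x c : (forall s, S s -> c <= p (x - s)) -> c <= dist_to x.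
Proof.
move=> H; apply: lb_le_inf; first exact: (dist_to_has_inf x).1.
by move=> _ [s Ss <-]; exact: H.
Qed.

Lemma dist_toD x y : dist_to (x + y) <= dist_to x + dist_to y.
Proof.
rewrite -lerBlDr; apply: dist_to_ge => s Ss; rewrite lerBlDr -lerBlDl.
apply: dist_to_ge => t St; rewrite lerBlDl.
have Sst : S (s + t) by rewrite -[s]scale1r; exact: Slin.
apply: (le_trans (dist_to_le (x + y) Sst)).
by rewrite opprD addrACA; exact: pD.
Qed.

Lemma dist_toZ l x : dist_to (l *: x) = rnorm l * dist_to x.
Proof.
have SZ a s : S s -> S (a *: s) by move=> Ss; rewrite -[a *: s]addr0; exact: Slin.
have [->|l0] := eqVneq l 0.
  rewrite scale0r rnorm0 mul0r; apply/le_anti/andP; split.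
    apply: (le_trans (dist_to_le 0 S0)).
    by rewrite subrr -(scale0r 0) pZ rnorm0 mul0r.
  by apply: dist_to_ge => s _; exact: kseminorm_ge0.
have nl : 0 < rnorm l.
  rewrite lt_neqAle rnorm_ge0 andbT eq_sym.
  by apply: contra l0 => /eqP/rnorm_eq0 ->.
apply/le_anti/andP; split.
  rewrite -ler_pdivrMl//; apply: dist_to_ge => s Ss; rewrite ler_pdivrMl//.
  by rewrite -pZ scalerBr; apply: dist_to_le; exact: SZ.
apply: dist_to_ge => s Ss.
have -> : l *: x - s = l *: (x - l^-1 *: s) by rewrite scalerBr scalerA mulfV// scale1r.
by rewrite pZ ler_pM2l//; apply: dist_to_le; exact: SZ.
Qed.

(** [hahn_banach] for the quotient seminorm modulo S. *)
Lemma hahn_banach_distance (x0 : E) : exists f : E -> K^o,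
  [/\ linear f, forall x, rnorm (f x : K) <= p x, forall s, S s -> f s = 0 &
    f x0 = sinj k (dist_to x0)].
Proof.
have [f [flin fd fx]] := hahn_banach x0 dist_toD dist_toZ.
exists f; split=> //.
  move=> x; apply: (le_trans (fd x)).
  by apply: (le_trans (dist_to_le x S0)); rewrite subr0.
move=> s Ss; apply: (@rnorm_eq0 R k K^o); apply/le_anti/andP; split; last exact: rnorm_ge0.
apply: (le_trans (fd s)); apply: (le_trans (dist_to_le s Ss)).
by rewrite subrr -(scale0r 0) pZ rnorm0 mul0r.
Qed.

Lemma dist_to_lt x c : dist_to x < c -> exists2 s, S s & p (x - s) < c.
Proof.
move=> lt; apply: contrapT => H.
suff : c <= dist_to x by rewrite leNgt lt.
apply: dist_to_ge => s Ss; rewrite leNgt; apply/negP => ps; apply: H.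
by exists s.
Qed.

End Distance.

Section MIdeal.
Variables (R : realType) (k : scalar_kind).
Local Notation K := (scalars R k).
Variables (X : normedModType K) (n_gt0 : 0 < numerical_index X).
Local Notation Z := (Lv n_gt0).
Local Notation J := (Kv n_gt0).

Lemma rnorm_Lv (T : Z) : rnorm T = rv T.
Proof. by []. Qed.

Variable P : {linear dual Z -> dual Z}.
Hypothesis J0 : J 0.
Hypothesis Jlin : forall (a : K) x y, J x -> J y -> J (a *: x + y).
Hypothesis kerP : [set f | P f = 0] = annihilator J.
Hypothesis PP : forall f, P (P f) = P f.
Hypothesis Pnorm : forall f, `|f| = `|P f| + `|f - P f|.

Definition idZ : Z := bid X.

Lemma ker_P (f : dual Z) : P f = 0 <-> (forall T, J T -> f T = 0).
Proof.
split=> [Pf T JT|fJ].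
  have H : annihilator J f by rewrite -kerP.
  exact: H.
have H : [set f | P f = 0] f by rewrite kerP.
exact: H.
Qed.

Lemma P_on_J (f : dual Z) T : J T -> P f T = f T.
Proof.
move=> JT; have /ker_P/(_ _ JT) : P (f - P f) = 0 by rewrite linearB PP subrr.
by move/eqP; rewrite subr_eq0 => /eqP.
Qed.

Lemma rnorm_P (f : dual Z) : rnorm f = rnorm (P f) + rnorm (f - P f).
Proof. by rewrite /rnorm Pnorm sreD. Qed.

(** The claim says that the point (K0 + lam I, P phi I) of Z x K has distance at
    most 1 from the subspace of the pairs (lam L, phi L) with L compact, for
    the norm max (v z, (2 / eps) |s|).  A functional vanishing on this subspace
    which computes the distance has the form psi z + c s with |psi| <= 1 and
    lam psi + c phi in the annihilator of J.  Hence c P phi = - lam P psi, and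
    the value at the point is P psi K0 + lam (psi - P psi) I, which is at most
    |P psi| + |psi - P psi| = |psi| in modulus. *)
Lemma compact_near_identity (K0 : Z) (lam : K) (phi : dual Z) (eps : R) :
  J K0 -> rv K0 <= 1 -> rnorm lam = 1 -> 0 < eps -> eps <= 1 ->
  exists2 L : Z, J L & rv (K0 + lam *: (idZ - L)) <= 1 + eps /\
    rnorm (phi L - P phi idZ) <= eps.
Proof.
move=> JK0 K01 lam1 e0 e1.
pose E : lmodType K := (Z * K^o)%type.
pose p (w : E) : R := Num.max (rv w.1) (2 / eps * rnorm w.2).
have c0 : 0 < 2 / eps by rewrite divr_gt0.
have pD x y : p (x + y) <= p x + p y.
  rewrite /p ge_max; apply/andP; split.
    by apply: (le_trans (rvD _ _)); apply: lerD; rewrite le_max lexx.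
  apply: (@le_trans _ _ (2 / eps * (rnorm x.2 + rnorm y.2))).
    by rewrite ler_pM2l//; exact: rnormD.
  by rewrite mulrDr; apply: lerD; rewrite le_max lexx orbT.
have pZ l x : p (l *: x) = rnorm l * p x.
  by rewrite /p /= rvZ rnormZ maxr_pMr ?rnorm_ge0// mulrCA.
pose S : set E := [set (lam *: L, phi L) | L in J].
have S0 : S 0 by exists 0 => //; rewrite scaler0 linear0.
have Slin (a : K) x y : S x -> S y -> S (a *: x + y).
  move=> [L JL <-] [L' JL' <-]; exists (a *: L + L'); first exact: Jlin.
  by rewrite scalerDr scalerA mulrC -scalerA linearP.
pose x0 : E := (K0 + lam *: idZ, P phi idZ).
have [f [flin fp fS fx0]] := hahn_banach_distance pD pZ S0 Slin x0.
have fD x y : f (x + y) = f x + f y.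
  by have := flin 1 x y; rewrite !scale1r.
have f0 : f 0 = 0 by apply: (addrI (f 0)); rewrite -fD !addr0.
have fZ l x : f (l *: x) = l * f x.
  by have := flin l x 0; rewrite f0 !addr0.
pose psi0 (z : Z) : K^o := f (z, 0).
have psilin : linear psi0.
  by move=> l x y; rewrite /psi0 -flin; congr f; rewrite /= [RHS]surjective_pairing /= scaler0 addr0.
have psib z : rnorm (psi0 z) <= 1 * rnorm z.
  apply: (le_trans (fp _)); rewrite /p /= rnorm0 mulr0 mul1r.
  by rewrite ge_max lexx rv_ge0.
pose psi : dual Z := blin_of psilin psib.
have psi1 : rnorm psi <= 1 by apply: rnorm_blin_le.
pose c : K := f (0, 1).
have fE z s : f (z, s) = psi z + c * s.
  rewrite mulrC -fZ -[psi z]/(f (z, 0)) -fD; congr f.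
  by rewrite [RHS]surjective_pairing /= scaler0 addr0 add0r [s *: 1]mulr1.
have Pc : c *: P phi = - (lam *: P psi).
  apply/eqP; rewrite -addr_eq0 addrC -!linearZ -linearD; apply/eqP/ker_P => T JT.
  have := fS _ (ex_intro2 _ _ T JT erefl : S _).
  by rewrite fE linearZ.
have fx0E : f x0 = P psi K0 + lam * (psi - P psi) idZ.
  have cE : c * P phi idZ = - (lam * P psi idZ).
    by have /(congr1 (fun g : dual Z => g idZ)) := Pc.
  have pE : psi (K0 + lam *: idZ) = psi K0 + lam * psi idZ.
    by rewrite linearD linearZ.
  have sE : (psi - P psi) idZ = psi idZ - P psi idZ by [].
  by rewrite /x0 fE pE cE sE (P_on_J psi JK0) mulrBr addrA.
have d1 : dist_to p S x0 <= 1.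
  have -> : dist_to p S x0 = rnorm (f x0 : K).
    rewrite fx0 rnorm_sinj ger0_norm// /dist_to; apply: dist_to_ge => // s Ss.
    exact: (kseminorm_ge0 pD pZ).
  rewrite fx0E; apply: (le_trans (rnormD _ _)); rewrite rnormM lam1 mul1r.
  apply: (@le_trans _ _ (rnorm (P psi) + rnorm (psi - P psi))); last by rewrite -rnorm_P.
  apply: lerD.
    apply: (le_trans (rnorm_blin _ _)); rewrite ler_piMr ?rnorm_ge0//.
  apply: (le_trans (rnorm_blin _ _)); rewrite ler_piMr ?rnorm_ge0//.
  exact: rv_bid.
have [|_ [L JL <-]] := @dist_to_lt _ _ E p S pD pZ S0 x0 (1 + eps).
  by apply: le_lt_trans d1 _; lra.
rewrite /p /= gt_max => /andP[v1 v2]; exists L => //; split.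
  apply: ltW; move: v1.
  by have -> : K0 + lam *: idZ - lam *: L = K0 + lam *: (idZ - L) by rewrite scalerBr addrA.
rewrite -rnormN opprB.
have : rnorm (P phi idZ - phi L) < (1 + eps) / (2 / eps) by rewrite ltr_pdivlMr// mulrC.
move/ltW/le_trans; apply.
have -> : (1 + eps) / (2 / eps) = (1 + eps) / 2 * eps by field; rewrite lt0r_neq0.
by apply: ler_piMl; [exact: ltW | lra].
Qed.

End MIdeal.

(** * Compactness and rank one operators *)

Section Compactness.
Variables (R : realType) (k : scalar_kind).
Local Notation K := (scalars R k).

Lemma nbhs_rnorm (V : normedModType K) (x : V) (A : set V) :
  nbhs x A <-> exists2 e : R, 0 < e & forall y, rnorm (x - y) < e -> A y.
Proof.
split.
  move=> /nbhs_normP[e /= e0 eA]; exists (sre e).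
    by have := sre_lt e0; rewrite sre0.
  move=> y xy; apply: eA => /=.
  by rewrite rnormE (ge0_sinj (ltW e0)) lt_sinj.
move=> [e e0 eA]; apply/nbhs_normP; exists (sinj k e) => /=.
  by rewrite -[0](sinj0 R k) lt_sinj.
by move=> y /=; rewrite rnormE lt_sinj; exact: eA.
Qed.

Lemma cluster_rnorm (V : normedModType K) (I : Type) (F : set_system I)
    (f : I -> V) (z : V) (e : R) :
  ProperFilter F -> cluster (f @ F) z -> 0 < e -> forall A, F A ->
  exists2 i, A i & rnorm (z - f i) < e.
Proof.
move=> FF zc e0 A FA.
have nz : nbhs z [set y | rnorm (z - y) < e] by apply/nbhs_rnorm; exists e.
have FfA : F (f @^-1` (f @` A)) by apply: filterS FA => i Ai; exists i.
by have [_ [[i Ai <-] /= zi]] := zc (f @` A) _ FfA nz; exists i.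
Qed.

Lemma lipschitz_continuous (V W : normedModType K) (f : V -> W) (M : R) :
  (forall x y, rnorm (f x - f y) <= M * rnorm (x - y)) -> continuous f.
Proof.
move=> fM x A /nbhs_rnorm[e e0 eA].
have M1 : 0 < `|M| + 1 by rewrite ltr_wpDl.
apply/nbhs_rnorm; exists (e / (`|M| + 1)); first by rewrite divr_gt0.
move=> y; rewrite ltr_pdivlMr// => xy; apply: eA.
apply: le_lt_trans (fM x y) _; apply: le_lt_trans xy.
rewrite mulrC ler_wpM2l ?rnorm_ge0//; have := ler_norm M; lra.
Qed.

Lemma blin_continuous (V W : normedModType K) (T : blin V W) : continuous T.
Proof.
apply: (@lipschitz_continuous _ _ _ (rnorm T)) => x y.
by rewrite -linearB; exact: rnorm_blin.
Qed.

Lemma precompact_sub (V : normedModType K) (A C : set V) :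
  compact C -> A `<=` C -> precompact A.
Proof.
move=> cC AC; exists C => //; split => //.
by apply: compact_closed => //; exact: norm_hausdorff.
Qed.

Lemma compact_comp (U V W : normedModType K) (S : blin V W) (T : blin U V) :
  compact_operator T -> compact_operator (bcomp S T).
Proof.
rewrite /compact_operator precompactE => cT.
apply: (@precompact_sub _ _ (S @` closure (T @` [set x : U | `|x| <= 1]))).
  apply: continuous_compact => //; apply: continuous_subspaceT.
  exact: blin_continuous.
move=> _ [x x1 <-]; exists (T x) => //; apply: subset_closure; by exists x.
Qed.

Lemma real_curve_continuous (V : normedModType K) (v : V) :
  continuous (fun a : R => sinj k a *: v).
Proof.
move=> a A /nbhs_rnorm[e e0 eA].
have M1 : 0 < rnorm v + 1 by rewrite ltr_wpDl// rnorm_ge0.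
apply/nbhs_normP; exists (e / (rnorm v + 1)); first by rewrite /= divr_gt0.
move=> b /=; rewrite ltr_pdivlMr// => ab; apply: eA.
rewrite -scalerBl -sinjB rnormZ rnorm_sinj; apply: le_lt_trans ab.
by rewrite ler_wpM2l// lerDl.
Qed.

(** The image of the unit ball under a rank one operator lies in such a set, for
    either scalar field. *)
Lemma plane_compact (V : normedModType K) (v w : V) (M : R) :
  compact [set sinj k p.1 *: v + sinj k p.2 *: w |
    p in `[(- M), M]%classic `*` `[(- M), M]%classic].
Proof.
apply: continuous_compact; last by apply: compact_setX; exact: segment_compact.
apply: continuous_subspaceT => -[a b].
apply: cvgD => /=.
  apply: (cvg_comp fst (fun a => sinj k a *: v)); first exact: cvg_fst.
  exact: real_curve_continuous.
apply: (cvg_comp snd (fun a => sinj k a *: w)); first exact: cvg_snd.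
exact: real_curve_continuous.
Qed.

Section RankOne.
Variables (U V : normedModType K) (phi : dual U) (v : V).

Lemma rank_one_linear : linear (fun x => (phi x : K) *: v).
Proof. by move=> l x y; rewrite linearP scalerDl scalerA. Qed.

Lemma rank_one_bound x : rnorm ((phi x : K) *: v) <= rnorm phi * rnorm v * rnorm x.
Proof.
rewrite rnormZ mulrAC ler_wpM2r ?rnorm_ge0//; exact: rnorm_blin.
Qed.

Definition rank_one : blin U V := blin_of rank_one_linear rank_one_bound.

Lemma rank_oneE x : rank_one x = (phi x : K) *: v.
Proof. by []. Qed.

Lemma rnorm_rank_one : rnorm rank_one <= rnorm phi * rnorm v.
Proof.
apply: rnorm_blin_le; first by rewrite mulr_ge0// rnorm_ge0.
exact: rank_one_bound.
Qed.

Lemma rank_one_compact : compact_operator rank_one.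
Proof.
pose M := (rnorm (simag R k) + 1) * rnorm phi.
apply: (@precompact_sub V _ _ (@plane_compact V v (- simag R k *: v) M)).
move=> _ [x /= x1 <-]; set z : K := phi x.
have zM : rnorm z <= rnorm phi.
  apply: (le_trans (rnorm_blin _ _)); rewrite ler_piMr ?rnorm_ge0//.
  by have := sre_le x1; rewrite sre1.
have p0 := rnorm_ge0 phi; have i0 := rnorm_ge0 (simag R k : K).
have ip := mulr_ge0 i0 p0.
exists (sre z, sre (simag R k * z)); last first.
  by rewrite /= scalerA -scalerDl mulrN [_ * simag R k]mulrC -simag_sq_split.
split; rewrite /= in_itv /= -ler_norml; apply: (le_trans (norm_sre_le _)).
  by rewrite /M mulrDl mul1r; lra.
rewrite rnormM /M mulrDl mul1r.
by have := ler_wpM2l i0 zM; lra.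
Qed.

End RankOne.
End Compactness.

(** * Matrix coefficients and the defect operator *)

Section MatrixCoefficient.
Variables (R : realType) (k : scalar_kind).
Local Notation K := (scalars R k).
Variables (X : normedModType K) (n_gt0 : 0 < numerical_index X).
Local Notation Z := (Lv n_gt0).
Local Notation J := (Kv n_gt0).
Local Notation E := (dual (dual X)).

Let n : R := sre (numerical_index X).
Let n0 : 0 < n := sre_numerical_index n_gt0.

Lemma adjointE (T : blin X X) (g : dual X) x : adjoint T g x = g (T x).
Proof. by []. Qed.

Lemma rnorm_adjoint (T : blin X X) (g : dual X) :
  rnorm (adjoint T g) <= rnorm g * rnorm T.
Proof.
apply: rnorm_blin_le; first by rewrite mulr_ge0 ?rnorm_ge0.
move=> x; rewrite adjointE -mulrA; apply: (le_trans (rnorm_blin _ _)).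
by rewrite ler_wpM2l ?rnorm_ge0// rnorm_blin.
Qed.

Lemma adjoint_linear (l : K) (S T : blin X X) (g : dual X) :
  adjoint (l *: S + T) g = l *: adjoint S g + adjoint T g.
Proof. by apply: blin_eqP => x; rewrite adjointE blinDE blinZE linearP. Qed.

Lemma adjoint_id (g : dual X) : adjoint (bid X) g = g.
Proof. exact: blin_eqP. Qed.

Lemma adjoint_comp (S T : blin X X) (g : dual X) :
  adjoint (bcomp S T) g = adjoint T (adjoint S g).
Proof. exact: blin_eqP. Qed.

Lemma rnorm_le_rv (T : blin X X) : rnorm T <= n^-1 * rv T.
Proof. by rewrite ler_pdivlMl//; exact: numerical_index_le. Qed.

Section Coefficient.
Variables (y : E) (g : dual X).

Lemma mcoef_linear : linear (fun T : Z => y (adjoint T g) : K^o).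
Proof.
move=> l S T.
have -> : adjoint (l *: S + T : blin X X) g = l *: adjoint S g + adjoint T g.
  exact: adjoint_linear.
exact: linearP.
Qed.

Lemma mcoef_bound (T : Z) :
  rnorm (y (adjoint T g)) <= rnorm y * rnorm g / n * rnorm T.
Proof.
apply: (le_trans (rnorm_blin _ _)); rewrite -!mulrA ler_wpM2l ?rnorm_ge0//.
apply: (le_trans (rnorm_adjoint _ _)); rewrite ler_wpM2l ?rnorm_ge0//.
exact: rnorm_le_rv.
Qed.

(** A weak* limit of the functionals T |-> x^* (T x) agrees with such a matrix
    coefficient on compact operators, but in general not on all operators. *)
Definition mcoef : dual Z := blin_of mcoef_linear mcoef_bound.

Lemma mcoefE (T : Z) : mcoef T = y (adjoint T g).
Proof. by []. Qed.

Lemma rnorm_mcoef : rnorm mcoef <= rnorm y * rnorm g / n.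
Proof.
apply: rnorm_blin_le; last exact: mcoef_bound.
by rewrite !mulr_ge0 ?rnorm_ge0// invr_ge0 ltW.
Qed.

End Coefficient.

Lemma mcoef_linear_l (l : K) y y' g : mcoef (l *: y + y') g = l *: mcoef y g + mcoef y' g.
Proof. exact: blin_eqP. Qed.

Lemma mcoef_linear_r (l : K) y g g' : mcoef y (l *: g + g') = l *: mcoef y g + mcoef y g'.
Proof.
apply: blin_eqP => T.
have -> : (l *: mcoef y g + mcoef y g') T = l *: (y (adjoint T g) : K^o) + y (adjoint T g') by [].
rewrite mcoefE.
have -> : adjoint T (l *: g + g') = l *: adjoint T g + adjoint T g' by exact: linearP.
exact: linearP.
Qed.

Variable P : {linear dual Z -> dual Z}.
Hypothesis J0 : J 0.
Hypothesis Jlin : forall (a : K) x y, J x -> J y -> J (a *: x + y).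
Hypothesis kerP : [set f | P f = 0] = annihilator J.
Hypothesis PP : forall f, P (P f) = P f.
Hypothesis Pnorm : forall f, `|f| = `|P f| + `|f - P f|.

Local Notation I := (idZ n_gt0).

Lemma rnorm_P_le f : rnorm (P f) <= rnorm f.
Proof. by rewrite (rnorm_P Pnorm f) lerDl rnorm_ge0. Qed.

Section Defect.
Variable y : E.

Definition defect_fun (g : dual X) : K^o := (y g : K^o) - P (mcoef y g) I.

Lemma defect_linear : linear defect_fun.
Proof.
move=> l g g'; rewrite /defect_fun.
have -> : P (mcoef y (l *: g + g')) I = l *: (P (mcoef y g) I : K^o) + P (mcoef y g') I.
  by rewrite mcoef_linear_r linearP.
have -> : y (l *: g + g') = l *: (y g : K^o) + y g' by exact: linearP.
by rewrite scalerBr opprD addrACA.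
Qed.

Lemma defect_bound g : rnorm (defect_fun g) <= (1 + n^-1) * rnorm y * rnorm g.
Proof.
apply: (le_trans (rnormD _ _)); rewrite rnormN -mulrA mulrDl mul1r.
apply: lerD; first exact: rnorm_blin.
apply: (le_trans (rnorm_blin _ _)).
apply: (@le_trans _ _ (rnorm (P (mcoef y g)))).
  by rewrite ler_piMr ?rnorm_ge0//; exact: rv_bid.
apply: (le_trans (rnorm_P_le _)); apply: (le_trans (rnorm_mcoef _ _)).
by rewrite mulrC.
Qed.

(** P (mcoef y g) is the extension of smallest norm of the restriction of
    mcoef y g to the compact operators; the defect compares the two at I. *)
Definition defect : E := blin_of defect_linear defect_bound.

Lemma defectE g : defect g = y g - P (mcoef y g) I.
Proof. by []. Qed.

Lemma rnorm_defect : rnorm defect <= (1 + n^-1) * rnorm y.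
Proof.
apply: rnorm_blin_le; last exact: defect_bound.
by rewrite mulr_ge0 ?rnorm_ge0// addr_ge0// invr_ge0 ltW.
Qed.

End Defect.

Lemma defect_linear_arg (l : K) y y' :
  defect (l *: y + y') = l *: defect y + defect y'.
Proof.
apply: blin_eqP => g.
have -> : (l *: defect y + defect y') g = l *: (defect y g : K^o) + defect y' g by [].
rewrite !defectE.
have -> : P (mcoef (l *: y + y') g) I = l *: (P (mcoef y g) I : K^o) + P (mcoef y' g) I.
  by rewrite mcoef_linear_l linearP.
have -> : (l *: y + y') g = l *: (y g : K^o) + y' g by [].
by rewrite scalerBr opprD addrACA.
Qed.

Lemma norming_vector (V : normedModType K) (f : dual V) (c : R) : 0 <= c ->
  c < rnorm f -> exists2 x : V, rnorm x <= 1 & c < rnorm (f x).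
Proof.
move=> c0 cf; apply: contrapT => H.
suff : rnorm f <= c by rewrite leNgt cf.
apply: rnorm_blin_le => // x.
have [->|x0] := eqVneq x 0; first by rewrite linear0 !rnorm0 mulr0.
have nx0 : 0 < rnorm x.
  rewrite lt_neqAle rnorm_ge0 andbT eq_sym.
  by apply: contra x0 => /eqP/rnorm_eq0 ->.
rewrite leNgt; apply/negP => lt; apply: H.
exists (sinj k (rnorm x)^-1 *: x).
  by rewrite rnormZ rnorm_sinj gtr0_norm ?invr_gt0// mulVf// lt0r_neq0.
rewrite linearZ /= rnormZ rnorm_sinj gtr0_norm ?invr_gt0//.
by rewrite ltr_pdivlMl// mulrC.
Qed.

(** A vector where f is larger than |z|, rescaled and rotated. *)
Lemma functional_value (V : normedModType K) (f : dual V) (z : K) :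
  rnorm z < rnorm f -> exists2 x : V, rnorm x <= 1 & f x = z.
Proof.
move=> zf.
have [x x1 zx] := norming_vector (rnorm_ge0 z) zf.
have fx0 : 0 < rnorm (f x) by apply: le_lt_trans zx; exact: rnorm_ge0.
have fxn : f x != 0 by apply: contraTN fx0 => /eqP ->; rewrite rnorm0 ltxx.
exists ((z / f x) *: x); last by rewrite linearZ /= [_ *: _](_ : _ = z / f x * f x)// mulfVK.
rewrite rnormZ -[1]mulr1; apply: ler_pM; rewrite ?rnorm_ge0//.
have : rnorm (z / f x) * rnorm (f x) <= 1 * rnorm (f x).
  by rewrite -rnormM mulfVK// mul1r ltW.
by rewrite ler_pM2r.
Qed.

(** For the operator phi (.) x of rank one, y ((phi (.) x)^* g) = g x * y phi.
    Take phi almost norming y, and x with g x equal to almost z g / y phi; the latter is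
    in reach since |z g| <= |y| |g|. *)
Lemma rank_one_match (y z : E) (g : dual X) (e : R) :
  rnorm z <= rnorm y -> 0 < e ->
  exists2 K0 : Z, J K0 & rv K0 <= 1 /\ rnorm (y (adjoint K0 g) - z g) <= e.
Proof.
move=> ky e0.
have [->|g0] := eqVneq g 0.
  exists 0 => //; split; first by rewrite -(scale0r 0) rvZ rnorm0 mul0r.
  have -> : adjoint (0 : Z) 0 = 0 :> dual X by exact: blin_eqP.
  have -> : y 0 - z 0 = 0 by rewrite (linear0 y) (linear0 z); exact: subrr.
  by rewrite rnorm0 ltW.
have ng : 0 < rnorm g.
  rewrite lt_neqAle rnorm_ge0 andbT eq_sym.
  by apply: contra g0 => /eqP/rnorm_eq0 ->.
have [y0|y0] := eqVneq (rnorm y) 0.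
  have yE : y = 0 by exact: rnorm_eq0.
  have kE : z = 0.
    by apply: rnorm_eq0; apply/le_anti; rewrite rnorm_ge0 andbT -y0.
  exists 0 => //; split; first by rewrite -(scale0r 0) rvZ rnorm0 mul0r.
  have -> : y (adjoint (0 : Z) g) - z g = 0 by rewrite yE kE; exact: subrr.
  by rewrite rnorm0 ltW.
have yp : 0 < rnorm y by rewrite lt_neqAle eq_sym y0 rnorm_ge0.
pose d := e / (rnorm y * rnorm g + e).
have den0 : 0 < rnorm y * rnorm g + e by rewrite addr_gt0// mulr_gt0.
have d0 : 0 < d by rewrite divr_gt0.
have d1 : d < 1 by rewrite ltr_pdivrMr// mul1r ltrDr mulr_gt0.
have dE : d * (rnorm y * rnorm g) <= e.
  have -> : d * (rnorm y * rnorm g) = e * ((rnorm y * rnorm g) / (rnorm y * rnorm g + e)).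
    by rewrite /d mulrAC mulrA.
  apply: ler_piMr; first exact: ltW.
  by rewrite ler_pdivrMr// mul1r lerDl; exact: ltW.
(* a functional almost norming y, with positive value *)
pose r := rnorm y * (1 - d / 2).
have r0 : 0 < r by rewrite mulr_gt0//; lra.
have ry : r < rnorm y by rewrite gtr_pMr//; lra.
have [phi phi1 phiE] : exists2 phi : dual X, rnorm phi <= 1 & y phi = sinj k r.
  by apply: functional_value; rewrite rnorm_sinj gtr0_norm.
have [x x1 gx] : exists2 x : X, rnorm x <= 1 & g x = (sinj k (1 - d) * z g) / sinj k r.
  apply: functional_value; rewrite -sinjV rnormM rnorm_sinj rnormM rnorm_sinj.
  rewrite !gtr0_norm ?invr_gt0//; last by lra.
  rewrite ltr_pdivrMr//.
  have := rnorm_blin z g => kg.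
  have kyg := le_trans kg (ler_wpM2r (ltW ng) ky).
  have d10 : 0 <= 1 - d by lra.
  apply: le_lt_trans (ler_wpM2l d10 kyg) _.
  have -> : rnorm g * r = (1 - d / 2) * (rnorm y * rnorm g) by rewrite /r; ring.
  by rewrite ltr_pM2r ?mulr_gt0//; lra.
exists (rank_one phi x : Z); first exact: rank_one_compact.
split.
  apply: (le_trans (rv_le_rnorm _)); apply: (le_trans (rnorm_rank_one _ _)).
  by rewrite -[1]mulr1; apply: ler_pM; rewrite ?rnorm_ge0.
have -> : adjoint (rank_one phi x) g = g x *: phi.
  apply: blin_eqP => w; rewrite adjointE rank_oneE.
  have -> : g ((phi w : K) *: x) = (phi w : K) * g x by rewrite linearZ.
  exact: mulrC.
have rn : sinj k r != 0 by rewrite -(sinj0 R k) gt_eqF// lt_sinj.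
have -> : y (g x *: phi) - z g = - (sinj k d * z g).
  have -> : y (g x *: phi) = g x * y phi by rewrite linearZ.
  by rewrite gx phiE mulfVK// sinjB sinj1; ring.
rewrite rnormN rnormM rnorm_sinj gtr0_norm//.
apply: le_trans dE; apply: ler_wpM2l; first exact: ltW.
by apply: (le_trans (rnorm_blin _ _)); rewrite ler_wpM2r// rnorm_ge0.
Qed.

End MatrixCoefficient.

(** * Perturbations of the identity *)

Section Steps.
Variables (R : realType) (k : scalar_kind).
Local Notation K := (scalars R k).
Variables (X : normedModType K) (n_gt0 : 0 < numerical_index X).
Local Notation Z := (Lv n_gt0).
Local Notation J := (Kv n_gt0).
Local Notation E := (dual (dual X)).
Local Notation I := (idZ n_gt0).
Local Notation sc := (sinj k).

Let n : R := sre (numerical_index X).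
Let n0 : 0 < n := sre_numerical_index n_gt0.

Variable P : {linear dual Z -> dual Z}.
Hypothesis J0 : J 0.
Hypothesis Jlin : forall (a : K) x y, J x -> J y -> J (a *: x + y).
Hypothesis kerP : [set f | P f = 0] = annihilator J.
Hypothesis PP : forall f, P (P f) = P f.
Hypothesis Pnorm : forall f, `|f| = `|P f| + `|f - P f|.

Local Notation B := (defect Pnorm).

(** A = K0 + lam (I - L) - I, where K0 has rank one and K0^** y is close to z at
    g, and L comes from [compact_near_identity].  As v (K0 + lam (I - L)) is at
    most 1 + eps, the numerical range of A has real parts at most eps, and
    [rnorm_id_add] applies.  For lam = 1 the multiples of I cancel. *)
Lemma step_operator (y z : E) (g : dual X) (lam h eps : R) :
  rnorm z <= rnorm y -> lam = 1 \/ lam = -1 -> 0 <= h -> h <= 1 ->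
  0 < eps -> eps <= 1/2 ->
  exists A : Z, [/\ rnorm (bid X + sc h *: (A : blin X X)) <=
      (1 + h ^+ 2 * (3 / n) ^+ 2) / (1 - h * eps),
    rnorm (y (adjoint (bid X + sc h *: (A : blin X X)) g) -
           (y + sc h *: (z - y + sc lam *: B y)) g) <= 2 * eps &
    lam = 1 -> J A].
Proof.
move=> ky lam1 h0 h1 e0 e1.
have lamn : rnorm (sc lam : K) = 1.
  by rewrite rnorm_sinj; case: lam1 => ->; rewrite ?normrN normr1.
have [K0 JK0 [K01 K0g]] := rank_one_match J0 g ky e0.
have e11 : eps <= 1 by lra.
have [L JL [L1 Lphi]] := compact_near_identity J0 Jlin kerP PP Pnorm (mcoef n_gt0 y g)
  JK0 K01 lamn e0 e11.
pose S : Z := K0 + sc lam *: (I - L); pose A : Z := S - I.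
have he : h * eps <= 1/2 by rewrite -[1/2]mul1r; apply: ler_pM => //; exact: ltW.
exists A; split.
- apply: le_trans (_ : _ <= (1 + h ^+ 2 * rnorm (A : blin X X) ^+ 2) / (1 - h * eps)) _.
    apply: rnorm_id_add => //; first by lra.
    move=> f x fx; have /numerical_pairsP[/= _ _ fx1] := fx.
    have -> : f ((A : blin X X) x) = f ((S : blin X X) x) - 1.
      by rewrite -fx1 -linearB.
    rewrite sreB sre1; have := sre_le_rnorm (f ((S : blin X X) x)).
    by have := rv_pair (S : blin X X) fx; move: L1; rewrite -/S; lra.
  rewrite ler_pM2r ?invr_gt0; last by lra.
  rewrite lerD2l; apply: ler_wpM2l; first exact: sqr_ge0.
  rewrite ler_pXn2r ?nnegrE ?rnorm_ge0//; last by rewrite divr_ge0// ltW.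
  apply: (le_trans (rnorm_le_rv n_gt0 (A : blin X X))).
  rewrite mulrC; apply: ler_wpM2r; first by rewrite invr_ge0 ltW.
  have := rvD (S : blin X X) (- bid X); rewrite rvN => AS.
  by apply: (le_trans AS); move: L1; rewrite -/S; have := rv_bid X; lra.
- pose phi := mcoef n_gt0 y g.
  have vA : y (adjoint (A : blin X X) g) =
      phi K0 + sc lam * (y g - phi L) - y g.
    have -> : y (adjoint (A : blin X X) g) = phi A by [].
    have -> : phi A = phi S - phi I by rewrite linearB.
    have -> : phi S = phi K0 + phi (sc lam *: (I - L)) by rewrite linearD.
    have -> : phi (sc lam *: (I - L)) = sc lam * phi (I - L) by rewrite linearZ.
    have -> : phi (I - L) = phi I - phi L by rewrite linearB.
    have -> : phi I = y g by rewrite /phi mcoefE adjoint_id.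
    by [].
  have -> : y (adjoint (bid X + sc h *: (A : blin X X)) g) =
      y g + sc h * y (adjoint (A : blin X X) g).
    have -> : adjoint (bid X + sc h *: (A : blin X X)) g =
        sc h *: adjoint (A : blin X X) g + g.
      by rewrite addrC adjoint_linear adjoint_id.
    by rewrite linearP addrC.
  have -> : (y + sc h *: (z - y + sc lam *: B y)) g =
      y g + sc h * (z g - y g + sc lam * (y g - P phi I)) by [].
  rewrite vA.
  have -> : y g + sc h * (phi K0 + sc lam * (y g - phi L) - y g) -
      (y g + sc h * (z g - y g + sc lam * (y g - P phi I))) =
      sc h * ((phi K0 - z g) - sc lam * (phi L - P phi I)) by ring.
  rewrite rnormM rnorm_sinj ger0_norm//.
  have : rnorm ((phi K0 - z g) - sc lam * (phi L - P phi I)) <= 2 * eps.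
    apply: (le_trans (rnormD _ _)); rewrite rnormN rnormM lamn mul1r.
    have := Lphi; rewrite -/phi; have : rnorm (phi K0 - z g) <= eps by exact: K0g.
    lra.
  by have := rnorm_ge0 ((phi K0 - z g) - sc lam * (phi L - P phi I)); nra.
- move=> l1; rewrite /A /S l1 sinj1 scale1r.
  have -> : K0 + (I - L) - I = -1 *: L + K0.
    by rewrite scaleN1r addrA addrAC addrK addrC.
  exact: Jlin.
Qed.

Lemma le_of_eps (x a h : R) : 0 <= a -> 0 <= h -> h <= 1 ->
  (forall e, 0 < e -> e <= 1/2 -> x <= a / (1 - h * e) + 2 * e) -> x <= a.
Proof.
move=> a0 h0 h1 H; rewrite leNgt; apply/negP => ax.
pose d := x - a; have d0 : 0 < d by rewrite subr_gt0.
pose e := Num.min (1/2) (d / (2 * (2 * a + 2))).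
have den : 0 < 2 * (2 * a + 2) by lra.
have e0 : 0 < e by rewrite lt_min; apply/andP; split; [lra|exact: divr_gt0].
have e1 : e <= 1/2 by rewrite ge_min lexx.
have e2 : e * (2 * (2 * a + 2)) <= d by rewrite -ler_pdivlMr// ge_min lexx orbT.
have he : h * e <= e by rewrite ler_piMl// ltW.
have he0 : 0 <= h * e by rewrite mulr_ge0// ltW.
have q : a / (1 - h * e) <= a * (1 + 2 * e).
  rewrite ler_pdivrMr; last by lra.
  rewrite -mulrA ler_peMr//.
  have := mulr_ge0 he0 (ltW e0); have := ler_wpM2r (ltW e0) he; nra.
by have := H e e0 e1; rewrite /d in e2; lra.
Qed.

(** [step_operator] with z = y, where the term z - y vanishes; the two signs of
    lam give the two signs of s. *)
Lemma defect_flow (s : R) (y : E) : `|s| <= 1 ->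
  rnorm (y + sc s *: B y) <= (1 + (3 / n) ^+ 2 * s ^+ 2) * rnorm y.
Proof.
move=> s1.
have [h [lam [h0 h1 sE lam1]]] : exists h lam : R,
    [/\ 0 <= h, h <= 1, s = h * lam & lam = 1 \/ lam = -1].
  have [s0|s0] := lerP 0 s.
    by exists s, 1; split; rewrite ?mulr1//; [rewrite -(ger0_norm s0)|left].
  exists (- s), (-1); split; rewrite ?mulrNN ?mulr1//; [lra| |by right].
  by rewrite -(ltr0_norm s0).
have s2 : s ^+ 2 = h ^+ 2.
  by rewrite sE exprMn; case: lam1 => ->; rewrite ?sqrrN expr1n mulr1.
have c0 : 0 <= 1 + (3 / n) ^+ 2 * s ^+ 2.
  by rewrite addr_ge0// mulr_ge0// sqr_ge0.
apply: rnorm_blin_le; first by rewrite mulr_ge0// rnorm_ge0.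
move=> g; apply: (@le_of_eps _ _ h) => //; first by rewrite !mulr_ge0// rnorm_ge0.
move=> e e0 e1.
have [A [A1 A2 _]] := step_operator g (lexx (rnorm y)) lam1 h0 h1 e0 e1.
set O := bid X + _ in A1 A2.
have yE : y + sc h *: (y - y + sc lam *: B y) = y + sc s *: B y.
  by rewrite subrr add0r scalerA -sinjM -sE.
rewrite yE in A2.
have : rnorm ((y + sc s *: B y) g) <= rnorm (y (adjoint O g)) + 2 * e.
  have -> : (y + sc s *: B y) g = y (adjoint O g) - (y (adjoint O g) - (y + sc s *: B y) g).
    by ring.
  by apply: (le_trans (rnormD _ _)); rewrite rnormN lerD2l.
move/le_trans; apply; rewrite lerD2r.
apply: (le_trans (rnorm_blin _ _)).
have := rnorm_adjoint O g => Og.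
apply: (le_trans (ler_wpM2l (rnorm_ge0 y) Og)).
have := ler_wpM2l (mulr_ge0 (rnorm_ge0 y) (rnorm_ge0 g)) A1.
rewrite -mulrA => /le_trans; apply.
rewrite s2 [(3 / n) ^+ 2 * _]mulrC.
by rewrite le_eqVlt; apply/orP; left; apply/eqP; ring.
Qed.

End Steps.

(** * Transport of bounds on the bidual *)

Section Walkable.
Variables (R : realType) (k : scalar_kind).
Local Notation K := (scalars R k).
Variables (X : normedModType K) (n_gt0 : 0 < numerical_index X).
Local Notation Z := (Lv n_gt0).
Local Notation J := (Kv n_gt0).
Local Notation E := (dual (dual X)).
Local Notation sc := (sinj k).

Let n : R := sre (numerical_index X).
Let n0 : 0 < n := sre_numerical_index n_gt0.

Variable P : {linear dual Z -> dual Z}.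
Hypothesis J0 : J 0.
Hypothesis Jlin : forall (a : K) x y, J x -> J y -> J (a *: x + y).
Hypothesis kerP : [set f | P f = 0] = annihilator J.
Hypothesis PP : forall f, P (P f) = P f.
Hypothesis Pnorm : forall f, `|f| = `|P f| + `|f - P f|.

Definition real_defect (y : realified E) : realified E := defect Pnorm (y : E).

Lemma real_defect_linear : linear real_defect.
Proof. move=> l y z; exact: (defect_linear_arg Pnorm (sc l) (y : E) (z : E)). Qed.

HB.instance Definition _ := GRing.isLinear.Build R (realified E) (realified E) _
  real_defect real_defect_linear.

(** Bounds over compact perturbations of I survive a step because such a
    perturbation times I + h A, with A compact, is again one. *)
Definition probe (g : dual X) (eta : R) (y : realified E) (gam : R) : Prop :=
  forall H : Z, J H -> rnorm (bid X + (H : blin X X)) <= 1 + eta ->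
    sre ((y : E) (adjoint (bid X + (H : blin X X)) g)) <= gam.

Lemma le_of_small (x gam m : R) : 0 < m ->
  (forall e, 0 < e -> e <= m -> x <= gam + 2 * e) -> x <= gam.
Proof.
move=> m0 H; rewrite leNgt; apply/negP => gx.
pose e := Num.min m ((x - gam) / 4).
have e0 : 0 < e by rewrite lt_min m0 /=; lra.
have e1 : e <= m by rewrite ge_min lexx.
have e2 : e <= (x - gam) / 4 by rewrite ge_min lexx orbT.
by have := H e e0 e1; lra.
Qed.

(** The product (I + H) (I + h A) has norm at most
    (1 + eta) (1 + O(h^2)) / (1 - h eps), which accounts for the loss in the
    tolerance once eps <= h. *)
Lemma probe_move (g : dual X) (h eta : R) (z y : E) (gam : R) :
  let C := 1 + 3 / n in
  0 < h -> h <= 1 -> 0 <= eta -> eta + 2 * C ^+ 2 * h ^+ 2 <= 1 ->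
  rnorm z <= rnorm y -> probe g (eta + 2 * C ^+ 2 * h ^+ 2) y gam ->
  probe g eta (y + sc h *: (z - y + defect Pnorm y)) gam.
Proof.
move=> C h0 h1 eta0 etaC ky My H JH H1.
have [c cE] : {c : R | c = 3 / n} by eexists.
have c0 : 0 <= c by rewrite cE divr_ge0// ltW.
have CE : C = 1 + c by rewrite cE.
have m0 : 0 < Num.min (1/2) h by rewrite lt_min h0 andbT; lra.
apply: (le_of_small m0) => e e0; rewrite le_min => /andP[e1 e2].
set O := bid X + _ in H1 *.
have [A [A1 A2 /(_ erefl) JA]] := step_operator J0 Jlin kerP PP Pnorm (adjoint O g) ky
  (or_introl erefl) (ltW h0) h1 e0 e1.
rewrite sinj1 scale1r in A2.
set O' := bid X + _ in A1 A2.
set w : E := y + _ in A2 *.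
have JH' : J (H + (sc h *: A + bcomp (sc h *: (H : blin X X)) (A : blin X X)) : Z).
  have JZ a (S : Z) : J S -> J (a *: S) by move=> JS; rewrite -[a *: S]addr0; exact: Jlin.
  have JD (S T : Z) : J S -> J T -> J (S + T).
    by move=> JS JT; rewrite -[S]scale1r; exact: Jlin.
  apply: (JD) => //; apply: (JD); first exact: JZ.
  by apply: compact_comp; exact: JA.
have OE : bid X + (H + (sc h *: A + bcomp (sc h *: (H : blin X X)) (A : blin X X)) : blin X X) =
    bcomp O O'.
  apply: blin_eqP => x.
  rewrite bcompE /O /O' !blinDE !blinZE !bidE !bcompE blinZE.
  have -> : H (x + sc h *: A x) = H x + sc h *: H (A x) by rewrite linearD linearZ.
  by rewrite !addrA; congr (_ + _); rewrite addrAC.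
have n1 : rnorm (bcomp O O') <= 1 + (eta + 2 * C ^+ 2 * h ^+ 2).
  apply: (le_trans (rnorm_bcomp _ _)).
  apply: (le_trans (ler_pM (rnorm_ge0 _) (rnorm_ge0 _) H1 A1)).
  have he : h * e <= h * h by rewrite ler_pM2l.
  have hh : h * h <= h by rewrite ler_piMr// ltW.
  have he2 : h * e <= 1 / 2.
    by rewrite -[1/2]mul1r; apply: ler_pM => //; exact: ltW.
  rewrite mulrA ler_pdivrMr; last by move: he2; lra.
  rewrite -cE.
  have hc : 0 <= h ^+ 2 * c ^+ 2 by rewrite mulr_ge0// sqr_ge0.
  have eta1 : eta <= 1.
    have : 0 <= 2 * C ^+ 2 * h ^+ 2 by rewrite -mulrA -exprMn mulr_ge0 ?sqr_ge0.
    by move: etaC; lra.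
  have e3 := ler_wpM2r hc eta1.
  have CC : h * h + h ^+ 2 * c ^+ 2 <= C ^+ 2 * h ^+ 2.
    rewrite CE -subr_ge0.
    have -> : (1 + c) ^+ 2 * h ^+ 2 - (h * h + h ^+ 2 * c ^+ 2) = 2 * c * h ^+ 2 by ring.
    by rewrite mulr_ge0 ?sqr_ge0// mulr_ge0.
  have he0 : 0 <= h * e by rewrite mulr_ge0// ltW.
  have e4 := ler_wpM2l he0 etaC.
  move: e3 CC e4 he; rewrite -!mulrA; set u := h ^+ 2 * c ^+ 2; set v := C ^+ 2 * h ^+ 2.
  nra.
have B1 := My _ JH' (eq_ind_r (fun O => is_true (rnorm O <= _)) n1 OE).
rewrite OE adjoint_comp in B1.
have -> : w (adjoint O g) =
    y (adjoint O' (adjoint O g)) - (y (adjoint O' (adjoint O g)) - w (adjoint O g)).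
  by ring.
rewrite sreB.
have := sre_le_rnorm (- (y (adjoint O' (adjoint O g)) - w (adjoint O g))).
rewrite sreN rnormN => s1.
by move: B1 A2 s1; lra.
Qed.

Lemma probe_walkable (g : dual X) : rnorm g <= 1 ->
  walkable (fun y : realified E => rnorm (y : E)) real_defect (1 + 3 / n) 2 (probe g).
Proof.
move=> g1.
have c0 : 0 <= 3 / n by rewrite divr_ge0// ltW.
have C2 : (3 / n) ^+ 2 <= (1 + 3 / n) ^+ 2.
  by rewrite ler_pXn2r ?nnegrE ?lerDr// addr_ge0.
split.
- by rewrite lerDl.
- by [].
- by move=> x y; exact: rnormD.
- by move=> l x; rewrite realifiedZ rnormZ rnorm_sinj.
- move=> y; apply: (le_trans (rnorm_defect Pnorm y)).
  rewrite ler_wpM2r ?rnorm_ge0// lerD2l -/n.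
  by rewrite ler_peMl ?invr_ge0 ?(ltW n0)//; lra.
- move=> s y s1; apply: (le_trans (defect_flow J0 Jlin kerP PP Pnorm y s1)).
  by rewrite ler_wpM2r ?rnorm_ge0// lerD2l ler_wpM2r// sqr_ge0.
- move=> eta y z gam eta0 eta1 My H JH H1.
  have -> : (z : E) (adjoint (bid X + (H : blin X X)) g) =
    (y : E) (adjoint (bid X + (H : blin X X)) g) +
    ((z : E) - y) (adjoint (bid X + (H : blin X X)) g).
    have zE : (z : E) = (y : E) + ((z : E) - y) by rewrite addrC subrK.
    by rewrite {1}zE.
  rewrite sreD; apply: lerD; first exact: My.
  apply: (le_trans (sre_le_rnorm _)); apply: (le_trans (rnorm_blin _ _)).
  rewrite mulrC ler_wpM2r ?rnorm_ge0//.
  apply: (le_trans (rnorm_adjoint _ _)).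
  rewrite -[2]mul1r; apply: ler_pM; rewrite ?rnorm_ge0//.
  by apply: le_trans H1 _; lra.
- by move=> eta y gam gam' gg My H JH H1; apply: le_trans gg; exact: My.
- move=> eta l y gam l0 My H JH H1.
  by rewrite realifiedZ blinZE sreZ ler_wpM2l//; exact: My.
- by move=> h eta z y gam h0 h1 eta0 etaC ky My; exact: probe_move.
Qed.

End Walkable.

(** * The defect forces the pairing *)

Section Alignment.
Variables (R : realType) (k : scalar_kind).
Local Notation K := (scalars R k).
Variables (X : normedModType K) (n_gt0 : 0 < numerical_index X).
Local Notation Z := (Lv n_gt0).
Local Notation J := (Kv n_gt0).
Local Notation E := (dual (dual X)).
Local Notation I := (idZ n_gt0).
Local Notation sc := (sinj k).

Let n : R := sre (numerical_index X).
Let n0 : 0 < n := sre_numerical_index n_gt0.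

Variable P : {linear dual Z -> dual Z}.
Hypothesis J0 : J 0.
Hypothesis Jlin : forall (a : K) x y, J x -> J y -> J (a *: x + y).
Hypothesis kerP : [set f | P f = 0] = annihilator J.
Hypothesis PP : forall f, P (P f) = P f.
Hypothesis Pnorm : forall f, `|f| = `|P f| + `|f - P f|.

(** P (mcoef y g) = f because the two agree on J.  The bound that starts the
    walk is y ((I + H)^* g) = y g - 1 + f (I + H), of real part at most
    Re (y g) + eta when |I + H| <= 1 + eta.  The walk takes place from the unit
    vector a = y / |y|, with g' = |y| g in place of g to keep the values. *)
Lemma compact_state_pairing (f : dual Z) (y : E) (g : dual X) :
  rnorm f <= 1 -> f I = 1 -> P f = f -> rnorm y <= 1 -> rnorm g <= 1 ->
  (forall H, J H -> f H = y (adjoint H g)) ->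
  P (mcoef n_gt0 y g) = f /\ y g = 1.
Proof.
move=> f1 fI Pf y1 g1 fJ.
have PvE : P (mcoef n_gt0 y g) = f.
  apply: subr0_eq; rewrite -[X in _ - X]Pf -linearB; apply/(ker_P kerP) => T JT.
  have -> : (mcoef n_gt0 y g - f) T = mcoef n_gt0 y g T - f T by [].
  by rewrite mcoefE (fJ _ JT); exact: subrr.
split=> //.
have B0 : defect Pnorm (0 : E) = 0 by exact: (linear0 (real_defect Pnorm)).
have Byg : defect Pnorm y g = y g - 1 by rewrite defectE PvE fI.
have [r rE] : {r : R | r = rnorm y} by eexists.
have r0 : 0 < r.
  rewrite rE lt_neqAle rnorm_ge0 andbT eq_sym; apply/negP => /eqP/rnorm_eq0 y0.
  move: Byg; rewrite y0 B0 => /eqP.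
  have -> : (0 : E) g = 0 :> K by [].
  by rewrite sub0r eq_sym oppr_eq0 oner_eq0.
have rn : sc r != 0 by rewrite -(sinj0 R k) gt_eqF// lt_sinj.
have [a aE] : {a : E | a = sc r^-1 *: y} by eexists.
have [g' gE] : {g' : dual X | g' = sc r *: g} by eexists.
have a1 : rnorm a = 1.
  by rewrite aE rnormZ rnorm_sinj gtr0_norm ?invr_gt0// -rE mulVf// lt0r_neq0.
have g'1 : rnorm g' <= 1.
  rewrite gE rnormZ rnorm_sinj gtr0_norm// -[1]mulr1.
  by apply: ler_pM; rewrite ?rnorm_ge0 ?rE//; rewrite -rE ltW.
have ag (S : blin X X) : a (adjoint S g') = y (adjoint S g).
  rewrite aE gE.
  have -> : adjoint S (sc r *: g) = sc r *: adjoint S g by rewrite linearZ.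
  have -> : (sc r^-1 *: y) (sc r *: adjoint S g) = sc r^-1 * (sc r * y (adjoint S g)).
    by rewrite blinZE linearZ.
  by rewrite mulrA -sinjM mulVf ?lt0r_neq0// sinj1 mul1r.
have ag1 : a g' = y g by rewrite -[g']adjoint_id ag adjoint_id.
have Bag : defect Pnorm a g' = y g - 1.
  rewrite -Byg aE gE.
  have := defect_linear_arg Pnorm (sc r^-1) y 0; rewrite !addr0 => ->.
  rewrite B0 addr0.
  have -> : (sc r^-1 *: defect Pnorm y) (sc r *: g) = sc r^-1 * (sc r * defect Pnorm y g).
    by rewrite blinZE linearZ.
  by rewrite mulrA -sinjM mulVf ?lt0r_neq0// sinj1 mul1r.
pose c : K := y g.
have c1 : rnorm c <= 1.
  apply: (le_trans (rnorm_blin _ _)); rewrite -[1]mulr1.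
  by apply: ler_pM; rewrite ?rnorm_ge0.
suff c2 : 1 <= sre c.
  have cE := rnorm_le_sre (le_trans c1 c2).
  rewrite -/c cE; have -> : sre c = 1; last exact: sinj1.
  by apply/le_anti; rewrite c2 (le_trans (sre_le_rnorm _) c1).
have W := probe_walkable J0 Jlin kerP PP Pnorm g'1.
pose nu (z : realified E) : R := rnorm (z : E).
have bnd_end (z : realified E) gam : probe n_gt0 g' 0 z gam -> sre ((z : E) g') <= gam.
  move=> /(_ 0 J0); rewrite !addr0 => H.
  have -> : (z : E) g' = (z : E) (adjoint (bid X) g') by rewrite adjoint_id.
  by move: H; apply; exact: rnorm_bid.
have bnd_start eta : 0 < eta -> eta <= 1 -> probe n_gt0 g' eta (a : realified E) (sre c + eta).
  move=> eta0 eta1 H JH H1; rewrite ag.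
  have -> : y (adjoint (bid X + (H : blin X X)) g) = c - 1 + f (I + H).
    have -> : f (I + H) = f I + f H by rewrite linearD.
    rewrite fI (fJ _ JH) addrA subrK.
    have -> : adjoint (bid X + (H : blin X X)) g = g + adjoint H g.
      by have := adjoint_linear 1 (bid X) H g; rewrite !scale1r adjoint_id.
    by rewrite linearD.
  rewrite sreD sreB sre1.
  have := sre_le_rnorm (f (I + H)); have := rnorm_blin f (I + H).
  have : rnorm f * rnorm (I + H) <= 1 * (1 + eta).
    apply: ler_pM; rewrite ?rnorm_ge0//.
    exact: (le_trans (rv_le_rnorm _) H1).
  lra.
have [C CE] : {C : R | C = 1 + 3 / n} by eexists.
rewrite -CE in W.
case: (W) => C1 _ nuD nuZ nuB nuF _ _ _ _.
(* [radial_bound] at q = a - t B a.  Both estimates of nu q come from the flow: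
   q is one step of it from a, and one step back from q gives a - t^2 B^2 a. *)
have bound t : 0 < t -> t * C ^+ 2 <= 1/16 -> 1 - sre c <= 2 * C ^+ 2 * t.
  move=> t0 tC.
  have C2 : C <= C ^+ 2 by rewrite expr2 ler_peMl// (le_trans ler01).
  have C21 : 1 <= C ^+ 2 by apply: le_trans C2.
  have tC1 := ler_wpM2l (ltW t0) C2; have t1 := ler_wpM2l (ltW t0) C21.
  pose B : realified E -> realified E := real_defect Pnorm.
  pose q : realified E := (a : realified E) - t *: B a.
  have Ba : nu (B a) <= C by have := nuB a; rewrite /= a1 mulr1.
  have BBa : nu (B (B a)) <= C ^+ 2.
    apply: (le_trans (nuB (B a))); rewrite expr2 ler_wpM2l//.
    by apply: le_trans C1.
  have qa : nu (q - a) <= 1/16.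
    have -> : q - a = - (t *: B a) by rewrite /q addrAC subrr add0r.
    rewrite -scaleNr /nu nuZ normrN gtr0_norm//.
    by have := ler_wpM2l (ltW t0) Ba; rewrite /nu; lra.
  have := radial_bound W bnd_end bnd_start a1 qa.
  have -> : sre ((q : E) g') = sre c - t * (sre c - 1).
    have -> : (q : E) g' = a g' - sc t * defect Pnorm a g' by [].
    by rewrite Bag ag1 sreB sreZ sreB sre1.
  have tn : `|t| <= 1 by rewrite gtr0_norm//; lra.
  have u1 : nu q <= 1 + C ^+ 2 * t ^+ 2.
    have tN : `|- t| <= 1 by rewrite normrN.
    have := nuF (- t) (a : realified E) tN.
    rewrite a1 mulr1 sqrrN; apply: le_trans.
    by rewrite /q /nu scaleNr.
  have u2 : 1 - t ^+ 2 * C ^+ 2 <= (1 + C ^+ 2 * t ^+ 2) * nu q.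
    apply: le_trans (nuF t q tn).
    have -> : q + t *: real_defect Pnorm q = (a : realified E) - (t ^+ 2) *: B (B a).
      rewrite /q -/B; have -> : B (a - t *: B a) = B a - t *: B (B a).
        by rewrite /B linearB linearZ.
      by rewrite scalerBr addrA subrK scalerA -expr2.
    have := nuD (a - t ^+ 2 *: B (B a)) (t ^+ 2 *: B (B a)).
    rewrite subrK a1 nuZ ger0_norm ?sqr_ge0//.
    by have := ler_wpM2l (sqr_ge0 t) BBa; rewrite /nu; lra.
  have v0 : 0 <= C ^+ 2 * t ^+ 2 by rewrite mulr_ge0// sqr_ge0.
  have [v vE] : {v : R | v = C ^+ 2 * t ^+ 2} by eexists.
  have [m mE] : {m : R | m = nu q} by eexists.
  have m0 : 0 <= m by rewrite mE /nu rnorm_ge0.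
  have [s sE] : {s : R | s = sre c} by eexists.
  have s1 : `|s| <= 1 by rewrite sE; exact: le_trans (norm_sre_le _) c1.
  rewrite -/(nu q) -mE -sE => b1.
  rewrite -mE -vE in u1; rewrite [t ^+ 2 * _]mulrC -mE -vE in u2.
  rewrite -vE in v0.
  have m1 : `|m - 1| <= 2 * v.
    rewrite ler_norml; apply/andP; split; last by lra.
    by have := ler_wpM2l v0 u1; nra.
  have sm : s * (m - 1) <= 2 * v.
    apply: (le_trans (ler_norm _)); rewrite normrM -[2 * v]mul1r.
    exact: ler_pM.
  rewrite -(ler_pM2l t0).
  have -> : t * (2 * C ^+ 2 * t) = 2 * v by rewrite vE; ring.
  lra.
rewrite leNgt; apply/negP => lt.
have C20 : 0 < C ^+ 2 by rewrite exprn_gt0// (lt_le_trans ltr01).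
pose t := Num.min (1/16) ((1 - sre c) / 4) / C ^+ 2.
have t0 : 0 < t by rewrite divr_gt0// lt_min; apply/andP; split; lra.
have tC : t * C ^+ 2 = Num.min (1/16) ((1 - sre c) / 4) by rewrite mulfVK// lt0r_neq0.
have := bound t t0; rewrite -mulrA [C ^+ 2 * t]mulrC tC ge_min lexx => /(_ isT).
have : Num.min (1/16) ((1 - sre c) / 4) <= (1 - sre c) / 4 by rewrite ge_min lexx orbT.
lra.
Qed.

End Alignment.

(** * Limits along an ultrafilter *)

Section UltraLimits.
Variables (R : realType) (k : scalar_kind).
Local Notation K := (scalars R k).
Variables (I : Type) (F : set_system I).
Hypothesis FU : UltraFilter F.

Let FP : ProperFilter F := ultra_proper.

Definition tends (z : I -> K) (l : K) : Prop :=
  forall e : R, 0 < e -> F [set i | rnorm (z i - l) < e].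

Lemma tends_lin (a : K) z w l m : tends z l -> tends w m ->
  tends (fun i => a * z i + w i) (a * l + m).
Proof.
move=> zl wm e e0.
have n0 : 0 < rnorm a + 1 by have := rnorm_ge0 a; lra.
have d0 : 0 < e / 2 / (rnorm a + 1) by rewrite divr_gt0//; lra.
have e20 : 0 < e / 2 by lra.
apply: filterS (filterI (zl _ d0) (wm _ e20)) => i [/= zi wi].
have -> : a * z i + w i - (a * l + m) = a * (z i - l) + (w i - m) by ring.
apply: (le_lt_trans (rnormD _ _)); rewrite rnormM.
move: zi; rewrite ltr_pdivlMr// => zi.
by have := rnorm_ge0 (z i - l); nra.
Qed.

Lemma tends_unique z l m : tends z l -> tends z m -> l = m.
Proof.
move=> zl zm; apply: subr0_eq; apply: rnorm_eq0; apply/le_anti; rewrite rnorm_ge0 andbT.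
rewrite leNgt; apply/negP => d0; have d20 : 0 < rnorm (l - m) / 2 by lra.
have [i [/= zi zi']] := filter_ex (filterI (zl _ d20) (zm _ d20)).
suff : rnorm (l - m) < rnorm (l - m) by rewrite ltxx.
have {1}-> : l - m = (z i - m) - (z i - l) by ring.
by apply: (le_lt_trans (rnormD _ _)); rewrite rnormN; lra.
Qed.

Lemma tends_le z l M : F [set i | rnorm (z i) <= M] -> tends z l -> rnorm l <= M.
Proof.
move=> FM zl; rewrite leNgt; apply/negP => lM.
have d0 : 0 < rnorm l - M by lra.
have [i [/= zi zi']] := filter_ex (filterI FM (zl _ d0)).
have : rnorm l <= rnorm (z i) + rnorm (z i - l).
  by rewrite -(rnormN (z i - l)); have := rnormD (z i) (- (z i - l)); rewrite opprB addrC subrK.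
lra.
Qed.

Lemma tends_cst z l : F [set i | z i = l] -> tends z l.
Proof.
by move=> Fl e e0; apply: filterS Fl => i /= ->; rewrite subrr rnorm0.
Qed.

(** The limit is the supremum of the levels that q exceeds on a set of F; above
    it, an ultrafilter contains the complementary sets. *)
Lemma bounded_real_tends (q : I -> R) (M : R) : F [set i | `|q i| <= M] ->
  exists l, forall e, 0 < e -> F [set i | `|q i - l| < e].
Proof.
move=> FM; pose A := [set r | F [set i | r <= q i]].
have A0 : A (- M).
  by apply: filterS FM => i /=; rewrite ler_norml => /andP[].
have Aub r : A r -> r <= M.
  move=> Ar; have [i [/= qi]] := filter_ex (filterI Ar FM).
  by rewrite ler_norml => /andP[_]; exact: le_trans.
have sA : has_sup A by split; [exists (- M)|exists M => r /Aub].
exists (sup A) => e e0.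
have [r Ar rs] := sup_adherent e0 sA.
have nA : F [set i | q i < sup A + e].
  have [FA|FA] := in_ultra_setVsetC [set i | sup A + e <= q i] FU.
    have := ub_le_sup sA.2 FA; lra.
  by apply: filterS FA => i /= /negP; rewrite ltNge.
apply: filterS (filterI Ar nA) => i [/= ri qi]; rewrite ltr_norml.
by apply/andP; split; lra.
Qed.

Lemma bounded_tends (z : I -> K) (M : R) : F [set i | rnorm (z i) <= M] ->
  exists l, tends z l.
Proof.
move=> FM; have i0 := rnorm_ge0 (simag R k : K).
have [a za] : exists l, forall e, 0 < e -> F [set i | `|sre (z i) - l| < e].
  apply: (@bounded_real_tends _ M); apply: filterS FM => i /=.
  by apply: le_trans; exact: norm_sre_le.
have [b zb] : exists l, forall e, 0 < e ->
    F [set i | `|sre (simag R k * z i) - l| < e].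
  apply: (@bounded_real_tends _ (rnorm (simag R k) * M)); apply: filterS FM => i /= zM.
  by apply: (le_trans (norm_sre_le _)); rewrite rnormM ler_wpM2l.
exists (sinj k a - simag R k * sinj k b) => e e0.
have n0 : 0 < rnorm (simag R k : K) + 1 by lra.
have d0 : 0 < e / 2 / (rnorm (simag R k : K) + 1) by rewrite divr_gt0//; lra.
have e20 : 0 < e / 2 by lra.
apply: filterS (filterI (za _ e20) (zb _ d0)) => i [/= ai bi].
rewrite {1}(simag_sq_split (z i)).
have -> : sinj k (sre (z i)) - simag R k * sinj k (sre (simag R k * z i)) -
    (sinj k a - simag R k * sinj k b) =
    sinj k (sre (z i) - a) - simag R k * sinj k (sre (simag R k * z i) - b).
  by rewrite !sinjB; ring.
apply: (le_lt_trans (rnormD _ _)); rewrite rnormN rnormM !rnorm_sinj.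
move: bi; rewrite ltr_pdivlMr// => bi.
by have := normr_ge0 (sre (simag R k * z i) - b); nra.
Qed.

(** Weak* compactness of balls, in the form of convergence along a given
    ultrafilter. *)
Lemma functional_tends (V : normedModType K) (phi : I -> dual V) (M : R) :
  F [set i | rnorm (phi i) <= M] ->
  exists f : dual V, rnorm f <= M /\ forall v, tends (fun i => phi i v) (f v).
Proof.
move=> FM.
have FMv v : F [set i | rnorm (phi i v) <= M * rnorm v].
  apply: filterS FM => i /= pM; apply: (le_trans (rnorm_blin _ _)).
  by rewrite ler_wpM2r// rnorm_ge0.
have [i0 /= i0M] := filter_ex FM.
have M0 : 0 <= M by apply: le_trans i0M; exact: rnorm_ge0.
have [f ft] : {f : V -> K^o | forall v, tends (fun i => phi i v) (f v)}.
  exists (fun v => projT1 (cid (bounded_tends (FMv v)))) => v.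
  exact: (projT2 (cid (bounded_tends (FMv v)))).
have flin : linear f.
  move=> a v w; apply: tends_unique (ft _) _.
  have H := tends_lin a (ft v) (ft w).
  move=> e e0; apply: filterS (H e e0) => i /=.
  by have -> : phi i (a *: v + w) = a * phi i v + phi i w by exact: linearP.
have fM v : rnorm (f v) <= M * rnorm v by exact: tends_le (FMv v) (ft v).
exists (blin_of flin fM); split => //.
exact: rnorm_blin_le.
Qed.

End UltraLimits.

Section AdjointPairs.
Variables (R : realType) (k : scalar_kind).
Local Notation K := (scalars R k).
Variable X : normedModType K.
Local Notation E := (dual (dual X)).

(** Rotate S so that r = y (S^* g) is nonnegative.  Then 1 + h r is at most the
    norm of I + h S, which [rnorm_id_add] bounds by 1 + h (v S) + O(h^2); let h
    tend to 0. *)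
Lemma adjoint_pair_le (y : E) (g : dual X) (S : blin X X) :
  rnorm y <= 1 -> rnorm g <= 1 -> y g = 1 -> rnorm (y (adjoint S g)) <= rv S.
Proof.
move=> y1 g1 yg.
have [u u1 uE] := phase (y (adjoint S g)).
have [r rE] : {r : R | r = rnorm (y (adjoint S g))} by eexists.
have [m mE] : {m : R | m = rv S} by eexists.
rewrite -rE -mE; rewrite -rE in uE.
have m0 : 0 <= m by rewrite mE rv_ge0.
have r0 : 0 <= r by rewrite rE rnorm_ge0.
have [M ME] : {M : R | M = rnorm (u *: S) ^+ 2} by eexists.
have M0 : 0 <= M by rewrite ME sqr_ge0.
have step h : 0 <= h -> h * m < 1 -> (1 + h * r) * (1 - h * m) <= 1 + h ^+ 2 * M.
  move=> h0 hm; rewrite -ler_pdivlMr; last by lra.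
  rewrite ME.
  have := rnorm_id_add (A := u *: S) h0 hm; rewrite mE => H.
  apply: le_trans (H _) => [|f x fx]; last first.
    apply: (le_trans (sre_le_rnorm _)); rewrite blinZE.
    have -> : f (u *: S x) = u * f (S x) by rewrite linearZ.
    by rewrite rnormM u1 mul1r; exact: rv_pair.
  have yO : y (adjoint (bid X + sinj k h *: (u *: S)) g) = 1 + sinj k h * sinj k r.
    have -> : adjoint (bid X + sinj k h *: (u *: S)) g = g + (sinj k h * u) *: adjoint S g.
      have -> : bid X + sinj k h *: (u *: S) = (sinj k h * u) *: S + bid X.
        by rewrite scalerA addrC.
      by rewrite adjoint_linear adjoint_id addrC.
    have -> : y (g + (sinj k h * u) *: adjoint S g) = y g + (sinj k h * u) * y (adjoint S g).
      by rewrite linearD linearZ.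
    by rewrite yg -mulrA uE.
  have : 1 + h * r = sre (y (adjoint (bid X + sinj k h *: (u *: S)) g)).
    by rewrite yO sreD sre1 sreZ sinjK.
  move=> ->; apply: (le_trans (sre_le_rnorm _)); apply: (le_trans (rnorm_blin _ _)).
  rewrite -[leRHS]mul1r; apply: ler_pM; rewrite ?rnorm_ge0//.
  apply: (le_trans (rnorm_adjoint _ _)).
  by rewrite -[leRHS]mul1r; apply: ler_pM; rewrite ?rnorm_ge0.
rewrite leNgt; apply/negP => mr.
have den : 0 < 2 * (M + r * m + m + 1).
  by have := mulr_ge0 r0 m0; lra.
pose h := Num.min 1 (r - m) / (2 * (M + r * m + m + 1)).
have mn : 0 < Num.min 1 (r - m) by rewrite lt_min; apply/andP; split; lra.
have h0 : 0 < h by rewrite divr_gt0.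
have hE : h * (2 * (M + r * m + m + 1)) = Num.min 1 (r - m) by rewrite mulfVK// lt0r_neq0.
have hE1 : h * (2 * (M + r * m + m + 1)) <= 1 by rewrite hE ge_min lexx.
have hE2 : h * (2 * (M + r * m + m + 1)) <= r - m by rewrite hE ge_min lexx orbT.
have p1 := mulr_ge0 (ltW h0) m0; have p2 := mulr_ge0 (ltW h0) M0.
have p3 := mulr_ge0 (ltW h0) (mulr_ge0 r0 m0).
have hm : h * m < 1 by lra.
have := step h (ltW h0) hm.
have -> : (1 + h * r) * (1 - h * m) = 1 + h * (r - m - h * (r * m)) by ring.
rewrite lerD2l expr2 -mulrA ler_pM2l//.
lra.
Qed.

End AdjointPairs.

(** * Attainment for the adjoint *)

Section Evaluation.
Variables (R : realType) (k : scalar_kind).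
Local Notation K := (scalars R k).
Variables (X : normedModType K) (x : X).

Lemma eval_linear : linear (fun f : dual X => f x : K^o).
Proof. by []. Qed.

Lemma eval_bound (f : dual X) : rnorm (f x) <= rnorm x * rnorm f.
Proof. by rewrite mulrC; exact: rnorm_blin. Qed.

Definition eval : dual (dual X) := blin_of eval_linear eval_bound.

Lemma rnorm_eval : rnorm eval <= rnorm x.
Proof. by apply: rnorm_blin_le; [exact: rnorm_ge0|exact: eval_bound]. Qed.

End Evaluation.

Section Attainment.
Variables (R : realType) (k : scalar_kind).
Local Notation K := (scalars R k).
Variables (X : normedModType K) (n_gt0 : 0 < numerical_index X).
Local Notation Z := (Lv n_gt0).
Local Notation J := (Kv n_gt0).
Local Notation E := (dual (dual X)).
Local Notation I := (idZ n_gt0).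

Definition almost_attaining (T : Z) (e : R) : set (dual X * X) :=
  [set fx | numerical_pairs fx /\ rv T - e < rnorm (fx.1 (T fx.2))].

Lemma almost_attaining_filter (T : Z) : 0 < rv T ->
  ProperFilter (filter_from [set e : R | 0 < e] (almost_attaining T)).
Proof.
move=> T0; apply: filter_from_proper => [|e /= e0]; last first.
  by have [f [x [fx fTx]]] := rv_approx T0 e0; exists (f, x).
apply: filter_from_filter; first by exists 1; rewrite /= ltr01.
move=> d e /= d0 e0; exists (Num.min d e); first by rewrite /= lt_min d0.
have m1 : Num.min d e <= d by rewrite ge_min lexx.
have m2 : Num.min d e <= e by rewrite ge_min lexx orbT.
by move=> fx [Pfx lt]; split; split=> //; lra.
Qed.

Variable P : {linear dual Z -> dual Z}.
Hypothesis J0 : J 0.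
Hypothesis Jlin : forall (a : K) x y, J x -> J y -> J (a *: x + y).
Hypothesis kerP : [set f | P f = 0] = annihilator J.
Hypothesis PP : forall f, P (P f) = P f.
Hypothesis Pnorm : forall f, `|f| = `|P f| + `|f - P f|.

(** For compact H the points H x cluster at some z in norm, so near z both
    x^* (H x) and g (H x) are close to g z; the first tends to f H and the
    second to y (H^* g). *)
Lemma attaining_limit (T : Z) : 0 < rv T ->
  exists f : dual Z, exists y : E, exists g : dual X,
  [/\ [/\ rnorm f <= 1, rnorm y <= 1 & rnorm g <= 1], f I = 1,
      rv T <= rnorm (f T) & forall H, J H -> f H = y (adjoint H g)].
Proof.
move=> T0; have FT := almost_attaining_filter T0.
have [F [FU FTF]] := ultraFilterLemma FT.
have FP : ProperFilter F by exact: ultra_proper.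
have FA e : 0 < e -> F (almost_attaining T e).
  by move=> e0; apply: FTF; exists e.
have FN : F [set fx : dual X * X | numerical_pairs fx].
  by apply: filterS (FA 1 ltr01) => fx [].
pose phi (fx : dual X * X) : dual Z := mcoef n_gt0 (eval fx.2) fx.1.
have phiE fx (S : Z) : phi fx S = fx.1 (S fx.2) by [].
have [f [f1 ft]] : exists f : dual Z, rnorm f <= 1 /\ forall S, tends F (fun fx => phi fx S) (f S).
  apply: functional_tends => //; apply: filterS FN => -[f x] /= fx.
  by apply: rnorm_blin_le => // S; rewrite phiE mul1r; exact: rv_pair.
have [g [g1 gt]] : exists g : dual X, rnorm g <= 1 /\ forall v, tends F (fun fx => fx.1 v) (g v).
  apply: functional_tends => //; apply: filterS FN => fx /= /numerical_pairsP[-> _ _].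
  by [].
have [y [y1 yt]] : exists y : E, rnorm y <= 1 /\
    forall v, tends F (fun fx => eval fx.2 v) (y v).
  apply: functional_tends => //; apply: filterS FN => fx /= /numerical_pairsP[_ x1 _].
  by rewrite -x1; exact: rnorm_eval.
exists f, y, g; split=> //.
- apply: (tends_unique FU (ft I)); apply: tends_cst => //.
  by apply: filterS FN => fx /= /numerical_pairsP[_ _].
- rewrite leNgt; apply/negP => lt.
  have d0 : 0 < (rv T - rnorm (f T)) / 2 by lra.
  have [fx [[_ a1] /= a2]] := filter_ex (filterI (FA _ d0) (ft T _ d0)).
  have := rnormD (phi fx T - f T) (f T); rewrite subrK; rewrite phiE in a2 *.
  lra.
- move=> H JH.
  have cH : compact (closure (H @` [set x : X | `|x| <= 1])).
    by rewrite -precompactE; exact: JH.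
  have FHp : ProperFilter ((fun fx : dual X * X => H fx.2) @ F) by exact: fmap_proper_filter.
  have FHc : ((fun fx : dual X * X => H fx.2) @ F) (closure (H @` [set x : X | `|x| <= 1])).
    rewrite /nbhs /=; apply: filterS FN => fx /numerical_pairsP[_ x1 _].
    by apply: subset_closure; exists fx.2 => //=; rewrite rnormE x1 sinj1.
  have [z [_ zc]] := cH _ FHp FHc.
  apply: subr0_eq; apply: rnorm_eq0; apply/le_anti; rewrite rnorm_ge0 andbT.
  rewrite leNgt; apply/negP => d0.
  have [e eE] : {e : R | e = rnorm (f H - y (adjoint H g)) / 5} by eexists.
  have e0 : 0 < e by rewrite eE; lra.
  have FF : F ([set fx | numerical_pairs fx] `&`
      ([set fx | rnorm (phi fx H - f H) < e] `&` ([set fx : dual X * X | rnorm (fx.1 z - g z) < e] `&`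
      [set fx : dual X * X | rnorm (eval fx.2 (adjoint H g) - y (adjoint H g)) < e]))).
    by do !apply: filterI => //; [exact: ft|exact: gt|exact: yt].
  have [[h x] [/numerical_pairsP[/= h1 x1 _] [/= a1 [/= a2 a3]]] zx] := cluster_rnorm FP zc e0 FF.
  have {}a1 : rnorm (h (H x) - f H) < e by exact: a1.
  have hz : rnorm (h z - h (H x)) <= e.
    rewrite -linearB; apply: (le_trans (rnorm_blin _ _)); rewrite h1 mul1r; exact: ltW.
  have gz : rnorm (g z - g (H x)) <= e.
    rewrite -linearB; apply: (le_trans (rnorm_blin _ _)).
    rewrite -[e]mul1r; apply: ler_pM; rewrite ?rnorm_ge0//; exact: ltW.
  have a3' : rnorm (g (H x) - y (adjoint H g)) < e by exact: a3.
  suff : rnorm (f H - y (adjoint H g)) < 5 * e by rewrite eE; lra.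
  have -> : f H - y (adjoint H g) = - (h (H x) - f H) - (h z - h (H x)) + (h z - g z) +
     (g z - g (H x)) + (g (H x) - y (adjoint H g)) by ring.
  have tri (a b : K) : rnorm (a + b) <= rnorm a + rnorm b by exact: rnormD.
  set b1 := h (H x) - f H in a1 *; set b2 := h z - h (H x) in hz *.
  set b3 := h z - g z in a2 *; set b4 := g z - g (H x) in gz *.
  set b5 := g (H x) - _ in a3' *.
  have := tri (- b1 - b2 + b3 + b4) b5; have := tri (- b1 - b2 + b3) b4.
  have := tri (- b1 - b2) b3; have := tri (- b1) (- b2).
  rewrite !rnormN; lra.
Qed.

(** Since f - P f vanishes on S, the value f T is at most
    |P f| (v T) + |f - P f| (v (T - S)), where |P f| + |f - P f| <= 1; so any
    part of f outside the range of P would be a loss. *)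
Lemma state_in_range (T S : Z) (f : dual Z) : J S -> rv (T - S) < rv T ->
  rnorm f <= 1 -> rv T <= rnorm (f T) -> P f = f.
Proof.
move=> JS ST f1 fT.
have fE : f T = P f T + (f - P f) (T - S).
  have -> : (f - P f) (T - S) = (f - P f) T - (f - P f) S by rewrite linearB.
  have -> : (f - P f) S = f S - P f S by [].
  rewrite (P_on_J kerP PP f JS) subrr subr0.
  by have -> : (f - P f) T = f T - P f T by []; rewrite addrC subrK.
have := rnormD (P f T) ((f - P f) (T - S)); rewrite -fE.
have := rnorm_blin (P f) T; have := rnorm_blin (f - P f) (T - S).
rewrite !rnorm_Lv => b1 b2 b3.
have := rnorm_P Pnorm f; rewrite -/(rnorm f).
have p0 := rnorm_ge0 (P f); have q0 := rnorm_ge0 (f - P f).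
have T0 := rv_ge0 T; have TS0 := rv_ge0 (T - S).
move=> fPE; apply/esym; apply: subr0_eq; apply: rnorm_eq0.
move: f1 fT b1 b2 b3 fPE p0 q0 T0 TS0 ST.
set a := rnorm (P f); set b := rnorm (f - P f); set t := rv T; set s := rv (T - S).
set w := rnorm (f T); set w1 := rnorm (P f T); set w2 := rnorm ((f - P f) (T - S)).
move=> f1 fT b1 b2 b3 fPE p0 q0 T0 TS0 ST.
apply/le_anti; rewrite q0 andbT leNgt; apply/negP => b0.
have bts : 0 < b * (t - s) by rewrite mulr_gt0// subr_gt0.
have : (a + b) * t <= 1 * t by rewrite ler_wpM2r// -fPE.
by move: bts; rewrite mulrDl mulrBr; lra.
Qed.

(** The limits y and g form a pair for X* at which T^* attains: y g = 1 forces
    |mcoef y g| <= 1, and f = P (mcoef y g) already has norm 1. *)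
Lemma adjoint_attains (T S : Z) : J S -> rv (T - S) < rv T ->
  attains_numerical_radius (adjoint T).
Proof.
move=> JS ST; have T0 : 0 < rv T by apply: le_lt_trans ST; exact: rv_ge0.
have [f [y [g [[f1 y1 g1] fI fT fJ]]]] := attaining_limit T0.
have Pf := state_in_range JS ST f1 fT.
have [Pcoef yg] := compact_state_pairing J0 Jlin kerP PP Pnorm f1 fI Pf y1 g1 fJ.
have coef1 : rnorm (mcoef n_gt0 y g) <= 1.
  by apply: rnorm_blin_le => // S'; rewrite mcoefE mul1r; exact: adjoint_pair_le.
have f1' : 1 <= rnorm f.
  have := rnorm_blin f I; rewrite fI rnorm1 => /le_trans; apply.
  by rewrite ler_piMr ?rnorm_ge0//; exact: rv_bid.
have coef_f : mcoef n_gt0 y g = f.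
  apply: subr0_eq; apply: rnorm_eq0; apply/le_anti; rewrite rnorm_ge0 andbT.
  by have := rnorm_P Pnorm (mcoef n_gt0 y g); rewrite Pcoef; lra.
have yT : rv T <= rnorm (y (adjoint T g)) by rewrite -mcoefE coef_f.
have yg1 : 1 <= rnorm y * rnorm g.
  by apply: le_trans (rnorm_blin y g); rewrite yg rnorm1.
have pair : numerical_pairs (y, g).
  have := rnorm_ge0 y; have := rnorm_ge0 g => g0 y0.
  apply/numerical_pairsP; split=> //=; apply/le_anti.
    rewrite y1 /=; apply: (le_trans yg1); exact: ler_piMr.
  rewrite g1 /=; apply: (le_trans yg1); exact: ler_piMl.
have rvT : rv (adjoint T) <= rv T.
  apply: rv_le; first exact: rv_ge0.
  move=> y' g' /numerical_pairsP[/= y'1 g'1 yg'].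
  by apply: adjoint_pair_le; rewrite ?y'1 ?g'1.
exists (y, g) => //=; rewrite rnormE numerical_radius_sinj; congr sinj.
apply/le_anti; rewrite (rv_pair (adjoint T) pair) /=.
exact: le_trans rvT yT.
Qed.

End Attainment.

(** * Operators far from the compacts *)

Section Final.
Variables (R : realType) (k : scalar_kind).
Local Notation K := (scalars R k).

Lemma infimum_min (A : set K) (m : K) : A m -> (forall x, A x -> m <= x) ->
  infimum 0 A = m.
Proof.
move=> Am mA; have A0 : A != set0 by apply/set0P; exists m.
rewrite /infimum ifF; last exact/negbTE.
case: xgetP => [y _ [yA ylb]|/(_ m)]; last by case; split=> // y; apply.
by apply/le_anti; rewrite yA//= ylb.
Qed.

Variable X : normedModType K.

(** Without pairs v would vanish, and so would all operators; the infimum over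
    the empty set is 0 by convention. *)
Lemma numerical_pair_exists : 0 < numerical_index X ->
  exists f (x : X), numerical_pairs (f, x).
Proof.
move=> n_gt0; apply: contrapT => no.
have T0 (T : blin X X) : `|T| = 1 -> False.
  move=> T1; have : rv T <= 0.
    by apply: rv_le => // f x fx; exfalso; apply: no; exists f, x.
  have := numerical_index_le T n_gt0.
  by rewrite /rnorm T1 sre1 mulr1; have := sre_numerical_index n_gt0; lra.
move: n_gt0; rewrite /numerical_index.
rewrite (_ : [set T : blin X X | `|T| = 1] = set0); last first.
  by rewrite -subset0 => T /T0.
by rewrite image_set0 /infimum eqxx ltxx.
Qed.

Lemma numerical_pair_approx (T : blin X X) (e : R) : 0 < numerical_index X -> 0 < e ->
  exists f x, numerical_pairs (f, x) /\ rv T - e < rnorm (f (T x)).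
Proof.
move=> n_gt0 e0; have := rv_ge0 T; rewrite le_eqVlt => /orP[/eqP <-|T0].
  have [f [x fx]] := numerical_pair_exists n_gt0; exists f, x; split=> //.
  by have := rnorm_ge0 (f (T x)); lra.
exact: rv_approx.
Qed.

Variable n_gt0 : 0 < numerical_index X.
Local Notation Z := (Lv n_gt0).
Local Notation J := (Kv n_gt0).
Hypothesis J0 : J 0.
Hypothesis Jlin : forall (a : K) x y, J x -> J y -> J (a *: x + y).

Definition far_from_compacts (T : Z) : Prop := forall S : Z, J S -> rv T <= rv (T - S).

Lemma far_from_compacts_essential (T : Z) : far_from_compacts T ->
  numerical_radius T = essential_numerical_radius T.
Proof.
move=> TJ; apply/esym/infimum_min.
  by exists 0; [exact: J0|rewrite subr0].
by move=> _ [S JS <-]; rewrite !numerical_radius_sinj le_sinj; exact: TJ.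
Qed.

Lemma closure_far_from_compacts (A : set Z) :
  A `<=` far_from_compacts -> closure A `<=` far_from_compacts.
Proof.
move=> AR T clT S JS; rewrite leNgt; apply/negP => lt.
have [d dE] : {d : R | d = (rv T - rv (T - S)) / 2} by eexists.
have d0 : 0 < d by rewrite dE; lra.
have nT : nbhs T [set U | rnorm (T - U) < d] by apply/nbhs_rnorm; exists d.
have [U [/AR/(_ S JS) US /= TU]] := clT _ nT.
rewrite rnorm_Lv in TU.
have := rvD (T - U : blin X X) U; rewrite subrK.
have := rvD (U - T : blin X X) (T - S); rewrite addrA subrK.
have -> : rv (U - T : blin X X) = rv (T - U : blin X X) by rewrite -rvN opprB.
lra.
Qed.

(** At a pair where |x^* (T x)| > v T - e/4, adding (e/2) u x^* (.) x with a
    unimodular u aligned with x^* (T x) raises this modulus by e/2, above v T;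
    but T is a compact perturbation of the result. *)
Lemma far_from_compacts_interior : interior far_from_compacts = set0.
Proof.
rewrite -subset0 => T /nbhs_rnorm[e e0 eR].
have e40 : 0 < e / 4 by lra.
have [f [x [fx fTx]]] := numerical_pair_approx T n_gt0 e40.
have /numerical_pairsP[/= f1 x1 fx1] := fx.
have [u u1 uE] := phase (f (T x)).
have un : u != 0.
  by apply: contra_eq_neq u1 => ->; rewrite rnorm0 eq_sym oner_neq0.
have ui : rnorm u^-1 = 1.
  by have := rnormM u^-1 u; rewrite mulVf// rnorm1 u1 mulr1.
pose S : Z := (sinj k (e / 2) * u^-1) *: (rank_one f x : Z).
have JS : J S by rewrite -[S]addr0; apply: Jlin => //; exact: rank_one_compact.
have SE : rv S <= e / 2.
  rewrite rvZ rnormM rnorm_sinj ui mulr1 gtr0_norm ?divr_gt0//.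
  rewrite -[leRHS]mulr1 ler_wpM2l//; first by lra.
  apply: (le_trans (rv_le_rnorm _)); apply: (le_trans (rnorm_rank_one _ _)).
  by rewrite f1 x1 mulr1.
have : far_from_compacts (T + S).
  apply: eR; rewrite opprD addrA subrr add0r rnormN rnorm_Lv.
  by apply: le_lt_trans SE _; lra.
move=> /(_ S JS); rewrite addrK leNgt => /negP; apply.
apply: lt_le_trans (rv_pair (T + S : blin X X) fx).
have -> : f ((T + S : blin X X) x) = u^-1 * (sinj k (rnorm (f (T x))) + sinj k (e / 2)).
  rewrite blinDE blinZE rank_oneE fx1 scale1r.
  have -> : f (T x + (sinj k (e / 2) * u^-1) *: x) = f (T x) + (sinj k (e / 2) * u^-1) * f x.
    by rewrite linearD linearZ.
  by rewrite fx1 mulr1 mulrDr -uE mulrA mulVf// mul1r [u^-1 * _]mulrC.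
rewrite rnormM ui mul1r -sinjD rnorm_sinj.
have := rnorm_ge0 (f (T x)); have := ler_norm (rnorm (f (T x)) + e / 2); lra.
Qed.

End Final.

Theorem theorem2p18 (R : realType) (k : scalar_kind)
    (X : completeNormedModType (scalars R k))
    (n_gt0 : 0 < numerical_index X)
    (hM : M_ideal (Kv n_gt0)) :
  (forall T : Lv n_gt0, ~ attains_numerical_radius (adjoint T) ->
     numerical_radius T = essential_numerical_radius T) /\
  nowhere_dense [set T : Lv n_gt0 | ~ attains_numerical_radius (adjoint T)].
Proof.
have [[J0 Jlin _] [P [PP kerP Pnorm]]] := hM.
have rem (T : Lv n_gt0) : ~ attains_numerical_radius (adjoint T) -> far_from_compacts T.
  move=> nT S JS; rewrite leNgt; apply/negP => lt; apply: nT.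
  exact: (adjoint_attains J0 Jlin kerP PP Pnorm JS lt).
split; first by move=> T /rem; exact: far_from_compacts_essential.
rewrite /nowhere_dense -subset0 -(far_from_compacts_interior J0 Jlin).
by apply: interiorS; exact: closure_far_from_compacts.
Qed.
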